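(* Let $N\ge 3$ be an integer and let $1<q<2<s<\infty$. Put $q_0=\dfrac{2N}{2N-q(N-2)}$. Assume that $(k)$ $k\in L^{q_0}(\mathbb{R}^N)\cap L^\infty(\mathbb{R}^N)$, $k\ge 0$, $k\not\equiv 0$; $(h)$ $h\in L^1(\mathbb{R}^N)\cap L^\infty(\mathbb{R}^N)$, $h\ge 0$. Then the problem $$-\Delta u-u\Delta(u^2)=k(x)|u|^{q-2}u-h(x)|u|^{s-2}u,\qquad u\in D^{1,2}(\mathbb{R}^N),$$ has a nonnegative (weak) solution $u$ such that $J(u)<0$, where $$J(u)=\frac12\int_{\mathbb{R}^N}(1+2u^2)|\nabla u|^2-\frac1q\int_{\mathbb{R}^N}k|u|^q+\frac1s\int_{\mathbb{R}^N}h|u|^s .$$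
   Context: $D^{1,2}(\mathbb{R}^N)$ is the completion of $C_0^\infty(\mathbb{R}^N)$ under the norm $\left(\int_{\mathbb{R}^N}|\nabla v|^2\right)^{1/2}$, regarded as a space of functions in $L^{2N/(N-2)}(\mathbb{R}^N)$. $J$ is the energy functional of the problem; it is finite only on a proper subset of $D^{1,2}(\mathbb{R}^N)$. A (weak) solution is a function $u\in D^{1,2}(\mathbb{R}^N)$ with $J(u)$ finite such that $\frac{\mathrm d}{\mathrm dt}\big|_{t=0}J(u+t\phi)=0$ for every $\phi\in C_0^\infty(\mathbb{R}^N)$, that is, $$\int_{\mathbb{R}^N}\left[(1+2u^2)\nabla u\cdot\nabla\phi+2u|\nabla u|^2\phi\right]=\int_{\mathbb{R}^N}k|u|^{q-2}u\,\phi-\int_{\mathbb{R}^N}h|u|^{s-2}u\,\phi .$$ *)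

(* Defs.v *)
From HB Require Import structures.
From mathcomp Require Import all_boot all_order all_algebra.
From mathcomp Require Import all_classical all_reals all_analysis.
Set Implicit Arguments.
Unset Strict Implicit.
Unset Printing Implicit Defensive.
Import Order.TTheory GRing.Theory Num.Theory.
Import numFieldNormedType.Exports.
Local Open Scope classical_set_scope.
Local Open Scope ring_scope.

(* Row vectors carry the product sigma-algebra, generated by the coordinates;
   on R^n it is the Borel sigma-algebra. *)
Definition measure_rV_display : measure_display -> measure_display.
Proof. exact. Qed.

Section measurable_rV.
Context {d} {T : sigmaRingType d}.
Variable n : nat.

Let coors : 'I_n -> 'rV[T]_n -> T := fun i x => x ord0 i.

Let rV_set0 : g_sigma_preimage coors set0.
Proof. exact: sigma_algebra0. Qed.

Let rV_setC A : g_sigma_preimage coors A -> g_sigma_preimage coors (~` A).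
Proof. exact: sigma_algebraC. Qed.

Let rV_bigcup (F : _^nat) : (forall i, g_sigma_preimage coors (F i)) ->
  g_sigma_preimage coors (\bigcup_i (F i)).
Proof. exact: sigma_algebra_bigcup. Qed.

HB.instance Definition _ := @isMeasurable.Build (measure_rV_display d)
  ('rV[T]_n) (g_sigma_preimage coors) rV_set0 rV_setC rV_bigcup.

End measurable_rV.

Definition rV_of_tuple {T : Type} {n : nat} (t : n.-tuple T) : 'rV[T]_n :=
  \row_i tnth t i.

Lemma measurable_rV_of_tuple d (T : measurableType d) n :
  measurable_fun [set: n.-tuple T] (@rV_of_tuple T n).
Proof.
suff preim : g_sigma_preimage (fun i t => @rV_of_tuple T n t ord0 i)
    `<=` (measurable : set (set (n.-tuple T))).
  move=> _ A mA; rewrite setTI; apply: preim.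
  by rewrite (g_sigma_preimage_comp (fun i (x : 'rV[T]_n) => x ord0 i));
    exists A => //; rewrite setTI.
rewrite (_ : (fun i t => _) = (fun i (t : n.-tuple T) => tnth t i))//.
by apply/funext => i; apply/funext => t; rewrite mxE.
Qed.

Section lebesgue_rV.
Local Open Scope ereal_scope.
Context {R : realType}.

Definition cons_pair n (p : R * n.-tuple R) : n.+1.-tuple R :=
  [the n.+1.-tuple R of p.1 :: p.2].

Lemma measurable_cons_pair n : measurable_fun [set: R * n.-tuple R] (@cons_pair n).
Proof.
by apply: measurable_cons; [exact: measurable_fst|exact: measurable_snd].
Qed.

Section step.
Context n (mu : {sigma_finite_measure set (n.-tuple R) -> \bar R}).

Definition lebesgue_cons : set (n.+1.-tuple R) -> \bar R :=
  pushforward (@lebesgue_measure R \x mu) (@cons_pair n).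

Let lebesgue_cons0 : lebesgue_cons set0 = 0.
Proof. by rewrite /lebesgue_cons /pushforward preimage_set0 measure0. Qed.

Let lebesgue_cons_ge0 A : 0 <= lebesgue_cons A.
Proof. by apply: measure_ge0; exact: measurable_cons_pair. Qed.

Let lebesgue_cons_additive : semi_sigma_additive lebesgue_cons.
Proof. by apply: measure_semi_sigma_additive; exact: measurable_cons_pair. Qed.

HB.instance Definition _ := isMeasure.Build _ _ _ lebesgue_cons
  lebesgue_cons0 lebesgue_cons_ge0 lebesgue_cons_additive.

Let lebesgue_cons_sigma_finite : sigma_finite setT lebesgue_cons.
Proof.
have /sigma_finiteP[F [TF ndF Foo]] := sigma_finiteT (@lebesgue_measure R).
have /sigma_finiteP[G [TG ndG Goo]] := sigma_finiteT mu.
exists (fun k => [set t | F k (thead t) /\ G k [tuple of behead t]]).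
  apply/esym; rewrite -subTset => t _.
  have [i _ Fi] : (\bigcup_i F i) (thead t) by rewrite -TF.
  have [j _ Gj] : (\bigcup_i G i) [tuple of behead t] by rewrite -TG.
  exists (maxn i j) => //=; split.
    by move: Fi; exact/subsetPset/ndF/leq_maxl.
  by move: Gj; exact/subsetPset/ndG/leq_maxr.
move=> k; have [mF Fk] := Foo k; have [mG Gk] := Goo k; split.
  apply: measurableI; rewrite -[X in measurable X]setTI.
    exact: (measurable_tnth ord0).
  exact: measurable_behead.
rewrite /lebesgue_cons /pushforward.
rewrite (_ : _ @^-1` _ = F k `*` G k).
  by rewrite product_measure1E// lte_mul_pinfty// ge0_fin_numE.
apply/seteqP; split=> -[x t] /=;
  by rewrite theadE (_ : [tuple of _] = t)//; exact/val_inj.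
Qed.

HB.instance Definition _ := Measure_isSigmaFinite.Build _ _ _ lebesgue_cons
  lebesgue_cons_sigma_finite.

End step.

Fixpoint lebesgue_tuple (n : nat) :
    {sigma_finite_measure set (n.-tuple R) -> \bar R} :=
  match n with
  | 0 => \d_([tuple] : 0.-tuple R)
  | m.+1 => lebesgue_cons (lebesgue_tuple m)
  end.

(* N-dimensional Lebesgue measure: the N-fold product of the 1-dimensional one,
   carried over from tuples to row vectors. *)
Definition lebesgue_rV (N : nat) : set 'rV[R]_N -> \bar R :=
  pushforward (lebesgue_tuple N) (@rV_of_tuple R N).

Section measure.
Variable N : nat.

Let lebesgue_rV0 : lebesgue_rV (set0 : set 'rV[R]_N) = 0.
Proof. by rewrite /lebesgue_rV /pushforward preimage_set0 measure0. Qed.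

Let lebesgue_rV_ge0 (A : set 'rV[R]_N) : 0 <= lebesgue_rV A.
Proof. by apply: measure_ge0; exact: measurable_rV_of_tuple. Qed.

Let lebesgue_rV_additive : semi_sigma_additive (@lebesgue_rV N).
Proof. by apply: measure_semi_sigma_additive; exact: measurable_rV_of_tuple. Qed.

HB.instance Definition _ := isMeasure.Build _ _ _ (@lebesgue_rV N)
  lebesgue_rV0 lebesgue_rV_ge0 lebesgue_rV_additive.

End measure.

Lemma lebesgue_rV_box N (A : 'I_N -> set R) : (forall i, measurable (A i)) ->
  lebesgue_rV [set x : 'rV[R]_N | forall i, A i (x ord0 i)] =
  \prod_(i < N) lebesgue_measure (A i).
Proof.
move=> mA; rewrite /lebesgue_rV /pushforward.
rewrite (_ : _ @^-1` _ = [set t : N.-tuple R | forall i, A i (tnth t i)]); last first.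
  by apply/seteqP; split=> t /= + i => /(_ i); rewrite mxE.
have box_measurable n (B : 'I_n -> set R) : (forall i, measurable (B i)) ->
    measurable [set t : n.-tuple R | forall i, B i (tnth t i)].
  move=> mB; rewrite (_ : mkset _ = \bigcap_(i in [set: 'I_n])
      ((@tnth _ _ ^~ i) @^-1` B i)); last first.
    by apply/seteqP; split=> t /= Bt i; [move=> _|]; exact: Bt.
  apply: fin_bigcap_measurable => [|i _]; first exact: finite_finset.
  rewrite -[X in measurable X]setTI.
  by apply: measurable_tnth => //; exact: mB.
elim: N A mA => [|n IH] A mA.
  rewrite big_ord0 /= diracE mem_set//=; by case.
rewrite big_ord_recl -IH//=.
rewrite /lebesgue_cons /pushforward.
rewrite -[RHS](product_measure1E (@lebesgue_measure R) (lebesgue_tuple n) (mA ord0)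
  (box_measurable _ _ (fun i => mA (lift ord0 i)))).
congr (product_measure1 _ _ _); apply/seteqP; split=> -[x t] /=.
  move=> At; split; first exact: (At ord0).
  by move=> i; have := At (lift ord0 i); rewrite tnthS.
move=> [Ax At] i; case: (unliftP ord0 i) => [j|] ->//.
by rewrite tnthS.
Qed.

End lebesgue_rV.
Arguments lebesgue_rV {R} N.

Section sobolev.
Context {R : realType} {N : nat}.
Implicit Types (u phi f g : 'rV[R]_N -> R).
Local Notation E := ('rV[R]_N).
Local Notation mu := (@lebesgue_rV R N).

Definition partial (i : 'I_N) f : E -> R :=
  fun x => 'D_(delta_mx 0 i : E) f x.

Fixpoint Ck (m : nat) f : Prop :=
  continuous f /\
  if m is m'.+1 then
    forall i : 'I_N, (forall x, derivable f x (delta_mx 0 i : E)) /\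
                     Ck m' (partial i f)
  else True.

Definition C0infty phi : Prop :=
  (forall m, Ck m phi) /\ compact (closure [set x | phi x != 0]).

Definition L1loc f : Prop :=
  measurable_fun setT f /\
  forall K : set E, compact K -> (\int[mu]_(x in K) `|f x|%:E < +oo)%E.

Definition is_weak_partial (i : 'I_N) u g : Prop :=
  [/\ L1loc u, L1loc g &
   forall phi, C0infty phi ->
    (\int[mu]_x (u x * partial i phi x)%:E = - \int[mu]_x (g x * phi x)%:E)%E].

(* A chosen representative of the weak derivative, which is unique up to a.e.
   equality; the default value 0 is taken only when there is none, which does
   not happen in D^{1,2}. *)
Definition weak_partial (i : 'I_N) u : E -> R :=
  xget (fun=> 0) [set g | is_weak_partial i u g].

Definition sqr_grad u (x : E) : R := \sum_(i < N) weak_partial i u x ^+ 2.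

Definition crit_exp : R := (2 * N)%:R / (N - 2)%:R.

Definition dirichlet_norm phi : \bar R :=
  ((\int[mu]_x (\sum_(i < N) partial i phi x ^+ 2)%:E) `^ 2^-1)%E.

(* u is the limit in L^{2N/(N-2)} of test functions forming a Cauchy sequence
   for the Dirichlet norm, i.e. the function representing an element of the
   completion. *)
Definition D12 u : Prop :=
  u \in Lfun mu crit_exp%:E /\
  exists phi : (E -> R)^nat,
    [/\ forall n, C0infty (phi n),
        forall e : R, 0 < e -> exists n0 : nat, forall n m,
          (n0 <= n)%N -> (n0 <= m)%N ->
          (dirichlet_norm (phi n \- phi m)%R < e%:E)%E &
        ('N[mu]_crit_exp%:E[EFin \o (phi n \- u)%R] @[n --> \oo] --> 0)%E].

(* Takes values in ]-oo, +oo] on D^{1,2} under the hypotheses on k and h. *)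
Definition J (q s : R) (k h u : E -> R) : \bar R :=
  (2^-1%:E * \int[mu]_x ((1 + 2 * u x ^+ 2) * sqr_grad u x)%:E
   - q^-1%:E * \int[mu]_x (k x * `|u x| `^ q)%:E
   + s^-1%:E * \int[mu]_x (h x * `|u x| `^ s)%:E)%E.

(* J (u + t phi) is finite for all t when J u is, so that fine is harmless. *)
Definition critical (q s : R) (k h u : E -> R) : Prop :=
  forall phi, C0infty phi ->
    is_derive (0 : R) 1 (fun t : R => fine (J q s k h (fun x => u x + t * phi x))) 0.

(* |u|^(q-2) u vanishes where u does, as it should for q > 1. *)
Definition weak_equation (q s : R) (k h u : E -> R) : Prop :=
  forall phi, C0infty phi ->
    (\int[mu]_x ((1 + 2 * u x ^+ 2) *
                   (\sum_(i < N) weak_partial i u x * partial i phi x)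
                 + 2 * u x * sqr_grad u x * phi x)%:E =
     \int[mu]_x (k x * `|u x| `^ (q - 2) * u x * phi x)%:E
     - \int[mu]_x (h x * `|u x| `^ (s - 2) * u x * phi x)%:E)%E.

Definition weak_solution (q s : R) (k h u : E -> R) : Prop :=
  [/\ D12 u, J q s k h u \is a fin_num,
      critical q s k h u & weak_equation q s k h u].

End sobolev.

(* Main.v *)
(* For nonnegative test functions u and v put z = sqrt ((u^2 + v^2) / 2). Since
   |dw|^2 / w is jointly convex in (w, dw), u^2 |du|^2 = |d(u^2)|^2 / 4 is
   quadratic in u^2, and w^(q/2) is concave and w^(s/2) convex, the energy satisfies
   J(z) <= (J(u) + J(v)) / 2 - |d(u^2 - v^2)|^2 / 16, the norm being that of L^2.
   So the squares of a minimizing sequence f_n of nonnegative test functions are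
   Cauchy in D^{1,2}; along a subsequence f_n tends to u a.e. and d(f_n^2) to
   2 u du in L^2. By Mazur's lemma convex combinations of the f_n converge to u in
   D^{1,2}, and Fatou's lemma gives J(u) <= inf J, which is negative because q < 2.

   The energy of f_n itself need not converge, so minimality is not used at u:
   J(f_n + t phi) is at most J(f_n) + t L_n + C t^2, up to the terms in k and h,
   with C independent of n. Letting n, then t, tend to their limits gives the
   equation, since the linear terms L_n only need d(f_n^2) to converge strongly
   and df_n weakly. *)
Require Import Defs.
From HB Require Import structures.
From mathcomp Require Import all_boot all_order all_algebra.
From mathcomp Require Import all_classical all_reals all_analysis.
From mathcomp Require Import measurable_realfun.
From mathcomp Require Import ring lra.
Set Implicit Arguments.
Unset Strict Implicit.
Unset Printing Implicit Defensive.
Import Order.TTheory GRing.Theory Num.Theory.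
Import numFieldNormedType.Exports.
Local Open Scope classical_set_scope.
Local Open Scope ring_scope.

(** * Integration *)

(** Minimality fails to reach u for the following reason. All competitors are test functions, and
    J(u + t phi) >= m would require approximating u + t phi by them in energy, which is more than
    convergence in D^{1,2}. Each f_n + t phi, on the other hand, is itself a competitor. Two places
    resist the substitution w = u^2. The square root is not smooth where w vanishes, so the mean of
    u and v is regularized; only the k-term pays for it, with an error made arbitrarily small by a
    parameter. And d(u^2) determines du only where u is nonzero. On the set u = 0 the gradient is
    taken from Mazur's convex combinations, while the products 2 f_n df_n are shown to tend to 0
    there, so that both sources give the same 2 u du. The subsequences extracted below come with one
    integrable majorant for all their errors, which turns most limits into dominated convergence.
    Quantities that are merely bounded, such as the integrals of |f_n|^p and h |f_n|^s, enter
    through Young's inequality with a small weight. *)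

Section real_integrals.
Context d (T : measurableType d) (R : realType) (mu : {measure set T -> \bar R}).
Implicit Types (f g : T -> R).
Local Notation intg f := (mu.-integrable setT (EFin \o f)).

Lemma intg_measurable f : intg f -> measurable_fun setT f.
Proof. by move=> /integrableP[/measurable_EFinP]. Qed.

Lemma Rintegral_EFin f : intg f -> (\int[mu]_x f x)%:E = (\int[mu]_x (f x)%:E)%E.
Proof. by move=> fi; rewrite fineK//; exact: integrable_fin_num. Qed.

Lemma intg_le f g : measurable_fun setT f -> intg g ->
  (forall x, `|f x| <= g x) -> intg f.
Proof.
move=> mf gi fg; apply: (le_integrable _ _ _ gi) => //; first exact/measurable_EFinP.
by move=> x _; rewrite /= lee_fin (le_trans (fg x))// ler_norm.
Qed.

Lemma intg_ge0 f : measurable_fun setT f -> (forall x, 0 <= f x) ->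
  (\int[mu]_x (f x)%:E < +oo)%E -> intg f.
Proof.
move=> mf f0 fi; apply/integrableP; split; first exact/measurable_EFinP.
rewrite (eq_integral (fun x => (f x)%:E))// => x _.
by rewrite /= ger0_norm.
Qed.

Lemma eq_intg f g : (forall x, f x = g x) -> intg f -> intg g.
Proof. by move=> /funext ->. Qed.

Lemma intgD f g : intg f -> intg g -> intg (fun x => f x + g x).
Proof. by move=> fi gi; apply: eq_integrable (integrableD measurableT fi gi). Qed.

Lemma intgZ (c : R) f : intg f -> intg (fun x => c * f x).
Proof. by move=> fi; apply: eq_integrable (integrableZl measurableT c fi). Qed.

Lemma intgB f g : intg f -> intg g -> intg (fun x => f x - g x).
Proof. by move=> fi gi; apply: eq_integrable (integrableB measurableT fi gi). Qed.

Lemma intg0 : intg (fun=> 0 : R).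
Proof. exact: integrable0. Qed.

Lemma intg_sum n (f : 'I_n -> T -> R) : (forall i, intg (f i)) ->
  intg (fun x => \sum_i f i x).
Proof.
elim: n f => [|n IH] f fi.
  by apply: eq_intg intg0 => x; rewrite big_ord0.
by apply: (@eq_intg (fun x => f ord0 x + \sum_i f (lift ord0 i) x)) =>
  [x|]; [rewrite big_ord_recl|apply: intgD => //; exact: IH].
Qed.

Lemma Rint_eq f g : (forall x, f x = g x) -> \int[mu]_x f x = \int[mu]_x g x.
Proof. by move=> fg; apply: eq_Rintegral => x _. Qed.

Lemma RintD f g : intg f -> intg g ->
  \int[mu]_x (f x + g x) = \int[mu]_x f x + \int[mu]_x g x.
Proof. by move=> fi gi; rewrite RintegralD. Qed.

Lemma RintB f g : intg f -> intg g ->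
  \int[mu]_x (f x - g x) = \int[mu]_x f x - \int[mu]_x g x.
Proof. by move=> fi gi; rewrite RintegralB. Qed.

Lemma RintZ (c : R) f : intg f -> \int[mu]_x (c * f x) = c * \int[mu]_x f x.
Proof. by move=> fi; rewrite RintegralZl. Qed.

Lemma Rint_sum n (f : 'I_n -> T -> R) : (forall i, intg (f i)) ->
  \int[mu]_x (\sum_i f i x) = \sum_i \int[mu]_x f i x.
Proof.
elim: n f => [|n IH] f fi.
  rewrite big_ord0; under Rint_eq do rewrite big_ord0.
  by rewrite /Rintegral integral0.
rewrite big_ord_recl -IH// -RintD//; last exact: intg_sum.
by apply: Rint_eq => x; rewrite big_ord_recl.
Qed.

Lemma Rint_le f g : intg f -> intg g -> (forall x, f x <= g x) ->
  \int[mu]_x f x <= \int[mu]_x g x.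
Proof. by move=> fi gi fg; apply: le_Rintegral. Qed.

Lemma Rint_ge0 f : (forall x, 0 <= f x) -> 0 <= \int[mu]_x f x.
Proof. by move=> f0; apply: Rintegral_ge0. Qed.

End real_integrals.

(** * Borel sets, cubes and integrability on row vectors *)

Section measure_rV.
Context {R : realType} {N : nat}.
Local Notation E := ('rV[R]_N).
Local Notation mu := (@lebesgue_rV R N).

Lemma measurable_coord (i : 'I_N) : measurable_fun [set: E] (fun x : E => x ord0 i).
Proof.
move=> _ A mA; rewrite setTI; apply: sub_sigma_algebra => /=.
rewrite -bigcup_seq/=; exists i => /=; first by rewrite mem_index_enum.
by exists A => //; rewrite setTI.
Qed.

Lemma measurable_box (A : 'I_N -> set R) : (forall i, measurable (A i)) ->
  measurable [set x : E | forall i, A i (x ord0 i)].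
Proof.
move=> mA; rewrite (_ : mkset _ = \bigcap_(i in [set: 'I_N])
    ((fun x : E => x ord0 i) @^-1` A i)); last first.
  by apply/seteqP; split=> t /= Bt i; [move=> _|]; exact: Bt.
apply: fin_bigcap_measurable => [|i _]; first exact: finite_finset.
by rewrite -[X in measurable X]setTI; apply: measurable_coord => //; exact: mA.
Qed.

(** The sigma-algebra is generated by the coordinates, so an open set has to be exhausted by
    countably many boxes: those with rational centre and radius 1/(n+1) that it contains. *)
Lemma open_measurable_rV (U : set E) : open U -> measurable U.
Proof.
move=> oU.
pose b (p : 'rV[rat]_N * nat) : set E :=
  [set x | forall i, ball (ratr (p.1 ord0 i) : R) (p.2.+1%:R^-1) (x ord0 i)].
have mb p : measurable (b p).
  apply: (@measurable_box (fun i => ball (ratr (p.1 ord0 i) : R) (p.2.+1%:R^-1))) => i.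
  exact: measurable_ball.
rewrite (_ : U = \bigcup_p (if `[< b p `<=` U >] then b p else set0)).
  apply: countable_bigcupT_measurable; first exact: countableP.
  by move=> p; case: ifP.
apply/seteqP; split=> [x Ux|x [p _]]; last by case: ifPn => // /asboolP; exact.
have [e /= e0 xeU] : exists2 e : R, 0 < e & ball x e `<=` U.
  by apply/nbhs_ballP; exact: open_nbhs_nbhs.
have [n ne] : exists n, n.+1%:R^-1 < e / 2.
  exists (Num.truncn ((e / 2)^-1)).
  by rewrite -ltf_pV2 ?posrE// ?invr_gt0// ?divr_gt0// invrK truncnS_gt.
have n0 : 0 < n.+1%:R^-1 :> R by rewrite invr_gt0.
have r i : {r : rat | ball (ratr r : R) (n.+1%:R^-1) (x ord0 i)}.
  apply/cid; have : x ord0 i < x ord0 i + n.+1%:R^-1 by rewrite ltrDl.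
  move=> /rat_in_itvoo[r]; rewrite in_itv/= => /andP[r1 r2]; exists r.
  by rewrite /ball/= ger0_norm ?subr_ge0 ?ltW// ltrBlDr addrC.
exists (\row_i sval (r i), n) => //.
suff bU : b (\row_i sval (r i), n) `<=` U.
  by rewrite asboolT// => i /=; rewrite mxE; exact: (svalP (r i)).
move=> y /= ynU; apply: xeU; split=> // k i; rewrite (ord1 k).
have := svalP (r i); have := ynU i; rewrite mxE => yr xr.
rewrite (splitr e).
apply: ball_triangle (le_ball (ltW ne) (ball_sym xr)) (le_ball (ltW ne) yr).
Qed.

Lemma continuous_measurable_rV (f : E -> R) : continuous f -> measurable_fun setT f.
Proof.
move=> /continuousP cf.
apply: (measurability _ (RGenOpens.measurableE R)).
move=> _ [_ [a [b ->] <-]]; rewrite setTI; apply: open_measurable_rV.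
exact/cf/interval_open.
Qed.

(** Cubes serve as the standard compact sets: the product formula shows that their measure is
    finite, and every compact set lies in one. *)
Definition cube (M : R) : set E := [set x | forall i, `[- M, M]%classic (x ord0 i)].

Lemma measurable_cube M : measurable (cube M).
Proof. by apply: (@measurable_box (fun=> `[- M, M]%classic)). Qed.

Lemma cube_ltoo M : (mu (cube M) < +oo)%E.
Proof.
rewrite /cube (lebesgue_rV_box (A := fun=> `[- M, M]%classic))//.
suff /andP[] : (0 <= \prod_(i < N) @lebesgue_measure R `[(- M)%R, M]%classic < +oo)%E by [].
apply: (big_ind (fun x : \bar R => 0 <= x < +oo)%E) => [|x y /andP[x0 xy] /andP[y0 yy]|i _].
- by rewrite lee01 ltry.
- by rewrite mule_ge0// lte_mul_pinfty// ge0_fin_numE.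
- by rewrite measure_ge0/= lebesgue_measure_itv/=; case: ifP => // _; rewrite ltry.
Qed.

Lemma compact_cube (K : set E) : compact K -> exists2 M : R, 0 < M & K `<=` cube M.
Proof.
move=> /compact_bounded[M [Mr KM]].
exists (`|M| + 1) => [|x Kx i /=]; first by rewrite ltr_wpDl.
have : `|x| <= `|M| + 1 by apply: KM => //; rewrite (le_lt_trans (ler_norm _))// ltrDl.
rewrite in_itv/= -ler_norml; apply: le_trans.
rewrite [leRHS]/Num.Def.normr/= mx_normrE.
by apply/bigmax_geP; right => /=; exists (ord0, i).
Qed.

Lemma integrable_bounded (f : E -> R) (M C : R) : measurable_fun setT f ->
  (forall x, `|f x| <= C) -> (forall x, ~ cube M x -> f x = 0) ->
  mu.-integrable setT (EFin \o f).
Proof.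
move=> mf fC f0; apply/integrableP; split; first exact/measurable_EFinP.
apply: (@le_lt_trans _ _ (\int[mu]_x (C%:E * (\1_(cube M) x)%:E))%E).
  apply: ge0_le_integral => //=.
  - by apply/measurable_EFinP; apply: measurableT_comp.
  - apply/measurable_EFinP/measurable_funM => //; apply: measurable_indic; exact: measurable_cube.
  - move=> x _; rewrite -EFinM lee_fin indicE.
    case: (pselect (cube M x)) => [xM|xM]; first by rewrite mem_set// mulr1.
    by rewrite f0// normr0 memNset// mulr0.
have C0 : 0 <= C by rewrite (le_trans _ (fC 0)).
rewrite ge0_integralZl_EFin//; last first.
  by apply/measurable_EFinP; apply: measurable_indic; exact: measurable_cube.
rewrite integral_indic ?setIT//; last exact: measurable_cube.
by rewrite lte_mul_pinfty//; exact: cube_ltoo.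
Qed.

End measure_rV.

(** * Smooth functions with compact support *)

Section directional.
Context {R : realType} {V : normedModType R}.
Implicit Types (f g : V -> R) (x v : V).

(** Restricting to a line turns directional derivatives into derivatives of one real variable, where
    the chain rule and the fundamental theorem of calculus apply. *)
Lemma is_derive_line f x v (t : R) df :
  is_derive (x + t *: v) v f df <-> is_derive t 1 (fun s => f (x + s *: v)) df.
Proof.
split=> -[]; rewrite /derivable /derive.
- set A := (X in X h @[h --> _]); set B := (X in _ -> lim (X h @[h --> _]) = _ -> _) => Ac Al.
  suff E : A = (fun h => h^-1 *: (((fun s => f (x + s *: v)) \o shift t) (h *: 1) - f (x + t *: v))).
    by split; rewrite /derivable /derive -E.
  apply/funext => h; rewrite /A/=; congr (_ *: (f _ - _)).
  by rewrite scalerDl [h *: 1]mulr1 addrCA.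
- set A := (X in X h @[h --> _]); set B := (X in _ -> lim (X h @[h --> _]) = _ -> _) => Ac Al.
  suff E : A = (fun h => h^-1 *: ((f \o shift (x + t *: v)) (h *: v) - f (x + t *: v))).
    by split; rewrite /derivable /derive -E.
  apply/funext => h; rewrite /A/=; congr (_ *: (f _ - _)).
  by rewrite scalerDl [h *: 1]mulr1 addrCA.
Qed.

Lemma is_derive_line0 f x v df :
  is_derive x v f df <-> is_derive (0 : R) 1 (fun s => f (x + s *: v)) df.
Proof. by rewrite -is_derive_line scale0r addr0. Qed.

Lemma is_derive_comp (F : R -> R) f x v df dF :
  is_derive x v f df -> is_derive (f x) 1 F dF ->
  is_derive x v (F \o f) (dF * df).
Proof.
move=> /is_derive_line0 fl Fl; apply/is_derive_line0.
have Fl' : is_derive (f (x + 0 *: v)) 1 F dF by rewrite scale0r addr0.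
exact: (@is_derive1_comp _ F (fun s => f (x + s *: v)) 0 dF df).
Qed.

End directional.

Section Ck.
Context {R : realType} {N : nat}.
Local Notation E := ('rV[R]_N).
Implicit Types (f g : E -> R).
Local Notation e i := (delta_mx 0 i : E).

Lemma Ck_continuous m f : Ck m f -> continuous f.
Proof. by case: m => [|m] []. Qed.

Lemma Ck_derivable m f i x : Ck m.+1 f -> derivable f x (e i).
Proof. by move=> [_ /(_ i)[]]. Qed.

Lemma Ck_is_derive m f i x : Ck m.+1 f -> is_derive x (e i) f (partial i f x).
Proof. by move=> /(@Ck_derivable _ _ i x) fx; split. Qed.

Lemma Ck_partial m f i : Ck m.+1 f -> Ck m (partial i f).
Proof. by move=> [_ /(_ i)[]]. Qed.

Lemma partialE i f (df : E -> R) :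
  (forall x, is_derive x (e i) f (df x)) -> partial i f = df.
Proof. by move=> fx; apply/funext => x; case: (fx x). Qed.

(** Smoothness proofs by induction on the order use this form: the partial derivatives are given by
    formulas, and it remains to see that these formulas are of the kind already treated. *)
Lemma CkS m f (df : 'I_N -> E -> R) : continuous f ->
  (forall i x, is_derive x (e i) f (df i x)) -> (forall i, Ck m (df i)) ->
  Ck m.+1 f.
Proof.
move=> cf fd dfm; split=> // i; split=> [x|]; first by case: (fd i x).
by rewrite (partialE (fd i)).
Qed.

Lemma Ck_le m f : Ck m.+1 f -> Ck m f.
Proof.
elim: m f => [|m IH] f [cf fm]; first by [].
split=> // i; have [fd fi] := fm i; split=> //; exact: IH.
Qed.

Lemma Ck_cst m (c : R) : Ck m (fun _ : E => c).
Proof.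
elim: m c => [|m IH] c; first by split => //; exact: cst_continuous.
apply: (@CkS _ _ (fun _ _ => 0)) => //; exact: cst_continuous.
Qed.

Lemma CkD m f g : Ck m f -> Ck m g -> Ck m (fun x => f x + g x).
Proof.
elim: m f g => [|m IH] f g.
  by move=> [cf _] [cg _]; split => // x; exact: (continuousD (cf x) (cg x)).
move=> fm gm; apply: (@CkS _ _ (fun i x => partial i f x + partial i g x)).
- by move=> x; have cf := Ck_continuous fm; have cg := Ck_continuous gm; exact: (continuousD (cf x) (cg x)).
- by move=> i x; apply: is_deriveD; [exact: (Ck_is_derive i x fm)|exact: (Ck_is_derive i x gm)].
- by move=> i; apply: IH; exact: Ck_partial.
Qed.

Lemma CkM m f g : Ck m f -> Ck m g -> Ck m (fun x => f x * g x).
Proof.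
elim: m f g => [|m IH] f g.
  by move=> [cf _] [cg _]; split => // x; exact: (continuousM (cf x) (cg x)).
move=> fm gm; apply: (@CkS _ _ (fun i x => f x * partial i g x + g x * partial i f x)).
- by move=> x; have cf := Ck_continuous fm; have cg := Ck_continuous gm; exact: (continuousM (cf x) (cg x)).
- by move=> i x; apply: is_deriveM; [exact: (Ck_is_derive i x fm)|exact: (Ck_is_derive i x gm)].
- by move=> i; apply: CkD; apply: IH; (exact: Ck_partial || exact: Ck_le).
Qed.

End Ck.

(** * Powers and flat exponentials of one real variable *)

Section scalar_derivatives.
Context {R : realType}.
Implicit Types (F : R -> R) (x : R).

(** An increment of order above 1 is o(h). This settles the one point, 0, at which |y|^q and
    [flat_exp] change their formula. *)
Lemma is_derive_flat F x (C r : R) : 0 < r ->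
  (forall h, `|F (x + h) - F x| <= C * `|h| `^ (1 + r)) -> is_derive x 1 F 0.
Proof.
move=> r0 FC.
have C0 : 0 <= C by have := FC 1; rewrite normr1 powR1 mulr1; exact: le_trans.
suff H : (fun h => h^-1 *: ((F \o shift x) (h *: 1) - F x)) @ 0^' --> (0 : R).
  by split; [exact: (cvgP _ H)|exact/cvg_lim].
apply/cvgrPdist_lt => e e0.
near=> h.
have h0 : h != 0 by near: h; exact: nbhs_dnbhs_neq.
rewrite sub0r normrN /= normrZ [h *: 1]mulr1 [h + x]addrC.
rewrite normfV mulrC ltr_pdivrMr ?normr_gt0//.
apply: le_lt_trans (FC _) _.
rewrite powRD; last by rewrite normr_eq0 h0 implybT.
rewrite powRr1// mulrCA mulrC ltr_pM2r ?normr_gt0//.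
(* Below this threshold C |h|^r stays under e; the 1 added to [C] covers C = 0. *)
have : `|h| < (e / (C + 1)) `^ r^-1.
  by near: h; apply: dnbhs0_lt; rewrite powR_gt0// divr_gt0// ltr_wpDl.
move=> /(gt0_ltr_powR r0); rewrite !nnegrE normr_ge0 powR_ge0 => /(_ isT isT).
rewrite -powRrM mulVf ?gt_eqF// powRr1 ?divr_ge0 ?addr_ge0 ?(ltW e0)//.
rewrite ltr_pdivlMr ?ltr_wpDl// => H.
apply: le_lt_trans H; rewrite mulrC ler_wpM2l ?powR_ge0//.
by rewrite lerDl.
Unshelve. all: by end_near. Qed.

(** At 0 the factor [x] makes the formula vanish whatever value the power with exponent q - 2 takes
    there; on each half-line it is the derivative of a power of a positive quantity. *)
Lemma is_derive_normr_powR x (q : R) : 1 < q ->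
  is_derive x 1 (fun y => `|y| `^ q) (q * `|x| `^ (q - 2) * x).
Proof.
move=> q1; have [x0|x0|->] := ltgtP x 0; last 1 first.
- rewrite mulr0; apply: (@is_derive_flat _ _ 1 (q - 1)); first by rewrite subr_gt0.
  move=> h; rewrite add0r normr0 powR0 ?gt_eqF ?(lt_trans ltr01)// subr0.
  by rewrite addrC subrK mul1r ger0_norm ?powR_ge0.
- apply: (@near_eq_is_derive _ _ _ (fun y => (- y) `^ q)).
    near=> y; rewrite ltr0_norm//; near: y; exact: lt_nbhsl.
  have -> : q * `|x| `^ (q - 2) * x = (q * (- x) `^ (q - 1)) * (- 1).
    rewrite ltr0_norm//.
    have -> : (- x) `^ (q - 1) = (- x) * (- x) `^ (q - 2).
      rewrite -[X in X * _]powRr1 ?oppr_ge0 ?ltW// -powRD ?oppr_eq0 ?(ltr0_neq0 x0) ?implybT//.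
      by congr (_ `^ _); ring.
    ring.
  apply: (@is_derive1_comp _ (fun y => y `^ q) (fun y => - y)).
  by apply: is_derive1_powR; rewrite oppr_gt0.
- apply: (@near_eq_is_derive _ _ _ (fun y => y `^ q)).
    near=> y; rewrite gtr0_norm//; near: y; exact: lt_nbhsr.
  have -> : q * `|x| `^ (q - 2) * x = q * x `^ (q - 1).
    rewrite gtr0_norm// -mulrA; congr (_ * _).
    rewrite -[X in _ * X]powRr1 ?(ltW x0)// -powRD ?(gt_eqF x0) ?implybT//.
    by congr (_ `^ _); ring.
  exact: is_derive1_powR.
Unshelve. all: by end_near. Qed.

(* The functions [x^-k exp (-1/x)] extended by 0 to [x <= 0] are stable under
   differentiation up to linear combinations. *)
Definition flat_exp (k : nat) : R -> R :=
  fun x => if 0 < x then x ^- k * expR (- x^-1) else 0.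

Lemma flat_exp_ge0 k x : 0 <= flat_exp k x.
Proof.
rewrite /flat_exp; case: ifPn => // x0.
by rewrite mulr_ge0 ?invr_ge0 ?exprn_ge0 ?ltW ?expR_gt0.
Qed.

(** exp(1/x) is at least the term of order k + 2 of its series, so two powers of x are left over;
    this flatness gives the derivative at 0. *)
Lemma flat_exp_le k x : flat_exp k x <= (k.+2)`!%:R * x ^+ 2.
Proof.
rewrite /flat_exp; case: ifPn => [x0|_]; last first.
  by rewrite mulr_ge0 ?exprn_even_ge0.
rewrite expRN ler_pdivrMr ?expR_gt0//.
have x1 : 0 <= x^-1 by rewrite invr_ge0 ltW.
have fn : 0 < (k.+2)`!%:R :> R by rewrite ltr0n fact_gt0.
have H : x^-1 ^+ k.+2 / (k.+2)`!%:R <= expR x^-1.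
  by apply: le_trans (expR_ge1Dxn k.+1 x1); rewrite lerDr.
apply: (@le_trans _ _ ((k.+2)`!%:R * x ^+ 2 * (x^-1 ^+ k.+2 / (k.+2)`!%:R))); last first.
  by rewrite ler_wpM2l// mulr_ge0 ?exprn_even_ge0.
have xn : x != 0 by rewrite gt_eqF.
rewrite le_eqVlt; apply/orP; left; apply/eqP.
rewrite -!exprVn !exprS expr0 mulr1.
set y := x^-1 ^+ k; set c := _`!%:R; field.
by rewrite xn gt_eqF.
Qed.

Lemma is_derive_flat_exp k x :
  is_derive x 1 (flat_exp k) (- k%:R * flat_exp k.+1 x + flat_exp k.+2 x).
Proof.
have [x0|x0|->] := ltgtP x 0; last 1 first.
- have -> : - k%:R * flat_exp k.+1 0 + flat_exp k.+2 0 = 0.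
    by rewrite /flat_exp ltxx mulr0 addr0.
  apply: (@is_derive_flat _ _ (k.+2)`!%:R 1) => // h.
  rewrite add0r {2}/flat_exp ltxx subr0 ger0_norm ?flat_exp_ge0//.
  have -> : 1 + 1 = 2%:R :> R by [].
  by rewrite powR_mulrn// real_normK ?num_real// flat_exp_le.
- apply: (@near_eq_is_derive _ _ _ (fun y => 0)).
    near=> y; rewrite /flat_exp ltNge ltW//; near: y; exact: lt_nbhsl.
  rewrite /flat_exp ltNge ltW//= mulr0 addr0; exact: is_derive_cst.
- apply: (@near_eq_is_derive _ _ _ (fun y : R => (y ^- k * expR (- y^-1) : R))).
    near=> y; rewrite /flat_exp ifT//; near: y; exact: lt_nbhsr.
  have xn : x != 0 by rewrite gt_eqF.
  rewrite /flat_exp x0.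
  have dV : is_derive x 1 (fun y : R => y^-1) (- x ^- 2 *: 1) by exact: (@is_deriveV _ id).
  have dN : is_derive x 1 (fun y : R => - y^-1) (- (- x ^- 2 *: 1)) by exact: is_deriveN.
  have dE : is_derive x 1 (fun y : R => expR (- y^-1)) (expR (- x^-1) * (- (- x ^- 2 *: 1))).
    exact: (@is_derive1_comp _ expR (fun y => - y^-1)).
  have dk : is_derive x 1 (fun y : R => y^-1 ^+ k) (k%:R * x^-1 ^+ k.-1 *: (- x ^- 2 *: 1)).
    rewrite (_ : (fun y : R => y^-1 ^+ k) = (fun y : R => y^-1) ^+ k); last first.
      by apply/funext => y; rewrite exprfctE.
    exact: is_deriveX.
  have -> : (fun y : R => y ^- k * expR (- y^-1)) = (fun y => y^-1 ^+ k * expR (- y^-1)).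
    by apply/funext => y; rewrite exprVn.
  apply: (is_derive_eq (is_deriveM dk dE)).
  rewrite /GRing.scale/= !mulr1 -!exprVn; case: k {dk} => [|k] /=.
    by rewrite !expr0 -[0%:R]/0; ring.
  by rewrite !exprS -!natr1; ring.
Unshelve. all: by end_near. Qed.

End scalar_derivatives.

Section smooth.
Context {R : realType} {N : nat}.
Local Notation E := ('rV[R]_N).
Implicit Types (f g phi psi : E -> R).
Local Notation e i := (delta_mx 0 i : E).

Definition smooth f := forall m, Ck m f.

Lemma smooth_continuous f : smooth f -> continuous f.
Proof. by move=> /(_ 0); exact: Ck_continuous. Qed.

Lemma smooth_is_derive f i x : smooth f -> is_derive x (e i) f (partial i f x).
Proof. by move=> /(_ 1); exact: Ck_is_derive. Qed.

Lemma smooth_partial f i : smooth f -> smooth (partial i f).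
Proof. by move=> fs m; apply: Ck_partial. Qed.

Lemma smooth_cst (c : R) : smooth (fun _ : E => c).
Proof. by move=> m; exact: Ck_cst. Qed.

Lemma smoothD f g : smooth f -> smooth g -> smooth (fun x => f x + g x).
Proof. by move=> fs gs m; exact: CkD. Qed.

Lemma smoothM f g : smooth f -> smooth g -> smooth (fun x => f x * g x).
Proof. by move=> fs gs m; exact: CkM. Qed.

Lemma smooth_prod n (f : 'I_n -> E -> R) : (forall i, smooth (f i)) ->
  smooth (fun x => \prod_i f i x).
Proof.
move=> fs; elim: n f fs => [|n IH] f fs.
  by under eq_fun do rewrite big_ord0; exact: smooth_cst.
under eq_fun do rewrite big_ord_recl.
by apply: smoothM => //; apply: IH.
Qed.

Lemma smooth_affine (i : 'I_N) (a b : R) : smooth (fun x : E => a * x ord0 i + b).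
Proof.
move=> m; apply: CkD; last exact: Ck_cst.
apply: CkM; first exact: Ck_cst.
case: m => [|m]; first by split => // x; exact: coord_continuous.
apply: (@CkS _ _ _ _ (fun j _ => (i == j)%:R)).
- by move=> x; exact: coord_continuous.
- move=> j x; apply/is_derive_line0.
  have -> : (fun s : R => (x + s *: e j) ord0 i) = (fun s => x ord0 i + (i == j)%:R * s).
    by apply/funext => s; rewrite !mxE/= mulrC.
  apply: is_derive_eq.
  by rewrite /GRing.scale/=; ring.
- by move=> j; exact: Ck_cst.
Qed.

(** Differentiation raises the index [k], so the induction on the order is made for all [k] at
    once. *)
Lemma smooth_flat_exp k g : smooth g -> smooth (fun x => flat_exp k (g x)).
Proof.
move=> gs m; have cf j : continuous (fun x => flat_exp j (g x)).
  move=> x; apply: (@continuous_comp _ _ _ g (@flat_exp R j)).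
    exact: smooth_continuous.
  apply: differentiable_continuous; apply/derivable1_diffP.
  by case: (is_derive_flat_exp j (g x)).
elim: m k => [|m IH] k; first by [].
apply: (@CkS _ _ _ _ (fun i x =>
  (- k%:R * flat_exp k.+1 (g x) + flat_exp k.+2 (g x)) * partial i g x)) => //.
- move=> i x; apply: (@is_derive_comp _ _ (flat_exp k)).
    exact: smooth_is_derive.
  exact: is_derive_flat_exp.
- move=> i; apply: CkM; last by apply: Ck_partial.
  apply: CkD => //; apply: CkM => //; exact: Ck_cst.
Qed.

Lemma is_derive_sqrtV (x : R) : 0 < x ->
  is_derive x 1 (fun y => (Num.sqrt y)^-1) (- 2^-1 * (Num.sqrt x)^-1 ^+ 3).
Proof.
move=> x0; have s0 : Num.sqrt x != 0 by rewrite gt_eqF// sqrtr_gt0.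
apply: (is_derive_eq (is_deriveV s0 (is_derive1_sqrt x0))).
by rewrite /GRing.scale/=; field.
Qed.

Lemma continuous_sqrt_comp g : continuous g -> continuous (fun x => Num.sqrt (g x)).
Proof.
move=> cg x; apply: (@continuous_comp _ _ _ g (@Num.sqrt R)); first exact: cg.
exact: sqrt_continuous.
Qed.

(** The reciprocal root is treated before the root because its derivative is a multiple of its own
    cube times a partial derivative of [g], which closes the induction. *)
Lemma smooth_sqrtV g : smooth g -> (forall x, 0 < g x) ->
  smooth (fun x => (Num.sqrt (g x))^-1).
Proof.
move=> gs g0; have cf : continuous (fun x => (Num.sqrt (g x))^-1).
  move=> x; apply: (@continuous_comp _ _ _ (fun x => Num.sqrt (g x)) (@GRing.inv R)).
    by apply: continuous_sqrt_comp; exact: smooth_continuous.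
  by apply: inv_continuous; rewrite gt_eqF// sqrtr_gt0.
elim=> [|m IH]; first by [].
apply: (@CkS _ _ _ _ (fun i x => (- 2^-1 * ((Num.sqrt (g x))^-1 * ((Num.sqrt (g x))^-1 * (Num.sqrt (g x))^-1))) * partial i g x)) => //.
- move=> i x; apply: (@is_derive_comp _ _ (fun y => (Num.sqrt y)^-1)).
    exact: smooth_is_derive.
  exact: (is_derive_eq (is_derive_sqrtV (g0 x))).
- move=> i; apply: CkM; last by apply: Ck_partial.
  by apply: CkM; [exact: Ck_cst|apply: CkM => //; apply: CkM].
Qed.

Lemma smooth_sqrt g : smooth g -> (forall x, 0 < g x) ->
  smooth (fun x => Num.sqrt (g x)).
Proof.
move=> gs g0.
have -> : (fun x => Num.sqrt (g x)) = (fun x => g x * (Num.sqrt (g x))^-1).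
  apply/funext => x; rewrite -{2}(sqr_sqrtr (ltW (g0 x))) expr2 mulfK//.
  by rewrite gt_eqF// sqrtr_gt0.
by apply: smoothM => //; exact: smooth_sqrtV.
Qed.

Lemma partial_cst (c : R) i : partial i (fun _ : E => c) = fun=> 0.
Proof. by apply: partialE => x; exact: is_derive_cst. Qed.

Lemma partialD f g i : smooth f -> smooth g ->
  partial i (fun x => f x + g x) = fun x => partial i f x + partial i g x.
Proof.
move=> fs gs; apply: partialE => x.
by apply: is_deriveD; exact: smooth_is_derive.
Qed.

Lemma partialM f g i : smooth f -> smooth g ->
  partial i (fun x => f x * g x) = fun x => f x * partial i g x + g x * partial i f x.
Proof.
move=> fs gs; apply: partialE => x.
by apply: is_deriveM; exact: smooth_is_derive.
Qed.

Lemma partialZ f c i : smooth f ->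
  partial i (fun x => c * f x) = fun x => c * partial i f x.
Proof.
move=> fs; rewrite partialM//; last exact: smooth_cst.
by apply/funext => x; rewrite partial_cst mulr0 addr0.
Qed.

Lemma partialB f g i : smooth f -> smooth g ->
  partial i (fun x => f x - g x) = fun x => partial i f x - partial i g x.
Proof.
move=> fs gs; apply: partialE => x.
by apply: is_deriveB; exact: smooth_is_derive.
Qed.

Lemma partial_sqrt g i : smooth g -> (forall x, 0 < g x) ->
  partial i (fun x => Num.sqrt (g x)) = fun x => (2 * Num.sqrt (g x))^-1 * partial i g x.
Proof.
move=> gs g0; apply: partialE => x; apply: (@is_derive_comp _ _ Num.sqrt).
  exact: smooth_is_derive.
exact: is_derive1_sqrt.
Qed.

End smooth.

(** * Test functions *)

Section test_functions.
Context {R : realType} {N : nat}.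
Local Notation E := ('rV[R]_N).
Implicit Types (f g phi psi : E -> R).
Local Notation e i := (delta_mx 0 i : E).
Local Notation mu := (@lebesgue_rV R N).

Lemma cube_sub (M M' : R) : M <= M' -> @cube R N M `<=` cube M'.
Proof.
move=> MM x xM i; have := xM i; rewrite /= !in_itv/= => /andP[a b].
by rewrite (le_trans _ a) ?lerN2// (le_trans b).
Qed.

Lemma compact_cubeT (M : R) : compact (@cube R N M).
Proof. apply: (@rV_compact _ _ (fun=> `[- M, M]%classic)) => _; exact: segment_compact. Qed.

Lemma closed_cube (M : R) : closed (@cube R N M).
Proof. by apply: compact_closed; [exact: norm_hausdorff|exact: compact_cubeT]. Qed.

(** Vanishing outside a cube passes through sums, products and derivatives more easily than
    compactness of a closure. *)
Lemma C0inftyP phi : C0infty phi <->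
  smooth phi /\ exists M : R, forall x, ~ cube M x -> phi x = 0.
Proof.
split=> [[phis /compact_cube[M M0 KM]]|[phis [M phiM]]]; split=> //.
  exists M => x xM; apply/eqP/negP => /negP x0; apply: xM; apply: KM.
  exact: subset_closure.
apply: (subclosed_compact _ (@compact_cubeT M)); first exact: closed_closure.
rewrite (closure_id (cube M)).1; last exact: closed_cube.
apply: closureS => x /= x0; apply: contrapT => /phiM xe.
by rewrite xe eqxx in x0.
Qed.

Lemma C0infty_smooth phi : C0infty phi -> smooth phi.
Proof. by case. Qed.
Hint Resolve C0infty_smooth : core.

Lemma C0inftyD f g : C0infty f -> C0infty g -> C0infty (fun x => f x + g x).
Proof.
move=> /C0inftyP[fs [M fM]] /C0inftyP[gs [M' gM]]; apply/C0inftyP; split.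
  exact: smoothD.
exists (Num.max M M') => x xM; rewrite fM ?gM ?addr0// => xM'; apply: xM;
  by apply: cube_sub xM'; rewrite le_max lexx ?orbT.
Qed.

Lemma C0inftyMl f g : smooth f -> C0infty g -> C0infty (fun x => f x * g x).
Proof.
move=> fs /C0inftyP[gs [M gM]]; apply/C0inftyP; split; first exact: smoothM.
by exists M => x xM; rewrite gM// mulr0.
Qed.

Lemma C0inftyM f g : C0infty f -> C0infty g -> C0infty (fun x => f x * g x).
Proof. by move=> fs; apply: C0inftyMl; exact: C0infty_smooth. Qed.

Lemma C0inftyZ c f : C0infty f -> C0infty (fun x => c * f x).
Proof. by apply: C0inftyMl; exact: smooth_cst. Qed.

Lemma C0inftyB f g : C0infty f -> C0infty g -> C0infty (fun x => f x - g x).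
Proof.
move=> fs gs; under eq_fun do rewrite -mulN1r.
by apply: C0inftyD => //; exact: C0inftyZ.
Qed.

Lemma C0infty_partial f i : C0infty f -> C0infty (partial i f).
Proof.
move=> /C0inftyP[fs [M fM]]; apply/C0inftyP; split; first exact: smooth_partial.
exists M => x xM.
have : is_derive x (e i) f 0.
  have d0 : is_derive x (e i) (cst (0 : R)) 0 by exact: is_derive_cst.
  apply: near_eq_is_derive d0.
  have : nbhs x (~` cube M).
    by apply: open_nbhs_nbhs; split => //; apply: closed_openC; exact: closed_cube.
  by apply: filterS => y yM; rewrite fM.
by case.
Qed.

Lemma C0infty_bounded f : C0infty f -> exists2 C : R, 0 < C & forall x, `|f x| <= C.
Proof.
move=> /C0inftyP[fs [M fM]].
have /compact_bounded[C [Cr fC]] : compact (f @` cube M).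
  apply: continuous_compact; last exact: compact_cubeT.
  by apply: continuous_subspaceT; exact: smooth_continuous.
exists (`|C| + 1) => [|x]; first by rewrite ltr_wpDl.
case: (pselect (cube M x)) => [xM|/fM ->]; last by rewrite normr0 addr_ge0.
apply: fC; last by exists x.
by rewrite (le_lt_trans (ler_norm _))// ltrDl.
Qed.

Lemma C0infty_measurable f : C0infty f -> measurable_fun setT f.
Proof. by move=> [fs _]; apply: continuous_measurable_rV; apply: smooth_continuous. Qed.

Lemma C0infty_integrableMl f g C : measurable_fun setT f -> (forall x, `|f x| <= C) ->
  C0infty g -> mu.-integrable setT (EFin \o (fun x => f x * g x)).
Proof.
move=> mf fC gs; have [D D0 gD] := C0infty_bounded gs.
have [_ [M gM]] := (C0inftyP g).1 gs.
apply: (@integrable_bounded _ _ _ M (C * D)).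
- by apply: measurable_funM => //; exact: C0infty_measurable.
- by move=> x; rewrite normrM ler_pM.
- by move=> x xM; rewrite gM// mulr0.
Qed.

Lemma C0infty_integrable g : C0infty g -> mu.-integrable setT (EFin \o g).
Proof.
move=> gs; have -> : EFin \o g = EFin \o (fun x => 1 * g x).
  by apply/funext => x /=; rewrite mul1r.
by apply: (@C0infty_integrableMl _ _ 1) => // x; rewrite normr1.
Qed.

End test_functions.
#[global] Hint Resolve C0infty_smooth : core.

(** * The Sobolev inequality *)

Section hoelder_ereal.
Local Open Scope ereal_scope.
Context {R : realType}.

Lemma young_powR (x y t : R) : (0 < t < 1 -> 0 <= x -> 0 <= y ->
  x `^ t * y `^ (1 - t) <= t * x + (1 - t) * y)%R.
Proof.
move=> /andP[t0 t1] x0 y0; have t1' : (0 < 1 - t)%R by rewrite subr_gt0.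
have := @conjugate_powR R (x `^ t)%R (y `^ (1 - t))%R (t^-1)%R ((1 - t)^-1)%R.
rewrite !powR_ge0 !invr_gt0 t0 t1' !invrK subrKC => /(_ isT isT isT isT erefl).
rewrite -!powRrM !divff ?gt_eqF// !powRr1//.
by rewrite (mulrC x) (mulrC y).
Qed.

Context d (T : measurableType d) (mu : {measure set T -> \bar R}).

Lemma poweR_measurable (F : T -> \bar R) (r : R) :
  measurable_fun setT F -> measurable_fun setT (fun x => F x `^ r).
Proof. by move=> mF; apply: (@measurableT_comp _ _ _ _ _ _ (poweR^~ r)) => //; exact: measurable_poweR. Qed.

(** Extended real values are allowed because the inequality is applied to inner integrals of
    Tonelli's theorem, which may be infinite. Outside the degenerate cases it is Young's inequality
    for F / a and G / b, with a and b the two integrals. *)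
Lemma hoelder_ereal (F G : T -> \bar R) (t : R) : (0 < t < 1)%R ->
  measurable_fun setT F -> measurable_fun setT G ->
  (forall x, 0 <= F x) -> (forall x, 0 <= G x) ->
  \int[mu]_x (F x `^ t * G x `^ (1 - t)) <=
  (\int[mu]_x F x) `^ t * (\int[mu]_x G x) `^ (1 - t).
Proof.
move=> t01 mF mG F0 G0; have /andP[t0 t1] := t01.
have t1' : (0 < 1 - t)%R by rewrite subr_gt0.
have mFG : measurable_fun setT (fun x => F x `^ t * G x `^ (1 - t)).
  by apply: emeasurable_funM; exact: poweR_measurable.
have FG0 x : 0 <= F x `^ t * G x `^ (1 - t) by rewrite mule_ge0// poweR_ge0.
have zero (H : T -> \bar R) : measurable_fun setT H -> (forall x, 0 <= H x) ->
    (forall x, H x = 0 -> F x `^ t * G x `^ (1 - t) = 0) ->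
    \int[mu]_x H x = 0 -> \int[mu]_x (F x `^ t * G x `^ (1 - t)) = 0.
  move=> mH H0 HFG IH.
  have /ae_eq_integral_abs : \int[mu]_x `|H x| = 0.
    by rewrite -[RHS]IH; apply: eq_integral => x _; rewrite gee0_abs.
  move=> /(_ measurableT mH) H0ae.
  rewrite (ae_eq_integral (cst 0)) ?integral0//.
  by apply: filterS H0ae => x Hx /Hx /HFG.
have [a0|a0] := eqVneq (\int[mu]_x F x) 0.
  rewrite (zero F)//; first by rewrite mule_ge0// poweR_ge0.
  by move=> x ->; rewrite poweR0r ?gt_eqF// mul0e.
have [b0|b0] := eqVneq (\int[mu]_x G x) 0.
  rewrite (zero G)//; first by rewrite mule_ge0// poweR_ge0.
  by move=> x ->; rewrite poweR0r ?gt_eqF// mule0.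
have a_gt0 : 0 < \int[mu]_x F x by rewrite lt0e a0 integral_ge0.
have b_gt0 : 0 < \int[mu]_x G x by rewrite lt0e b0 integral_ge0.
have [iFy|iFy] := eqVneq (\int[mu]_x F x) +oo.
  by rewrite iFy poweRyr ?gt_eqF// gt0_mulye ?leey// poweR_gt0.
have [iGy|iGy] := eqVneq (\int[mu]_x G x) +oo.
  by rewrite iGy poweRyr ?gt_eqF// gt0_muley ?leey// poweR_gt0.
have [a Ea] : exists a, \int[mu]_x F x = a%:E.
  by exists (fine (\int[mu]_x F x)); rewrite fineK// ge0_fin_numE ?ltey ?integral_ge0.
have [b Eb] : exists b, \int[mu]_x G x = b%:E.
  by exists (fine (\int[mu]_x G x)); rewrite fineK// ge0_fin_numE ?ltey ?integral_ge0.
move: a_gt0 b_gt0; rewrite Ea Eb !lte_fin => a_gt0 b_gt0.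
rewrite !poweR_EFin -EFinM.
pose c := (a `^ t * b `^ (1 - t))%R.
rewrite -/c; have c0 : (0 <= c)%R by rewrite mulr_ge0 ?powR_ge0.
apply: (@le_trans _ _ (\int[mu]_x ((c * (t / a))%:E * F x + (c * ((1 - t) / b))%:E * G x))).
  apply: ge0_le_integral => //.
  - apply: emeasurable_funD; exact: measurable_funeM.
  - move=> x _; have := F0 x; have := G0 x.
    have ct : (0 < c * (t / a))%R by rewrite !mulr_gt0 ?powR_gt0 ?invr_gt0.
    have ct' : (0 < c * ((1 - t) / b))%R by rewrite !mulr_gt0 ?powR_gt0 ?invr_gt0.
    case: (F x) => [f||]//; case: (G x) => [g||]// g0 f0.
    + rewrite !poweR_EFin -!EFinM -EFinD lee_fin.
      have := @young_powR (f / a)%R (g / b)%R t t01 (divr_ge0 f0 (ltW a_gt0)) (divr_ge0 g0 (ltW b_gt0)).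
      move=> /(ler_wpM2l c0); rewrite mulrDr.
      have -> : (c * ((f / a) `^ t * (g / b) `^ (1 - t)) = f `^ t * g `^ (1 - t))%R.
        rewrite /c mulrACA -!powRM ?divr_ge0 ?(ltW a_gt0) ?(ltW b_gt0)//.
        by rewrite ![(_ * (_ / _))%R]mulrC !divfK ?gt_eqF.
      by move=> /le_trans; apply; rewrite le_eqVlt; apply/orP; left; apply/eqP; ring.
    + by rewrite (gt0_muley (x := (c * ((1 - t) / b))%:E)) ?lte_fin// -EFinM addey// leey.
    + by rewrite (gt0_muley (x := (c * (t / a))%:E)) ?lte_fin// -EFinM addye// leey.
    + by rewrite (gt0_muley (x := (c * (t / a))%:E)) ?lte_fin// (gt0_muley (x := (c * ((1 - t) / b))%:E)) ?lte_fin// leey.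
rewrite ge0_integralD//; try by move=> x _; rewrite mule_ge0// lee_fin mulr_ge0// divr_ge0// ltW.
all: try exact: measurable_funeM.
rewrite !ge0_integralZl_EFin//; try by rewrite mulr_ge0// divr_ge0// ltW.
rewrite Ea Eb -!EFinM -EFinD lee_fin le_eqVlt; apply/orP; left; apply/eqP.
by field; rewrite !gt_eqF.
Qed.

Lemma prode_poweR (I : Type) (s : seq I) (a : I -> \bar R) (r : R) :
  (forall i, 0 <= a i) ->
  (\prod_(i <- s) a i) `^ r = \prod_(i <- s) (a i `^ r).
Proof.
move=> a0; elim: s => [|i s IH]; first by rewrite !big_nil poweR1r.
by rewrite !big_cons poweRM ?IH// prode_ge0.
Qed.

Lemma measurable_prode n (G : 'I_n -> T -> \bar R) :
  (forall i, measurable_fun setT (G i)) ->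
  measurable_fun setT (fun x => \prod_(i < n) G i x).
Proof.
elim: n G => [|n IH] G mG.
  by under eq_fun do rewrite big_ord0; exact: measurable_cst.
under eq_fun do rewrite big_ord_recl.
by apply: emeasurable_funM => //; apply: IH.
Qed.

(** Induction on the number of factors: the first is split off with exponent t = 1/(n+2), and
    1/(n+2) = (1 - t)/(n+1) lets the others be treated by the induction hypothesis. *)
Lemma hoelder_prode n (G : 'I_n.+1 -> T -> \bar R) :
  (forall i, measurable_fun setT (G i)) -> (forall i x, 0 <= G i x) ->
  \int[mu]_x \prod_i (G i x `^ (n.+1%:R^-1)) <=
  \prod_i (\int[mu]_x G i x) `^ (n.+1%:R^-1).
Proof.
elim: n G => [|n IH] G mG G0.
  rewrite big_ord1 invr1 poweRe1 ?integral_ge0//.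
  by under eq_integral do rewrite big_ord1 poweRe1//.
rewrite big_ord_recl.
pose t : R := (n.+2%:R^-1)%R.
have n2 : (n.+2%:R != 0 :> R)%R by [].
have n1 : (n.+1%:R != 0 :> R)%R by [].
have t01 : (0 < t < 1)%R by rewrite invr_gt0 ltr0n /= invf_lt1 ?ltr0n// ltr1n.
have tE : (t = n.+1%:R^-1 * (1 - t))%R.
  have m1 : (n.+1%:R + 1 != 0 :> R)%R by rewrite natr1.
  have key (m : R) : (m != 0 -> m + 1 != 0 -> (m + 1)^-1 = m^-1 * (1 - (m + 1)^-1))%R.
    by move=> m0 m10; field; rewrite m0 m10.
  by rewrite /t -[n.+2%:R%R]natr1; exact: key.
have tE' (x : \bar R) : x `^ t = (x `^ (n.+1%:R^-1)) `^ (1 - t) by rewrite {1}tE poweRrM.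
have lG0 x i : 0 <= G (lift ord0 i) x `^ (n.+1%:R^-1) by exact: poweR_ge0.
rewrite (eq_integral (fun x => G ord0 x `^ t *
    (\prod_(i < n.+1) (G (lift ord0 i) x `^ (n.+1%:R^-1))) `^ (1 - t))); last first.
  move=> x _; rewrite big_ord_recl prode_poweR//; congr (_ * _).
  by apply: eq_bigr => i _; exact: tE'.
apply: le_trans; first apply: hoelder_ereal => //.
- by apply: measurable_prode => i; exact: poweR_measurable.
- by move=> x; rewrite prode_ge0.
rewrite lee_wpmul2l ?poweR_ge0//.
have -> : \prod_(i < n.+1) (\int[mu]_x G (lift ord0 i) x) `^ t =
    (\prod_(i < n.+1) (\int[mu]_x G (lift ord0 i) x) `^ (n.+1%:R^-1)) `^ (1 - t).
  rewrite prode_poweR; first by apply: eq_bigr => i _; exact: tE'.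
  by move=> i; exact: poweR_ge0.
apply: gt0_ler_poweR.
- by have /andP[_ /ltW] := t01; rewrite subr_ge0.
- by rewrite in_itv/= leey integral_ge0// => x _; rewrite prode_ge0.
- by rewrite in_itv/= leey prode_ge0// => i _; exact: poweR_ge0.
- by apply: IH.
Qed.

End hoelder_ereal.

(** * Tonelli's theorem coordinate by coordinate, and a Loomis-Whitney inequality *)

Section tuple_integrals.
Local Open Scope ereal_scope.
Context {R : realType}.
Local Notation lam := (@lebesgue_measure R).
Local Notation Lam n := (@lebesgue_tuple R n).

Definition tuple_set n (t : n.-tuple R) (i : 'I_n) (x : R) : n.-tuple R :=
  [tuple if j == i then x else tnth t j | j < n].

Lemma tuple_set0 n x (t : n.-tuple R) y :
  tuple_set (cons_pair (x, t)) ord0 y = cons_pair (y, t).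
Proof.
apply: eq_from_tnth => j; rewrite tnth_mktuple.
by case: (unliftP ord0 j) => [k|] ->; rewrite ?tnthS ?eqxx.
Qed.

Lemma tuple_setS n x (t : n.-tuple R) i y :
  tuple_set (cons_pair (x, t)) (lift ord0 i) y = cons_pair (x, tuple_set t i y).
Proof.
apply: eq_from_tnth => j; rewrite tnth_mktuple.
case: (unliftP ord0 j) => [k|] -> //.
by rewrite !tnthS tnth_mktuple (inj_eq lift_inj).
Qed.

Section cons.
Context n (F : n.+1.-tuple R -> \bar R).

Lemma measurable_cons_l x : measurable_fun setT F ->
  measurable_fun setT (fun t : n.-tuple R => F (cons_pair (x, t))).
Proof.
move=> mF; apply: (measurableT_comp mF).
by apply: (measurableT_comp (@measurable_cons_pair R n)).
Qed.

Lemma measurable_cons_r t : measurable_fun setT F ->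
  measurable_fun setT (fun x : R => F (cons_pair (x, t))).
Proof.
move=> mF; apply: (measurableT_comp mF).
by apply: (measurableT_comp (@measurable_cons_pair R n)).
Qed.

Lemma tonelli_cons_l : measurable_fun setT F -> (forall t, 0 <= F t) ->
  \int[Lam n.+1]_t F t = \int[lam]_x \int[Lam n]_t F (cons_pair (x, t)).
Proof.
move=> mF F0; rewrite ge0_integral_pushforward//; last exact: measurable_cons_pair.
rewrite preimage_setT fubini_tonelli1//; last by move=> x; exact: F0.
exact: (measurableT_comp mF (@measurable_cons_pair R n)).
Qed.

Lemma tonelli_cons_r : measurable_fun setT F -> (forall t, 0 <= F t) ->
  \int[Lam n.+1]_t F t = \int[Lam n]_t \int[lam]_x F (cons_pair (x, t)).
Proof.
move=> mF F0; rewrite ge0_integral_pushforward//; last exact: measurable_cons_pair.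
rewrite preimage_setT fubini_tonelli2//; last by move=> x; exact: F0.
exact: (measurableT_comp mF (@measurable_cons_pair R n)).
Qed.

Lemma measurable_int_l : measurable_fun setT F -> (forall t, 0 <= F t) ->
  measurable_fun setT (fun x => \int[Lam n]_t F (cons_pair (x, t))).
Proof.
move=> mF F0; have := @measurable_fun_fubini_tonelli_F _ _ _ _ _ (Lam n)
  (F \o @cons_pair R n) (measurableT_comp mF (@measurable_cons_pair R n)).
by apply => x; exact: F0.
Qed.

Lemma measurable_int_r : measurable_fun setT F -> (forall t, 0 <= F t) ->
  measurable_fun setT (fun t => \int[lam]_x F (cons_pair (x, t))).
Proof.
move=> mF F0; have := @measurable_fun_fubini_tonelli_G _ _ _ _ _ lam
  (F \o @cons_pair R n) (measurableT_comp mF (@measurable_cons_pair R n)).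
by apply => x; exact: F0.
Qed.

End cons.

(* Of Loomis-Whitney type; it is applied to a power of a test function, bounded
   along each line by the integral of its partial derivative. *)
Lemma gagliardo n (f : n.+2.-tuple R -> \bar R) (g : 'I_n.+2 -> n.+2.-tuple R -> \bar R) :
  measurable_fun setT f -> (forall t, 0 <= f t) ->
  (forall i, measurable_fun setT (g i)) -> (forall i t, 0 <= g i t) ->
  (forall i t, f t <= \int[lam]_x g i (tuple_set t i x)) ->
  \int[Lam n.+2]_t (f t `^ (1 + n.+1%:R^-1)) <=
  \prod_i (\int[Lam n.+2]_t g i t) `^ (n.+1%:R^-1).
Proof.
elim: n f g => [|n IH] f g mf f0 mg g0 fg.
  (* Dimension two: [f1] bounds [f] by a function of the first coordinate and [f2] by one of the
     second, so f^2 is at most a product whose integral factors. *)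
  rewrite big_ord_recl big_ord1 !invr1 !poweRe1 ?integral_ge0//.
  have f1 x t : f (cons_pair (x, t)) <= \int[Lam 1]_s g (lift ord0 ord0) (cons_pair (x, s)).
    apply: le_trans (fg (lift ord0 ord0) _) _.
    rewrite tonelli_cons_l => [|//|//]; last exact: measurable_cons_l.
    apply: ge0_le_integral => //.
    - apply: (eq_measurable_fun (fun y => g (lift ord0 ord0) (cons_pair (x, cons_pair (y, [tuple]))))).
        move=> y _; rewrite tuple_setS; congr (g _ (cons_pair (_, _))).
        by apply: eq_from_tnth => j; rewrite tnth_mktuple (ord1 j).
      have mg' := @measurable_cons_l _ _ x (mg (lift ord0 ord0)).
      exact: (@measurable_cons_r _ _ [tuple] mg').
    - exact: (@measurable_int_l _ _ (@measurable_cons_l _ _ x (mg (lift ord0 ord0)))).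
    - move=> y _; rewrite tuple_setS integral_dirac//; last first.
        exact: (@measurable_cons_l _ _ y (@measurable_cons_l _ _ x (mg (lift ord0 ord0)))).
      rewrite ?diracT ?mul1e.
      rewrite le_eqVlt; apply/orP; left; apply/eqP; congr (g _ (cons_pair (_, _))).
      by apply: eq_from_tnth => j; rewrite tnth_mktuple (ord1 j).
  have f2 x t : f (cons_pair (x, t)) <= \int[lam]_y g ord0 (cons_pair (y, t)).
    by apply: le_trans (fg ord0 _) _; under eq_integral do rewrite tuple_set0.
  have mf2 : measurable_fun setT (fun t => f t `^ (1 + 1)).
    exact: poweR_measurable.
  rewrite tonelli_cons_l => [|//|t]; last exact: poweR_ge0.
  rewrite muleC (tonelli_cons_l (mg (lift ord0 ord0)))// (tonelli_cons_r (mg ord0))//.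
  set G0 := fun t => \int[lam]_x g ord0 (cons_pair (x, t)).
  set G1 := fun x => \int[Lam 1]_t g (lift ord0 ord0) (cons_pair (x, t)).
  have mG0 : measurable_fun setT G0 by exact: measurable_int_r.
  have mG1 : measurable_fun setT G1 by exact: measurable_int_l.
  have G00 t : 0 <= G0 t by apply: integral_ge0.
  have G10 x : 0 <= G1 x by apply: integral_ge0.
  rewrite -ge0_integralZr; [|by []|exact: mG1|by move=> x _; exact: G10|by apply: integral_ge0 => t _; exact: G00].
  apply: ge0_le_integral => //.
  - by move=> x _; apply: integral_ge0 => t _; exact: poweR_ge0.
  - by apply: (measurable_int_l mf2) => t; exact: poweR_ge0.
  - exact: emeasurable_funM.
  - move=> x _; rewrite -ge0_integralZl; [|by []|exact: mG0|by move=> t _; exact: G00|exact: G10].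
    apply: ge0_le_integral => //.
    + by move=> t _; exact: poweR_ge0.
    + exact: (@measurable_cons_l _ _ x mf2).
    + exact: measurable_funeM.
    + move=> t _; have := f1 x t; have := f2 x t; have := f0 (cons_pair (x, t)).
      move: (f _) => [y| |]// y0 fG0 fG1.
        rewrite poweR_EFin powRD; last by rewrite gt_eqF// addr_gt0.
        by rewrite powRr1// EFinM muleC lee_pmul.
      move: fG0 fG1; rewrite !leye_eq => /eqP fG0 /eqP fG1.
      by rewrite /G0 fG0 fG1 mulyy leey.
pose r : R := (n.+2%:R^-1)%R.
have n2 : (n.+2%:R != 0 :> R)%R by [].
have r01 : (0 < r < 1)%R by rewrite invr_gt0 ltr0n /= invf_lt1 ?ltr0n// ltr1n.
have rE : (r = n.+1%:R^-1 * (1 - r))%R.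
  have m1 : (n.+1%:R + 1 != 0 :> R)%R by rewrite natr1.
  have key (m : R) : (m != 0 -> m + 1 != 0 -> (m + 1)^-1 = m^-1 * (1 - (m + 1)^-1))%R.
    by move=> m0 m10; field; rewrite m0 m10.
  by rewrite /r -[n.+2%:R%R]natr1; exact: key.
have rE1 : ((1 + n.+1%:R^-1) * (1 - r) = 1)%R by rewrite mulrDl mul1r -rE subrK.
have /andP[r0 r1] := r01.
have r10 : (0 <= 1 - r)%R by rewrite subr_ge0 ltW.
set G0 := fun t => \int[lam]_x g ord0 (cons_pair (x, t)).
have mG0 : measurable_fun setT G0 by exact: (measurable_int_r (mg ord0)).
have G00 t : 0 <= G0 t by apply: integral_ge0.
pose H i x := \int[Lam n.+2]_t g (lift ord0 i) (cons_pair (x, t)).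
have mH i : measurable_fun setT (H i) by exact: (measurable_int_l (mg (lift ord0 i))).
have H0 i x : 0 <= H i x by apply: integral_ge0.
have fG t x : f (cons_pair (x, t)) <= G0 t.
  by apply: le_trans (fg ord0 _) _; under eq_integral do rewrite tuple_set0.
have mfr : measurable_fun setT (fun t => f t `^ (1 + r)) by exact: poweR_measurable.
rewrite -/r tonelli_cons_l => [|//|t]; last exact: poweR_ge0.
(* With the first coordinate frozen, f^(1+r) is at most G0^r times f, and f is the power 1 - r of
   the integrand that the induction hypothesis bounds; Hoelder's inequality separates the two. *)
have slice x : \int[Lam n.+2]_t f (cons_pair (x, t)) `^ (1 + r) <=
    (\int[Lam n.+2]_t G0 t) `^ r * \prod_i (H i x `^ r).
  apply: (@le_trans _ _ (\int[Lam n.+2]_t (G0 t `^ r *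
      (f (cons_pair (x, t)) `^ (1 + n.+1%:R^-1)) `^ (1 - r)))).
    apply: ge0_le_integral => //.
    - by move=> t _; exact: poweR_ge0.
    - exact: (measurable_cons_l x mfr).
    - apply: emeasurable_funM; first exact: poweR_measurable.
      by do 2!apply: poweR_measurable; exact: (measurable_cons_l x mf).
    - move=> t _; rewrite -poweRrM rE1 poweRe1//.
      have := f0 (cons_pair (x, t)); have := fG t x.
      move: (f _) => [y| |]//; last first.
        rewrite leye_eq => /eqP -> _.
        by rewrite !poweRyr ?gt_eqF ?addr_gt0// mulyy leey.
      move=> yG y0; rewrite poweR_EFin powRD; last by rewrite gt_eqF// addr_gt0.
      rewrite powRr1// EFinM muleC lee_pmul//.
        by rewrite lee_fin powR_ge0.
      rewrite -poweR_EFin; apply: gt0_ler_poweR => //; first exact: ltW.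
      + by rewrite in_itv/= y0 leey.
      + by rewrite in_itv/= G00 leey.
  apply: le_trans; first apply: (hoelder_ereal (Lam n.+2) r01) => //.
  - by apply: poweR_measurable; exact: (measurable_cons_l x mf).
  - by move=> t; exact: poweR_ge0.
  rewrite lee_wpmul2l ?poweR_ge0//.
  have -> : \prod_i (H i x `^ r) = (\prod_i (H i x `^ (n.+1%:R^-1))) `^ (1 - r).
    rewrite prode_poweR; last by move=> i; exact: poweR_ge0.
    by apply: eq_bigr => i _; rewrite -poweRrM -rE.
  apply: gt0_ler_poweR => //.
  - by rewrite in_itv/= leey integral_ge0// => t _; exact: poweR_ge0.
  - by rewrite in_itv/= leey prode_ge0// => i _; exact: poweR_ge0.
  apply: (IH (fun t => f (cons_pair (x, t)))
    (fun i t => g (lift ord0 i) (cons_pair (x, t)))) => //.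
  - exact: (measurable_cons_l x mf).
  - by move=> i; exact: (measurable_cons_l x (mg (lift ord0 i))).
  - move=> i t; apply: le_trans (fg (lift ord0 i) _) _.
    by under eq_integral do rewrite tuple_setS.
have mHr : measurable_fun setT (fun x => \prod_i (H i x `^ r)).
  by apply: measurable_prode => i; exact: poweR_measurable.
have Hr0 x : 0 <= \prod_i (H i x `^ r).
  by apply: prode_ge0 => i _; exact: poweR_ge0.
apply: (@le_trans _ _ (\int[lam]_x ((\int[Lam n.+2]_t G0 t) `^ r * \prod_i (H i x `^ r)))).
  apply: ge0_le_integral => //.
  - by move=> x _; apply: integral_ge0 => t _; exact: poweR_ge0.
  - by apply: (measurable_int_l mfr) => t; exact: poweR_ge0.
  - exact: measurable_funeM.
rewrite ge0_integralZl//; last exact: poweR_ge0.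
rewrite big_ord_recl (tonelli_cons_r (mg ord0))// lee_wpmul2l ?poweR_ge0//.
(* What remains is a product of n + 2 functions of the first coordinate, each to the power
   1/(n+2). *)
apply: le_trans (hoelder_prode lam mH H0) _.
rewrite le_eqVlt; apply/orP; left; apply/eqP; apply: eq_bigr => i _.
by rewrite (tonelli_cons_l (mg (lift ord0 i))).
Qed.
End tuple_integrals.

Section line_integrals.
Local Open Scope ereal_scope.
Context {R : realType}.
Local Notation lam := (@lebesgue_measure R).
Local Notation Lam n := (@lebesgue_tuple R n).

(** Fubini's theorem, since [F] is signed; almost every slice is integrable, which is all that the
    induction requires. *)
Lemma integral_line0 n (F : n.-tuple R -> \bar R) (i : 'I_n) :
  (Lam n).-integrable setT F ->
  (forall t, \int[lam]_x F (tuple_set t i x) = 0) -> \int[Lam n]_t F t = 0.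
Proof.
elim: n F i => [|n IH] F i iF; first by case: i.
have mF := measurable_int _ iF.
have mFc := measurableT_comp mF (@measurable_cons_pair R n).
have iFc : (lam \x Lam n).-integrable setT (F \o @cons_pair R n).
  apply/integrableP; split => //.
  have /integrableP[_] := iF; rewrite ge0_integral_pushforward//.
  - exact: measurable_cons_pair.
  - exact: (measurableT_comp (@abse_measurable R _) mF).
have -> : \int[Lam n.+1]_t F t = \int[lam \x Lam n]_p F (cons_pair p).
  by rewrite integral_pushforward//; exact: measurable_cons_pair.
case: (unliftP ord0 i) => [j|] -> F0.
  rewrite -(integral12_prod_meas1 iFc) (ae_eq_integral (cst 0)) ?integral0//.
    exact: measurable_fubini_F iFc.
  apply: filterS (ae_integrable1 iFc) => x iFx _ /=.
  apply: (IH (fun t => F (cons_pair (x, t))) j iFx) => t.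
  by rewrite -[RHS](F0 (cons_pair (x, t))); apply: eq_integral => y _; rewrite tuple_setS.
rewrite -(integral21_prod_meas1 iFc) integral0_eq// => t _.
by rewrite -[RHS](F0 (cons_pair (0%R, t))); apply: eq_integral => x _; rewrite tuple_set0.
Qed.

Section ftc.
Local Open Scope ring_scope.
Variables (f df : R -> R) (M : R).
Hypothesis fdf : forall t : R, is_derive t 1 f (df t).
Hypothesis cdf : continuous df.
Hypothesis f0 : forall t, ~ `[- M, M]%classic t -> f t = 0.
Hypothesis df0 : forall t, ~ `[- M, M]%classic t -> df t = 0.

Let cf : continuous f.
Proof.
move=> x; apply: differentiable_continuous; apply/derivable1_diffP.
by case: (fdf x).
Qed.

Let ftc (a b : R) : a < b ->
  (\int[lam]_(x in `[a, b]) (df x)%:E = (f b)%:E - (f a)%:E)%E.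
Proof.
move=> ab; apply: continuous_FTC2 => //.
- exact: continuous_subspaceT.
- split.
  + by move=> x _; case: (fdf x).
  + by apply: cvg_at_right_filter; exact: cf.
  + by apply: cvg_at_left_filter; exact: cf.
- by move=> x _; rewrite derive1E; case: (fdf x).
Qed.

Lemma ftc_compact0 : (\int[lam]_x (df x)%:E = 0)%E.
Proof.
(* [M] may be negative, and [f] is only given to vanish strictly outside its interval; at the ends
   of the larger interval [f] is 0. *)
pose M' := `|M| + 1.
have MM : M < M' by rewrite (le_lt_trans (ler_norm M))// ltrDl.
have M'0 : 0 < M' by rewrite ltr_wpDl.
have -> : (\int[lam]_x (df x)%:E = \int[lam]_(x in `[(- M')%R, M']) (df x)%:E)%E.
  rewrite [RHS]integral_mkcond; apply: eq_integral => x _.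
  rewrite patchE; case: ifPn => //; rewrite notin_setE => xM.
  congr (_%:E); apply: df0 => /=; rewrite in_itv/= => /andP[a b].
  apply: xM; rewrite /= in_itv/= (le_trans _ a) ?lerN2 ?(ltW MM)//.
  by rewrite (le_trans b)// ltW.
rewrite ftc ?gtrN// !f0 ?subee//.
- by rewrite /= in_itv/= => /andP[]; rewrite lerN2 leNgt MM.
- by rewrite /= in_itv/= => /andP[_]; rewrite leNgt MM.
Qed.

Lemma ftc_compact_le x : (`|f x|%:E <= \int[lam]_t `|df t|%:E)%E.
Proof.
(* A point to the left of both [x] and the support, where the integration can start. *)
pose a := Num.min (- M) x - 1.
have ax : a < x by rewrite ltrBlDr (@le_lt_trans _ _ x) ?ltrDl// ge_min lexx orbT.
have fa : f a = 0.
  apply: f0 => /=; rewrite in_itv/= => /andP[+ _]; rewrite leNgt => /negP; apply.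
  by rewrite ltrBlDr (@le_lt_trans _ _ (- M)) ?ltrDl// ge_min lexx.
have -> : `|f x|%:E = (`| \int[lam]_(t in `[a, x]) (df t)%:E |)%E.
  by rewrite ftc// fa sube0.
have mdf : measurable_fun setT df by exact: continuous_measurable_fun.
apply: (@le_trans _ _ (\int[lam]_(t in `[a, x]) `|(df t)%:E|)%E).
  apply: le_abse_integral => //; apply/measurable_EFinP.
  exact: measurable_funTS.
apply: ge0_subset_integral => //.
by apply/measurable_EFinP; apply: measurableT_comp.
Qed.

End ftc.
End line_integrals.

Section powR_continuity.
Context {R : realType}.

Lemma continuous_normr_powR (a : R) : 0 < a -> continuous (fun y : R => `|y| `^ a).
Proof.
move=> a0 x; have [->|x0] := eqVneq x 0.
  apply/cvgrPdist_lt => e e0; apply/nbhs_ballP.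
  exists (e `^ a^-1) => [|y]; first exact: powR_gt0.
  rewrite /ball/= sub0r normrN => ye.
  rewrite normr0 powR0 ?gt_eqF// sub0r normrN ger0_norm ?powR_ge0//.
  move: ye => /(gt0_ltr_powR a0); rewrite !nnegrE normr_ge0 powR_ge0 => /(_ isT isT).
  by rewrite -powRrM mulVf ?gt_eqF// powRr1 ?(ltW e0).
apply: (@continuous_comp _ _ _ (@Num.norm R R) (fun y => y `^ a)).
  exact: norm_continuous.
apply: differentiable_continuous; apply/derivable1_diffP.
by case: (@is_derive1_powR _ a `|x|) => //; rewrite normr_gt0.
Qed.

End powR_continuity.

Section sobolev_ineq.
Context {R : realType}.
Local Notation lam := (@lebesgue_measure R).
Local Notation Lam n := (@lebesgue_tuple R n).

Section line.
Context {N : nat}.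
Local Notation E := ('rV[R]_N).
Local Notation mu := (@lebesgue_rV R N).
Local Notation e i := (delta_mx 0 i : E).

Lemma rV_tuple_set (t : N.-tuple R) i s :
  rV_of_tuple (tuple_set t i s) = (rV_of_tuple t - tnth t i *: e i) + s *: e i.
Proof.
apply/rowP => j; rewrite !mxE tnth_mktuple /=.
have [->|ji] := eqVneq j i; first by rewrite !mulr1 subrr add0r.
by rewrite !mulr0 subr0 addr0.
Qed.

Lemma tuple_set_coord (t : N.-tuple R) i s : rV_of_tuple (tuple_set t i s) ord0 i = s.
Proof. by rewrite mxE tnth_mktuple eqxx. Qed.

Lemma integral_rV (F : E -> \bar R) : measurable_fun setT F ->
  (forall x, 0 <= F x)%E ->
  (\int[mu]_x F x = \int[Lam N]_t F (rV_of_tuple t))%E.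
Proof.
move=> mF F0; rewrite ge0_integral_pushforward//; last exact: measurable_rV_of_tuple.
Qed.

Lemma integral_partial0 phi i : C0infty phi -> (\int[mu]_x (partial i phi x)%:E = 0)%E.
Proof.
move=> phis; have dphis := C0infty_partial i phis.
have [M phiM] := ((C0inftyP _).1 phis).2.
have [M' dphiM] := ((C0inftyP _).1 dphis).2.
have iF := C0infty_integrable dphis.
have iFc : (Lam N).-integrable setT ((EFin \o partial i phi) \o rV_of_tuple).
  have /integrableP[mF] := iF; rewrite integral_rV//; last by apply: measurableT_comp.
  move=> H; apply/integrableP; split=> //.
  by apply: (measurableT_comp mF); exact: measurable_rV_of_tuple.
have -> : (\int[mu]_x (partial i phi x)%:E =
    \int[Lam N]_t (partial i phi (rV_of_tuple t))%:E)%E.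
  rewrite integral_pushforward//; first exact: measurable_rV_of_tuple.
  exact: (measurable_int _ iF).
apply: (integral_line0 iFc (i := i)) => t.
(* The point of the line whose i-th coordinate is 0, so that the parameter [s] is the coordinate
   itself. *)
pose z := rV_of_tuple t - tnth t i *: e i.
have zE s : z + s *: e i = rV_of_tuple (tuple_set t i s) by rewrite rV_tuple_set.
have out (m : R) s : ~ `[- m, m]%classic s -> ~ cube m (z + s *: e i).
  by move=> sm zm; apply: sm; have := zm i; rewrite zE tuple_set_coord.
transitivity (\int[lam]_s (partial i phi (z + s *: e i))%:E)%E.
  by apply: eq_integral => s _ /=; rewrite zE.
apply: (@ftc_compact0 _ (fun s : R => phi (z + s *: e i)) _ (Num.max M M')).
- move=> s; apply: (is_derive_line phi z (e i) s _).1.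
  by apply: smooth_is_derive; case: phis.
- move=> s; apply: (@continuous_comp _ _ _ (fun s : R => z + s *: e i) (partial i phi)).
    apply: cvgD; [exact: cvg_cst|apply: cvgZr_tmp; exact: cvg_id].
  by apply: smooth_continuous; case: dphis.
- move=> s sM; apply: phiM => zM; apply: (out _ _ sM).
  by apply: cube_sub zM; rewrite le_max lexx.
- move=> s sM; apply: dphiM => zM; apply: (out _ _ sM).
  by apply: cube_sub zM; rewrite le_max lexx orbT.
Qed.

(** The hypothesis of [gagliardo] for f = |phi|^c, by the fundamental theorem of calculus on a line.
    The condition c > 2 makes the derivative c |y|^(c-2) y a product of continuous functions. *)
Lemma powR_line_le (phi : E -> R) (i : 'I_N) (c : R) (t : N.-tuple R) : C0infty phi -> 2 < c ->
  ((`|phi (rV_of_tuple t)| `^ c)%:E <= \int[lam]_s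
    (c * `|phi (rV_of_tuple (tuple_set t i s))| `^ (c - 1) *
      `|partial i phi (rV_of_tuple (tuple_set t i s))|)%:E)%E.
Proof.
move=> phis c2; have dphis := C0infty_partial i phis.
have c0 : 0 < c by rewrite (lt_trans _ c2).
have [M phiM] := ((C0inftyP _).1 phis).2.
pose z := rV_of_tuple t - tnth t i *: e i.
have zE s : z + s *: e i = rV_of_tuple (tuple_set t i s) by rewrite rV_tuple_set.
have out s : ~ `[- M, M]%classic s -> phi (z + s *: e i) = 0.
  by move=> sm; apply: phiM => zm; apply: sm; have := zm i; rewrite zE tuple_set_coord.
have cz : continuous (fun s : R => z + s *: e i).
  by move=> s; apply: cvgD; [exact: cvg_cst|apply: cvgZr_tmp; exact: cvg_id].
pose F y : R := c * `|y| `^ (c - 2) * y.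
have cF : continuous F.
  move=> y; apply: (@continuousM _ _ (fun y => c * `|y| `^ (c - 2)) id); last exact: cvg_id.
  apply: (@continuousM _ _ (fun y => c) (fun y => `|y| `^ (c - 2))); first exact: cvg_cst.
  by apply: continuous_normr_powR; rewrite subr_gt0.
have cphi (f : E -> R) : continuous f -> continuous (fun s : R => f (z + s *: e i)).
  by move=> cf s; apply: (@continuous_comp _ _ _ (fun s : R => z + s *: e i) f); [exact: cz|exact: cf].
have := @ftc_compact_le _ (fun s : R => `|phi (z + s *: e i)| `^ c)
  (fun s => F (phi (z + s *: e i)) * partial i phi (z + s *: e i)) M.
move=> /(_ _ _ _ (tnth t i)); rewrite subrK => H.
apply: (le_trans (le_trans _ (H _ _ _))).
- by rewrite lee_fin ler_norm.
- move=> s; apply: (@is_derive1_comp _ (fun y => `|y| `^ c) (fun s : R => phi (z + s *: e i))).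
    by apply: is_derive_normr_powR; rewrite (lt_trans _ c2)// ltr1n.
  apply: (is_derive_line phi z (e i) s _).1.
  by apply: smooth_is_derive; case: phis.
- move=> s; apply: (@continuousM _ _ (fun s : R => F (phi (z + s *: e i))) (fun s : R => partial i phi (z + s *: e i))).
    apply: (@continuous_comp _ _ _ (fun s : R => phi (z + s *: e i)) F); last exact: cF.
    by apply: cphi; apply: smooth_continuous; case: phis.
  by apply: cphi; apply: smooth_continuous; case: dphis.
- by move=> s /out ->; rewrite normr0 powR0// gt_eqF.
- rewrite le_eqVlt; apply/orP; left; apply/eqP; apply: eq_integral => s _.
  rewrite zE; set y := phi _; set w := partial _ _ _; congr (_%:E).
  rewrite normrM /F !normrM (gtr0_norm c0) (ger0_norm (powR_ge0 _ _)).
  congr (_ * _); rewrite -mulrA; congr (_ * _).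
  have [->|y0] := eqVneq y 0.
    by rewrite normr0 mulr0 powR0// gt_eqF// subr_gt0 (lt_trans _ c2)// ltr1n.
  rewrite -[X in _ * X]powRr1// -powRD ?normr_eq0 ?y0 ?implybT//.
  by congr (_ `^ _); ring.
Qed.

End line.
End sobolev_ineq.

Section sobolev_inequality.
Context {R : realType}.

(** The square of [dirichlet_norm] on test functions, as a real number. *)
Definition dir {N : nat} (phi : 'rV[R]_N -> R) : R :=
  \int[lebesgue_rV N]_x (\sum_(i < N) partial i phi x ^+ 2).

Section dir.
Context {N : nat}.
Local Notation E := ('rV[R]_N).
Local Notation mu := (@lebesgue_rV R N).
Local Notation intg f := (mu.-integrable setT (EFin \o f)).
Implicit Types phi psi : E -> R.

Lemma C0infty_intg_sqr phi : C0infty phi -> intg (fun x => phi x ^+ 2).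
Proof. by move=> phis; apply: C0infty_integrable; exact: C0inftyM. Qed.

Lemma intg_grad phi : C0infty phi -> intg (fun x => \sum_(i < N) partial i phi x ^+ 2).
Proof.
by move=> phis; apply: intg_sum => i; apply: C0infty_intg_sqr; exact: C0infty_partial.
Qed.

Lemma sum_sqr_ge0 n (a : 'I_n -> R) : 0 <= \sum_(i < n) a i ^+ 2.
Proof. by apply: sumr_ge0 => i _; exact: sqr_ge0. Qed.

Lemma dir_ge0 phi : 0 <= dir phi.
Proof. by apply: Rint_ge0 => x; exact: sum_sqr_ge0. Qed.

Lemma dir_partial phi i : C0infty phi -> \int[mu]_x (partial i phi x ^+ 2) <= dir phi.
Proof.
move=> phis; apply: Rint_le.
- by apply: C0infty_intg_sqr; exact: C0infty_partial.
- exact: intg_grad.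
- move=> x; rewrite (bigD1 i)//= lerDl; apply: sumr_ge0 => j _; exact: sqr_ge0.
Qed.

Lemma C0infty_powR_intg phi (c : R) : 0 < c -> C0infty phi -> intg (fun x => `|phi x| `^ c).
Proof.
move=> c0 phis; have [C C0 phiC] := C0infty_bounded phis.
have [M phiM] := ((C0inftyP _).1 phis).2.
apply: (@integrable_bounded _ _ _ M (C `^ c)).
- apply: continuous_measurable_rV => x.
  apply: (@continuous_comp _ _ _ phi (fun y => `|y| `^ c)).
    by apply: smooth_continuous; case: phis.
  exact: continuous_normr_powR.
- move=> x; rewrite ger0_norm ?powR_ge0//; apply: ge0_ler_powR => //.
  + exact: ltW.
  + by rewrite nnegrE ltW.
- by move=> x /phiM ->; rewrite normr0 powR0 ?gt_eqF.
Qed.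

End dir.

(** With N = m + 2, the exponent c = 2(N-1)/(N-2) satisfies c N/(N-1) = p and c - 1 = p/2. So
    [gagliardo] for |phi|^c bounds X, the integral of |phi|^p, by a product of integrals of c
    |phi|^(p/2) |d_i phi|, each at most c (X D)^(1/2) by Hoelder's inequality. The total power of X
    on the right is below 1 and X is finite for a test function, so X can be solved for. *)
Lemma sobolev n (p := @crit_exp R n.+3) : exists2 C : R, 0 < C &
  forall phi : 'rV[R]_(n.+3) -> R, C0infty phi ->
    \int[lebesgue_rV n.+3]_x (`|phi x| `^ p) <= C * dir phi `^ (p / 2).
Proof.
pose m : R := n.+1%:R.
have m0 : 0 < m by rewrite ltr0n.
have m1 : m + 1 = n.+2%:R by rewrite natr1.
have pE : p = 2 * (m + 2) / m.
  rewrite /p /crit_exp natrM; congr (_ * _ / _); rewrite /m.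
  by rewrite -!natr1; ring.
have m3 : n.+3%:R = m + 2 by rewrite /m -!natr1; ring.
clearbody m.
pose c : R := 2 * (m + 1) / m.
have c2 : 2 < c by rewrite /c ltr_pdivlMr// ltr_pM2l// ltrDl.
have c1 : 0 < c - 1 by rewrite subr_gt0 (lt_trans _ c2)// ltr1n.
have c0 : 0 < c by rewrite (lt_trans _ c2).
have p0 : 0 < p by rewrite pE divr_gt0// mulr_gt0// addr_gt0.
exists (c `^ p) => [|phi phis]; first by rewrite powR_gt0// (lt_trans _ c2).
set mu := lebesgue_rV n.+3; set X := \int[mu]_x _; set D := dir phi.
have X0 : 0 <= X by apply: Rint_ge0 => x; exact: powR_ge0.
have D0 : 0 <= D by exact: dir_ge0.
have [->|Xn0] := eqVneq X 0; first by rewrite mulr_ge0 ?powR_ge0.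
have Xgt0 : 0 < X by rewrite lt0r Xn0.
have XE : X%:E = (\int[mu]_x (`|phi x| `^ p)%:E)%E.
  by rewrite Rintegral_EFin//; exact: C0infty_powR_intg.
pose f (t : n.+3.-tuple R) : \bar R := (`|phi (rV_of_tuple t)| `^ c)%:E.
pose G i (x : 'rV[R]_(n.+3)) : \bar R := (c * `|phi x| `^ (c - 1) * `|partial i phi x|)%:E.
have mphi (a : R) : 0 < a -> measurable_fun setT (fun x => `|phi x| `^ a).
  by move=> a0; apply: (@intg_measurable _ _ _ mu); exact: C0infty_powR_intg.
have mG i : measurable_fun setT (G i).
  apply/measurable_EFinP/measurable_funM.
    by apply: measurable_funM => //; exact: mphi.
  by apply: measurableT_comp => //; apply: C0infty_measurable; exact: C0infty_partial.
have G0 i x : (0 <= G i x)%E.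
  by rewrite lee_fin (mulr_ge0 (mulr_ge0 (ltW c0) (powR_ge0 _ _)) (normr_ge0 _)).
have mr := @measurable_rV_of_tuple _ R n.+3.
have ga : (X%:E <= \prod_(i < n.+3) (\int[mu]_x G i x) `^ (n.+2%:R^-1))%E.
  have -> : (\prod_(i < n.+3) (\int[mu]_x G i x) `^ (n.+2%:R^-1) =
      \prod_(i < n.+3) (\int[lebesgue_tuple n.+3]_t G i (rV_of_tuple t)) `^ (n.+2%:R^-1))%E.
    by apply: eq_bigr => i _; rewrite /mu integral_rV.
  have -> : (X%:E = \int[lebesgue_tuple n.+3]_t f t `^ (1 + n.+2%:R^-1))%E.
    rewrite XE integral_rV//; last by apply/measurable_EFinP; exact: mphi.
    apply: eq_integral => t _; rewrite /f poweR_EFin -powRrM.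
    congr ((_ `^ _)%:E); rewrite pE /c -m1; field.
    by rewrite !gt_eqF// addr_gt0.
  apply: (@gagliardo R n.+1 f (fun i t => G i (rV_of_tuple t))) => //.
  - apply: (@measurableT_comp _ _ _ _ _ _ (fun x => (`|phi x| `^ c)%:E)) => //.
    by apply/measurable_EFinP; exact: mphi.
  - by move=> t; rewrite lee_fin powR_ge0.
  - by move=> i; exact: (measurableT_comp (mG i) mr).
  - by move=> i t; exact: powR_line_le.
have GB i : (\int[mu]_x G i x <= (c * (X `^ 2^-1 * D `^ 2^-1))%:E)%E.
  rewrite (eq_integral (fun x => c%:E * ((`|phi x| `^ p)%:E `^ 2^-1 *
      (partial i phi x ^+ 2)%:E `^ (1 - 2^-1)))%E); last first.
    move=> x _; rewrite /G -mulrA EFinM; congr (_ * _)%E.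
    rewrite !poweR_EFin -EFinM -powRrM; congr (_ * _)%:E.
      by congr (_ `^ _); rewrite pE /c; field; rewrite gt_eqF.
    have -> : 1 - 2^-1 = 2^-1 :> R by field.
    by rewrite powR12_sqrt ?sqr_ge0// sqrtr_sqr.
  have mF : measurable_fun setT (fun x => (`|phi x| `^ p)%:E).
    by apply/measurable_EFinP; exact: mphi.
  have mK : measurable_fun setT (fun x => (partial i phi x ^+ 2)%:E).
    by apply: (measurable_int mu); apply: C0infty_intg_sqr; exact: C0infty_partial.
  rewrite ge0_integralZl_EFin ?(ltW c0)//; last 2 first.
  - by move=> x _; rewrite mule_ge0// poweR_ge0.
  - by apply: emeasurable_funM; exact: poweR_measurable.
  rewrite [leRHS]EFinM lee_wpmul2l ?lee_fin ?(ltW c0)//.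
  apply: le_trans; first apply: (hoelder_ereal mu _ mF mK) => //.
  - by apply/andP; split; lra.
  - by move=> x; rewrite lee_fin sqr_ge0.
  rewrite -XE -Rintegral_EFin; last by apply: C0infty_intg_sqr; exact: C0infty_partial.
  have -> : 1 - 2^-1 = 2^-1 :> R by field.
  rewrite !poweR_EFin -EFinM lee_fin ler_wpM2l ?powR_ge0//.
  apply: ge0_ler_powR => //; rewrite ?nnegrE//; first by apply: Rint_ge0 => x; exact: sqr_ge0.
  exact: dir_partial.
pose B := c * (X `^ 2^-1 * D `^ 2^-1).
have B0 : 0 <= B by rewrite (mulr_ge0 (ltW c0) (mulr_ge0 (powR_ge0 _ _) (powR_ge0 _ _))).
have XB : X <= B `^ (n.+3%:R / n.+2%:R).
  rewrite -lee_fin; apply: (le_trans ga).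
  have -> : B `^ (n.+3%:R / n.+2%:R) = \prod_(i < n.+3) (B `^ (n.+2%:R^-1)).
    by rewrite prodr_const card_ord -powR_mulrn ?powR_ge0// -powRrM mulrC.
  suff /andP[] : (0 <= \prod_(i < n.+3) (\int[mu]_x G i x) `^ (n.+2%:R^-1) <=
    (\prod_(i < n.+3) (B `^ (n.+2%:R^-1)))%:E)%E by [].
  elim/big_ind2 : _ => [|x y x' y' /andP[x0 xy] /andP[x0' xy']|i _].
  - by rewrite lee01 lexx.
  - by rewrite mule_ge0// EFinM lee_pmul.
  - rewrite poweR_ge0/= -poweR_EFin; apply: gt0_ler_poweR => //.
    + by rewrite in_itv/= leey integral_ge0.
    + by rewrite in_itv/= leey lee_fin B0.
have sE : n.+3%:R / n.+2%:R = (m + 2) / (m + 1) :> R.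
  by rewrite -m1 m3.
move: XB; rewrite sE; set s := (m + 2) / (m + 1) => XB.
have mm : 0 < m + 1 by rewrite addr_gt0.
have s0 : 0 < s by rewrite divr_gt0// addr_gt0.
pose w := 2 * (m + 1) / m.
have w0 : 0 < w by rewrite divr_gt0// mulr_gt0.
have sw : s * w = p by rewrite pE /s /w; field; rewrite !gt_eqF.
(* The power [w] satisfies s w = p and w - p/2 = 1: raising X <= B^s to it and dividing by X^(p/2)
   isolates X. *)
have XE1 : X = X `^ w / X `^ (p / 2).
  rewrite -powRB ?(negPf Xn0) ?implybT//.
  have -> : w - p / 2 = 1 by rewrite pE /w; field; rewrite gt_eqF.
  by rewrite powRr1.
have : X `^ w <= B `^ p.
  rewrite -sw powRrM; apply: ge0_ler_powR => //; rewrite ?nnegrE ?powR_ge0//; exact: ltW.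
rewrite /B powRM ?(ltW c0) ?mulr_ge0 ?powR_ge0// powRM ?powR_ge0// -!powRrM.
rewrite ![2^-1 * p]mulrC => XW.
rewrite XE1 ler_pdivrMr ?powR_gt0//; apply: le_trans XW _.
by rewrite le_eqVlt; apply/orP; left; apply/eqP; ring.
Qed.

End sobolev_inequality.

Section integration_by_parts_rV.
Context {R : realType} {N : nat}.
Local Notation E := ('rV[R]_N).
Local Notation mu := (@lebesgue_rV R N).
Implicit Types phi psi : E -> R.

Lemma integration_by_parts_rV phi psi i : C0infty phi -> C0infty psi ->
  \int[mu]_x (phi x * partial i psi x) = - \int[mu]_x (partial i phi x * psi x).
Proof.
move=> phis psis.
have := integral_partial0 i (C0inftyM phis psis).
rewrite (partialM _ (C0infty_smooth phis) (C0infty_smooth psis)) => I0.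
have i1 := C0infty_integrable (C0inftyM phis (C0infty_partial i psis)).
have i2 := C0infty_integrable (C0inftyM (C0infty_partial i phis) psis).
apply/eqP; rewrite -subr_eq0 opprK -RintD//; apply/eqP.
rewrite /Rintegral -[RHS]/(fine 0) -I0; congr fine; apply: eq_integral => x _.
by rewrite [psi x * _]mulrC.
Qed.

End integration_by_parts_rV.

(** * Inequalities for powers *)

Section powR_inequalities.
Context {R : realType}.
Implicit Types a b c r x y : R.

Lemma powR_sqr x r : (x ^+ 2) `^ r = `|x| `^ (2 * r).
Proof. by rewrite powRrM powR_mulrn// real_normK ?num_real. Qed.

Lemma powR_subadd a b r : 0 <= a -> 0 <= b -> 0 < r <= 1 ->
  (a + b) `^ r <= a `^ r + b `^ r.
Proof.
move=> a0 b0 /andP[r0 r1].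
have [s0|sn0] := eqVneq (a + b) 0.
  by rewrite s0 powR0 ?gt_eqF// addr_ge0 ?powR_ge0.
have s0 : 0 < a + b by rewrite lt0r sn0 addr_ge0.
have le x : 0 <= x -> x <= a + b -> x / (a + b) * (a + b) `^ r <= x `^ r.
  move=> x0 xs; have [->|xn0] := eqVneq x 0.
    by rewrite mul0r mul0r powR_ge0.
  have -> : x `^ r = (x / (a + b)) `^ r * (a + b) `^ r.
    by rewrite -powRM ?divr_ge0 ?(ltW s0)// divfK.
  rewrite ler_wpM2r ?powR_ge0//; apply: ger1_powR => //.
  apply/andP; split; last by rewrite ler_pdivrMr// mul1r.
  by apply: divr_gt0 => //; rewrite lt0r xn0.
have -> : (a + b) `^ r = a / (a + b) * (a + b) `^ r + b / (a + b) * (a + b) `^ r.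
  by rewrite -mulrDl -mulrDl divff// mul1r.
by apply: lerD; apply: le => //; rewrite ?lerDl ?lerDr.
Qed.

(** Convexity without calculus: Young's inequality with weights (r-1)/r and 1/r for |a|^r and |a +
    b|^r rearranges to the tangent line at [a]. *)
Lemma normr_powR_tangent a b r : 1 < r ->
  `|a| `^ r + r * `|a| `^ (r - 2) * a * b <= `|a + b| `^ r.
Proof.
move=> r1; have r0 : 0 < r by rewrite (lt_trans _ r1).
have [->|an0] := eqVneq a 0.
  by rewrite mulr0 mul0r normr0 powR0 ?gt_eqF// !add0r powR_ge0.
have na : 0 < `|a| by rewrite normr_gt0.
have t01 : 0 < (r - 1) / r < 1.
  apply/andP; split; first by rewrite divr_gt0 ?subr_gt0.
  by rewrite ltr_pdivrMr// mul1r ltrBlDr ltrDl.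
have := young_powR t01 (powR_ge0 `|a| r) (powR_ge0 `|a + b| r).
rewrite -!powRrM.
have -> : r * ((r - 1) / r) = r - 1 by field; rewrite gt_eqF.
have -> : r * (1 - (r - 1) / r) = 1 by field; rewrite gt_eqF.
rewrite powRr1// => H.
have E : `|a| `^ r = `|a| `^ (r - 2) * a * a.
  rewrite -mulrA -expr2 -(real_normK (num_real a)) -powR_mulrn// -powRD ?normr_eq0 ?an0 ?implybT//.
  by congr (_ `^ _); ring.
have E1 : `|a| `^ (r - 1) = `|a| `^ (r - 2) * `|a|.
  rewrite -[X in _ * X]powRr1// -powRD ?normr_eq0 ?an0 ?implybT//.
  by congr (_ `^ _); ring.
have H1 : `|a| `^ (r - 2) * a * (a + b) <= `|a| `^ (r - 1) * `|a + b|.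
  by rewrite E1 -!mulrA ler_wpM2l ?powR_ge0// -normrM ler_norm.
have := le_trans H1 H.
rewrite -(ler_pM2l r0) => H2.
rewrite -subr_ge0; move: H2; rewrite -subr_ge0.
have -> : r * ((r - 1) / r * `|a| `^ r + (1 - (r - 1) / r) * `|a + b| `^ r) =
   (r - 1) * `|a| `^ r + `|a + b| `^ r by field; rewrite gt_eqF.
set X := `|a + b| `^ r; rewrite E.
by set L := (Z in 0 <= Z -> _) => HL; rewrite (_ : X - _ = L)// /L; ring.
Qed.

Lemma powR_midpoint_convex a b r : 0 <= a -> 0 <= b -> 1 <= r ->
  ((a + b) / 2) `^ r <= (a `^ r + b `^ r) / 2.
Proof.
move=> a0 b0; rewrite le_eqVlt => /predU1P[<-|r1].
  by rewrite !powRr1// divr_ge0 ?addr_ge0.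
set m := (a + b) / 2; have m0 : 0 <= m by rewrite divr_ge0 ?addr_ge0.
have := normr_powR_tangent m (a - m) r1; have := normr_powR_tangent m (b - m) r1.
rewrite !subrKC !ger0_norm//; set c := r * _ * m => Hb Ha.
rewrite ler_pdivlMr//; have E : a - m + (b - m) = 0 by rewrite /m; field.
have := lerD Ha Hb; rewrite addrACA -mulrDr E mulr0 addr0.
by rewrite mulr_natr mulr2n.
Qed.

(** Convexity of the inverse power 1/r, applied to a^r and b^r. *)
Lemma powR_midpoint_concave a b r : 0 <= a -> 0 <= b -> 0 < r <= 1 ->
  (a `^ r + b `^ r) / 2 <= ((a + b) / 2) `^ r.
Proof.
move=> a0 b0 /andP[r0 r1].
have := @powR_midpoint_convex (a `^ r) (b `^ r) r^-1 (powR_ge0 _ _) (powR_ge0 _ _).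
rewrite -!powRrM divff ?gt_eqF// !powRr1// invf_ge1// r1 => /(_ isT).
move=> /(ge0_ler_powR (ltW r0)); rewrite !nnegrE powR_ge0 divr_ge0 ?addr_ge0//.
move=> /(_ isT isT); rewrite -powRrM mulVf ?gt_eqF// powRr1//.
by rewrite divr_ge0 ?addr_ge0 ?powR_ge0.
Qed.

Lemma powR_absorb r1 r2 (e : R) : 0 <= r1 -> r1 < r2 -> 0 < e ->
  exists2 C : R, 0 <= C & forall a, 0 <= a -> a `^ r1 <= C + e * a `^ r2.
Proof.
(* [M] solves e M^(r2-r1) = 1: below it a^r1 is bounded by a constant, above it e a^r2 takes
   over. *)
move=> r10 r12 e0; pose M := e `^ (- (r2 - r1)^-1).
have d0 : 0 < r2 - r1 by rewrite subr_gt0.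
have M0 : 0 < M by rewrite powR_gt0.
exists (M `^ r1) => [|a a0]; first exact: powR_ge0.
have [aM|Ma] := leP a M.
  rewrite (@le_trans _ _ (M `^ r1))//; last by rewrite lerDl mulr_ge0 ?powR_ge0 ?ltW.
  by apply: ge0_ler_powR => //; rewrite nnegrE ltW.
have ap : 0 < a by rewrite (lt_trans M0).
rewrite (@le_trans _ _ (e * a `^ r2))//; last by rewrite lerDr powR_ge0.
have -> : a `^ r2 = a `^ r1 * a `^ (r2 - r1).
  by rewrite -powRD ?(gt_eqF ap) ?implybT//; congr (_ `^ _); ring.
rewrite mulrCA ler_peMr ?powR_ge0//.
have -> : 1 = e * M `^ (r2 - r1).
  by rewrite -powRrM mulNr mulVf ?gt_eqF// -{1}[e]powRr1 ?ltW// -powRD ?subrr ?powRr0 ?(gt_eqF e0) ?implybT.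
rewrite ler_pM2l//; apply: ge0_ler_powR; rewrite ?nnegrE; try exact: ltW.
Qed.

(* Young's inequality for [k a^q] with the exponents of the space to which [k] belongs. *)
Lemma powR_weight_absorb (q p e : R) : 0 < q -> q < p -> 0 < e ->
  exists2 C : R, 0 <= C & forall k a, 0 <= k -> 0 <= a ->
    k * a `^ q <= C * k `^ (p / (p - q)) + e * a `^ p.
Proof.
move=> q0 qp e0; have d0 : 0 < p - q by rewrite subr_gt0.
have p0 : 0 < p by rewrite (lt_trans q0).
exists (e `^ (- (q / (p - q)))) => [|k a k0 a0]; first exact: powR_ge0.
have [->|kn0] := eqVneq k 0.
  by rewrite mul0r addr_ge0// mulr_ge0 ?powR_ge0// ltW.
have kp : 0 < k by rewrite lt0r kn0.
(* Either e a^p already dominates, or [a] is at most a power of k / e and only k remains. *)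
have [ka|ka] := leP k (e * a `^ (p - q)).
  rewrite (@le_trans _ _ (e * a `^ p))//; last by rewrite lerDr mulr_ge0 ?powR_ge0.
  have [->|an0] := eqVneq a 0.
    by rewrite !powR0 ?gt_eqF// !mulr0.
  have -> : a `^ p = a `^ (p - q) * a `^ q.
    by rewrite -powRD ?an0 ?implybT//; congr (_ `^ _); ring.
  by rewrite mulrA ler_wpM2r ?powR_ge0.
rewrite (@le_trans _ _ (e `^ (- (q / (p - q))) * k `^ (p / (p - q))))//; last first.
  by rewrite lerDl mulr_ge0 ?powR_ge0 ?ltW.
have ake : a <= (k / e) `^ ((p - q)^-1).
  have -> : a = (a `^ (p - q)) `^ (p - q)^-1 by rewrite -powRrM divff ?gt_eqF// powRr1.
  apply: ge0_ler_powR; rewrite ?nnegrE ?powR_ge0 ?divr_ge0 ?invr_ge0 ?(ltW d0) ?(ltW e0)//.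
  by rewrite ler_pdivlMr// mulrC ltW.
apply: (@le_trans _ _ (k * ((k / e) `^ ((p - q)^-1)) `^ q)).
  by rewrite ler_wpM2l//; apply: ge0_ler_powR; rewrite ?nnegrE ?powR_ge0 ?(ltW q0).
rewrite -powRrM powRM ?invr_ge0 ?(ltW e0)//.
have -> : e^-1 `^ ((p - q)^-1 * q) = e `^ (- (q / (p - q))).
  by rewrite -(powR_inv1 (ltW e0)) -powRrM; congr (_ `^ _); rewrite mulN1r mulrC.
rewrite mulrA mulrC ler_wpM2l ?powR_ge0//.
rewrite -{1}(powRr1 k0) -powRD ?kn0 ?implybT//.
rewrite le_eqVlt; apply/orP; left; apply/eqP; congr (_ `^ _).
by field; rewrite gt_eqF.
Qed.

Lemma powR_D_le a b r : 0 <= a -> 0 <= b -> 0 < r ->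
  (a + b) `^ r <= 2 `^ r * (a `^ r + b `^ r).
Proof.
move=> a0 b0 r0.
have le x y : 0 <= x -> x <= y -> (x + y) `^ r <= 2 `^ r * (x `^ r + y `^ r).
  move=> x0 xy; have y0 := le_trans x0 xy.
  apply: (@le_trans _ _ ((2 * y) `^ r)).
    apply: ge0_ler_powR; rewrite ?nnegrE ?addr_ge0 ?mulr_ge0 ?(ltW r0)//.
    by rewrite mulr_natl mulr2n lerD2r.
  by rewrite powRM// ler_wpM2l ?powR_ge0// lerDr powR_ge0.
have [ab|/ltW ba] := leP a b; first exact: le.
by rewrite addrC [a `^ r + _]addrC; exact: le.
Qed.

End powR_inequalities.

(** * Convergence of integrals *)

Section convergence.
Context d (T : measurableType d) (R : realType) (mu : {measure set T -> \bar R}).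
Implicit Types (f g F : T -> R).
Local Notation intg f := (mu.-integrable setT (EFin \o f)).

Lemma Rint_dominated (f_ : (T -> R)^nat) f g :
  (forall n, measurable_fun setT (f_ n)) -> measurable_fun setT f ->
  {ae mu, forall x, f_ ^~ x @ \oo --> f x} -> intg g ->
  {ae mu, forall x, forall n, `|f_ n x| <= g x} ->
  [/\ intg f, (\int[mu]_x `|f_ n x - f x|) @[n --> \oo] --> 0 &
      (\int[mu]_x f_ n x) @[n --> \oo] --> \int[mu]_x f x].
Proof.
move=> mf_ mf ff gi fg.
have [|||||fi H1 H2] := @dominated_convergence _ T R mu setT measurableT
  (fun n x => (f_ n x)%:E) (fun x => (f x)%:E) (fun x => (g x)%:E).
- by move=> n; exact/measurable_EFinP.
- exact/measurable_EFinP.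
- by apply: filterS ff => x fx _; apply/cvg_EFin; [exact: nearW|exact: fx].
- exact: gi.
- by apply: filterS fg => x fx n _; rewrite lee_fin.
split=> //.
  by apply: (@fine_cvg _ _ _ _ (fun n => \int[mu]_x `|(f_ n x)%:E - (f x)%:E|)%E).
apply: (@fine_cvg _ _ _ _ (fun n => \int[mu]_x (f_ n x)%:E)%E).
by rewrite fineK//; exact: integrable_fin_num fi.
Qed.

(* Vitali-type convergence: uniform integrability enters as domination up to
   arbitrarily small multiples of functions bounded in L^1. *)
Lemma Rint_cvg_young (f_ P_ : (T -> R)^nat) f (B : R) :
  (forall n, intg (f_ n)) -> measurable_fun setT f ->
  {ae mu, forall x, f_ ^~ x @ \oo --> f x} ->
  (forall n, intg (P_ n)) -> (forall n x, 0 <= P_ n x) ->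
  (forall n, \int[mu]_x P_ n x <= B) ->
  (forall e : R, 0 < e -> exists2 D, intg D &
    {ae mu, forall x, forall n, `|f_ n x - f x| <= D x + e * P_ n x}) ->
  [/\ intg f, (\int[mu]_x `|f_ n x - f x|) @[n --> \oo] --> 0 &
      (\int[mu]_x f_ n x) @[n --> \oo] --> \int[mu]_x f x].
Proof.
move=> fi mf ff Pi P0 PB HD.
have mf_ n := intg_measurable (fi n).
have mP n := intg_measurable (Pi n).
have fint : intg f.
  have [D Di fD] := HD 1 ltr01.
  have i0 : intg (fun x => `|D x| + P_ 0 x + `|f_ 0 x|).
    by apply: intgD; [apply: intgD => //|]; exact: integrable_norm.
  apply/integrableP; split; first exact/measurable_EFinP.
  apply: (@le_lt_trans _ _ (\int[mu]_x (`|D x| + P_ 0 x + `|f_ 0 x|)%:E)%E).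
    apply: ae_ge0_le_integral => //.
    - by apply/measurable_EFinP; apply: measurableT_comp.
    - by move=> x _; rewrite lee_fin !addr_ge0.
    - exact: measurable_int i0.
    - apply: filterS fD => x /(_ 0) fx _; rewrite /= lee_fin.
      rewrite mul1r in fx; rewrite -(subrK (f_ 0 x) (f x)).
      rewrite (le_trans (ler_normD _ _))// lerD2r distrC (le_trans fx)//.
      by rewrite lerD2r ler_norm.
  by have /integrableP[_] := i0; apply: le_lt_trans; apply: ge0_le_integral => //;
    [by move=> x _; rewrite lee_fin !addr_ge0|exact: measurable_int i0|
     by apply: measurableT_comp => //; exact: measurable_int i0|
     by move=> x _; rewrite /= lee_fin ler_norm].
have absi n : intg (fun x => `|f_ n x - f x|) by apply: integrable_norm; exact: intgB.
have B0 : 0 <= B by rewrite (le_trans _ (PB 0))// Rint_ge0.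
have abs0 : (\int[mu]_x `|f_ n x - f x|) @[n --> \oo] --> 0.
  apply/cvgrPdist_lt => e e0.
  pose e' := e / (2 * (B + 1)).
  have e'0 : 0 < e' by rewrite divr_gt0// mulr_gt0// ltr_wpDl.
  have [D Di fD] := HD e' e'0.
  (* The part of the error exceeding e' P_n is dominated by |D| and tends to 0 almost everywhere;
     the part below has integral at most e' B <= e/2. *)
  pose H n x := Num.max (`|f_ n x - f x| - e' * P_ n x) 0.
  have H0 n x : 0 <= H n x by rewrite le_max lexx orbT.
  have HF n x : H n x <= `|f_ n x - f x|.
    by rewrite ge_max normr_ge0 andbT gerBl mulr_ge0// ltW.
  have mH n : measurable_fun setT (H n).
    apply: measurable_maxr => //; apply: measurable_funB.
      by apply: measurableT_comp => //; exact: measurable_funB.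
    exact: measurable_funM.
  have Hi n : intg (H n).
    by apply: (intg_le (mH n) (absi n)) => x; rewrite ger0_norm.
  have [_ _ Hcv] : [/\ intg (cst 0 : T -> R),
      (\int[mu]_x `|H n x - cst 0 x|) @[n --> \oo] --> (0 : R) &
      (\int[mu]_x H n x) @[n --> \oo] --> \int[mu]_x (cst 0 x : R)].
    apply: (@Rint_dominated _ _ (fun x => `|D x|)) => //.
    - apply: filterS ff => x fx; apply: (@squeeze_cvgr _ _ _ _ (fun=> 0) (fun n => `|f_ n x - f x|)).
      + by apply: nearW => n; rewrite H0 HF.
      + exact: cvg_cst.
      + by rewrite -[X in _ --> X](@normr0 _ R) -(subrr (f x)); apply: cvg_norm; apply: cvgB => //; exact: cvg_cst.
    - exact: integrable_norm.
    - apply: filterS fD => x fx n; rewrite ger0_norm// ge_max normr_ge0 andbT.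
      by rewrite lerBlDr (le_trans (fx n))// lerD2r ler_norm.
  rewrite /cst Rintegral_cst// mul0r in Hcv.
  have /cvgrPdist_lt/(_ (e / 2)) := Hcv.
  rewrite divr_gt0// => /(_ isT); apply: filterS => n.
  rewrite !sub0r !normrN !ger0_norm ?Rint_ge0// => Hn.
  apply: (@le_lt_trans _ _ (\int[mu]_x (H n x + e' * P_ n x))).
    apply: Rint_le => //; first by apply: intgD => //; exact: intgZ.
    by move=> x; rewrite -lerBlDr le_max lexx.
  rewrite RintD//; last exact: intgZ.
  rewrite RintZ// [ltRHS](splitr e) ltr_leD//.
  rewrite (@le_trans _ _ (e' * B))//; first by rewrite ler_wpM2l// ltW.
  rewrite /e' mulrAC ler_pdivrMr ?mulr_gt0 ?ltr_wpDl//.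
  by rewrite mulrA divfK// ler_wpM2l ?(ltW e0)// lerDl.
split=> //.
apply/cvgrPdist_lt => e e0.
have /cvgrPdist_lt/(_ e e0) := abs0; apply: filterS => n.
rewrite sub0r normrN ger0_norm ?Rint_ge0//; apply: le_lt_trans.
rewrite distrC -RintB//; apply: le_normr_Rintegral => //; exact: intgB.
Qed.

(** The conclusion is stated in the extended reals, so that integrability of the limit is part of
    what is obtained. *)
Lemma Rint_fatou (F_ : (T -> R)^nat) F (c : R^nat) (C : R) :
  (forall n, intg (F_ n)) -> (forall n x, 0 <= F_ n x) -> measurable_fun setT F ->
  {ae mu, forall x, F_ ^~ x @ \oo --> F x} ->
  (forall n, \int[mu]_x F_ n x <= c n) -> c @ \oo --> C ->
  {ae mu, forall x, 0 <= F x} -> (\int[mu]_x (F x)%:E <= C%:E)%E.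
Proof.
move=> Fi F0 mF FF Fc cC F0ae.
have mF_ n := measurable_int _ (Fi n).
have -> : (\int[mu]_x (F x)%:E = \int[mu]_x limn_einf (fun n => (F_ n x)%:E))%E.
  apply: ae_eq_integral => //.
  - exact/measurable_EFinP.
  - under eq_fun do rewrite -[limn_einf _]oppeK -limn_esupN.
    apply: measurableT_comp => //; apply: measurable_fun_limn_esup => n.
    by apply: measurableT_comp => //; exact: mF_.
  - apply: filterS FF => x Fx _; apply/esym.
    apply: (cvg_limn_einf_sup (l := (F x)%:E) _).1.
    by apply/cvg_EFin; [exact: nearW|exact: Fx].
apply: (@le_trans _ _ (limn_einf (fun n => \int[mu]_x (F_ n x)%:E))%E).
  by apply: fatou => // n x _; rewrite lee_fin.
have cE : (EFin \o c) @ \oo --> C%:E by apply/cvg_EFin; [exact: nearW|exact: cC].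
rewrite limn_einf_lim -(cvg_lim _ cE)//.
apply: lee_lim; [exact: is_cvg_einfs|exact: (cvgP _ cE)|].
apply: nearW => n /=.
apply: (@le_trans _ _ (\int[mu]_x (F_ n x)%:E)%E).
  by apply: ereal_inf_lbound; exists n => //=.
by rewrite -Rintegral_EFin// lee_fin.
Qed.

End convergence.

(** * Completeness of L^p, with a majorant *)

Section riesz_fischer.
Context {R : realType}.

(** 2 c 2^-n is the sum of all increments allowed from rank n on. Subtracting it gives a
    nondecreasing sequence and adding it a nonincreasing one; they enclose the limit and give the
    error. *)
Lemma cvg_geometric_increments (a : R^nat) (c : R) :
  (forall n, `|a n.+1 - a n| <= c * 2^-1 ^+ n) ->
  exists2 l, a @ \oo --> l & forall n, `|a n - l| <= 2 * c * 2^-1 ^+ n.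
Proof.
move=> ac.
have cn n : 2 * c * 2^-1 ^+ n.+1 = c * 2^-1 ^+ n by rewrite exprS; field.
have geo0 : (fun n => 2 * c * 2^-1 ^+ n) @ \oo --> (0 : R).
  rewrite -[X in _ --> X](mulr0 (2 * c)); apply: cvgM; first exact: cvg_cst.
  by apply: cvg_expr; rewrite ger0_norm//; lra.
pose lo n := a n - 2 * c * 2^-1 ^+ n; pose up n := a n + 2 * c * 2^-1 ^+ n.
have lo_nd : nondecreasing_seq lo.
  apply/nondecreasing_seqP => n; rewrite /lo cn.
  have := ac n; rewrite ler_norml => /andP[h _].
  by move: h; set x := _ ^+ n => h; lra.
have up_ni : nonincreasing_seq up.
  apply/nonincreasing_seqP => n; rewrite /up cn.
  have := ac n; rewrite ler_norml => /andP[_ h].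
  by move: h; set x := _ ^+ n => h; lra.
have c0 : 0 <= c by have := ac 0; rewrite expr0 mulr1; exact: le_trans.
have xm0 k : 0 <= 2 * c * 2^-1 ^+ k by rewrite !mulr_ge0 ?exprn_ge0.
have lo_le_up n : lo n <= up n by rewrite /lo /up lerD2l (le_trans _ (xm0 n))// oppr_le0.
have lo_up n m : lo n <= up m.
  have [nm|/ltnW mn] := leqP n m.
    exact: le_trans (lo_nd _ _ nm) (lo_le_up m).
  exact: le_trans (lo_le_up n) (up_ni _ _ mn).
have lo_cvg : cvgn lo.
  apply: nondecreasing_is_cvgn => //; exists (up 0) => _ [n _ <-]; exact: lo_up.
pose l := limn lo; have lol : lo @ \oo --> l by exact: lo_cvg.
have al : a @ \oo --> l.
  have -> : a = lo \+ (fun n => 2 * c * 2^-1 ^+ n) by apply/funext => n /=; rewrite /lo subrK.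
  by rewrite -[X in _ --> X]addr0; exact: cvgD.
exists l => // n; rewrite ler_norml.
have l1 : lo n <= l by exact: nondecreasing_cvgn_le.
have l2 : l <= up n by apply: limr_le => //; apply: nearW => m; exact: lo_up.
move: l1 l2; rewrite /lo /up; set x := _ * _ ^+ n => l1 l2.
by apply/andP; split; lra.
Qed.

Context d (T : measurableType d) (mu : {measure set T -> \bar R}).
Local Notation intg f := (mu.-integrable setT (EFin \o f)).

(* The dominating function is 2^p times the sum of 2^(np) |f_(n+1) - f_n|^p. *)
Lemma riesz_fischer_fast (f_ : (T -> R)^nat) (p : R) : 0 < p ->
  (forall n, measurable_fun setT (f_ n)) ->
  (forall n, \int[mu]_x (`|f_ n.+1 x - f_ n x| `^ p)%:E <=
    ((2^-1 ^+ n) * (2^-1 ^+ n) `^ p)%:E)%E ->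
  exists f : T -> R, exists2 S : T -> R, intg S &
    [/\ measurable_fun setT f, forall x, 0 <= S x,
      {ae mu, forall x, f_ ^~ x @ \oo --> f x} &
      {ae mu, forall x, forall n, `|f_ n x - f x| `^ p <= S x}].
Proof.
move=> p0 mf fp.
have h0 n : 0 < 2^-1 ^+ n :> R by rewrite exprn_gt0.
(* The weight 2^(np) cancels the last factor of the assumed bound, leaving integrals at most
   2^-n. *)
pose g n x := (2^-1 ^+ n) `^ (- p) * `|f_ n.+1 x - f_ n x| `^ p.
have g0 n x : 0 <= g n x by rewrite mulr_ge0 ?powR_ge0.
have mg n : measurable_fun setT (g n).
  apply: measurable_funM => //; apply: (measurableT_comp (measurable_powR _)).
  by apply: measurableT_comp => //; exact: measurable_funB.
pose S0 x := (\sum_(n <oo) (g n x)%:E)%E.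
have S00 x : (0 <= S0 x)%E by apply: nneseries_ge0 => n _ _; rewrite lee_fin.
have mS0 : measurable_fun setT S0.
  by apply: ge0_emeasurable_sum => [n x _ _|n _]; [rewrite lee_fin|exact/measurable_EFinP].
have iS0 : (\int[mu]_x S0 x < +oo)%E.
  rewrite integral_nneseries//; last 2 first.
  - by move=> n; exact/measurable_EFinP.
  - by move=> n x _; rewrite lee_fin.
  apply: (@le_lt_trans _ _ (\sum_(n <oo) (2^-1 ^+ n)%:E)%E).
    apply: lee_nneseries => [n _ _|n _]; first by apply: integral_ge0 => x _; rewrite lee_fin.
    under eq_integral do rewrite EFinM.
    rewrite ge0_integralZl_EFin ?powR_ge0//; last first.
      apply/measurable_EFinP; apply: (measurableT_comp (measurable_powR _)).
      by apply: measurableT_comp => //; exact: measurable_funB.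
    apply: (le_trans (lee_wpmul2l _ (fp n))); first by rewrite lee_fin powR_ge0.
    rewrite -EFinM lee_fin mulrCA -powRD ?(gt_eqF (h0 n)) ?implybT//.
    by rewrite addNr powRr0 mulr1.
  apply: (@le_lt_trans _ _ 2%:E); last exact: ltry.
  apply: le_trans (@epsilon_trick0 R 2 xpredT _) => //.
  apply: lee_nneseries => [n _ _|n _]; first by rewrite lee_fin ltW.
  by rewrite lee_fin natrX exprS invfM mulrA divff// mul1r exprVn.
have S0fin : {ae mu, forall x, S0 x \is a fin_num}.
  have iS : mu.-integrable setT S0.
    apply/integrableP; split => //; rewrite (eq_integral S0)// => x _.
    by rewrite gee0_abs.
  by apply: filterS (integrable_ae measurableT iS) => x; exact.
pose S x := 2 `^ p * fine (S0 x).
have iS : intg S.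
  apply: intgZ; apply: intg_ge0.
  - by apply: measurableT_comp.
  - by move=> x; apply: fine_ge0.
  - apply: le_lt_trans iS0; apply: ge0_le_integral => //.
    + by move=> x _; rewrite lee_fin fine_ge0.
    + by apply/measurable_EFinP; apply: measurableT_comp.
    + by move=> x _; have := S00 x; case: (S0 x) => [r||]//=; rewrite ?leey.
have key x : S0 x \is a fin_num -> exists2 l, f_ ^~ x @ \oo --> l &
    forall n, `|f_ n x - l| `^ p <= S x.
  (* Each term of the series is at most its sum, so the increments at [x] are at most c 2^-n. *)
  move=> Sx; pose c := (fine (S0 x)) `^ p^-1.
  have gS n : g n x <= fine (S0 x).
    rewrite -lee_fin fineK//.
    apply: le_trans (@nneseries_lim_ge _ (fun k => (g k x)%:E) xpredT 0 n.+1 _).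
      by rewrite big_nat_recr//= leeDr// sume_ge0// => k _; rewrite lee_fin.
    by move=> k _ _; rewrite lee_fin.
  have [] := @cvg_geometric_increments (f_ ^~ x) c.
    move=> n; rewrite /c.
    have -> : `|f_ n.+1 x - f_ n x| = (`|f_ n.+1 x - f_ n x| `^ p) `^ p^-1.
      by rewrite -powRrM divff ?gt_eqF// powRr1.
    have -> : 2^-1 ^+ n = ((2^-1 ^+ n) `^ p) `^ p^-1 :> R.
      by rewrite -powRrM divff ?gt_eqF// powRr1// ltW.
    rewrite -powRM ?powR_ge0 ?fine_ge0//.
    apply: ge0_ler_powR; rewrite ?nnegrE ?powR_ge0 ?invr_ge0 ?mulr_ge0 ?fine_ge0 ?(ltW p0)//.
    have := gS n; rewrite /g powRN mulrC ler_pdivrMr ?powR_gt0//.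
  move=> l fl fle; exists l => // n.
  have n1 : 2^-1 ^+ n <= 1 :> R by rewrite exprn_ile1//; lra.
  have cge0 : 0 <= c by exact: powR_ge0.
  have : `|f_ n x - l| <= 2 * c.
    by rewrite (le_trans (fle n))// ler_piMr// mulr_ge0.
  move=> /(ge0_ler_powR (ltW p0)); rewrite !nnegrE normr_ge0 mulr_ge0// => /(_ isT isT).
  by rewrite powRM// -powRrM mulVf ?gt_eqF// powRr1// fine_ge0.
pose G := [set x | S0 x \is a fin_num].
have mG : measurable G.
  by rewrite -[G]setTI; exact: emeasurable_fin_num.
(* The default value 0 on the null set where the series diverges makes [f] an everywhere limit of
   measurable functions. *)
pose f x := if x \in G then limn (f_ ^~ x) else 0.
have fG n x : (fun n => f_ n x * \1_G x) @ \oo --> f x.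
  rewrite /f indicE; case: ifPn => [|/negPf].
    rewrite inE => /key[l fl _]; rewrite (cvg_lim _ fl)//.
    by under eq_fun do rewrite mulr1.
  by move=> _; under eq_fun do rewrite mulr0; exact: cvg_cst.
exists f, S => //; split.
- apply: (@measurable_fun_cvg _ _ _ _ (fun n x => f_ n x * \1_G x)) => [n|x _].
    by apply: measurable_funM => //; exact: measurable_indic.
  exact: fG.
- by move=> x; rewrite mulr_ge0 ?powR_ge0 ?fine_ge0.
- apply: filterS S0fin => x xG; have [l fl _] := key x xG.
  by rewrite /f mem_set// (cvg_lim _ fl).
- apply: filterS S0fin => x xG n; have [l fl fle] := key x xG.
  by rewrite /f mem_set// (cvg_lim _ fl).
Qed.

End riesz_fischer.

(** * The fundamental lemma of the calculus of variations *)

Section cvg_prod_ord.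
Context {R : realType}.

Lemma cvg_prod_ord m (f : 'I_m -> R^nat) (l : 'I_m -> R) :
  (forall i, f i @ \oo --> l i) ->
  (fun n => \prod_(i < m) f i n) @ \oo --> \prod_(i < m) l i.
Proof.
elim: m f l => [|m IH] f l fl.
  by rewrite big_ord0; under eq_fun do rewrite big_ord0; exact: cvg_cst.
rewrite big_ord_recl; under eq_fun do rewrite big_ord_recl.
by apply: cvgM => //; apply: IH.
Qed.

End cvg_prod_ord.

Section bumps.
Context {R : realType} {N : nat}.
Local Notation E := ('rV[R]_N).
Local Notation mu := (@lebesgue_rV R N).
Local Notation intg f := (mu.-integrable setT (EFin \o f)).

Definition open_box (a b : 'I_N -> R) : set E :=
  [set x | forall i, `]a i, b i[%classic (x ord0 i)].

Lemma measurable_open_box a b : measurable (open_box a b).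
Proof. by apply: (@measurable_box _ _ (fun i => `]a i, b i[%classic)). Qed.

(* Smooth, supported in the closed box, and increasing to the indicator of the
   open box. *)
Definition bump (a b : 'I_N -> R) (n : nat) (x : E) : R :=
  \prod_(i < N) (flat_exp 0 (n.+1%:R * x ord0 i + - (n.+1%:R * a i)) *
                 flat_exp 0 (- n.+1%:R * x ord0 i + n.+1%:R * b i)).

Lemma flat_exp0_le1 (x : R) : flat_exp 0 x <= 1.
Proof.
rewrite /flat_exp expr0 invr1 mul1r; case: ifPn => // x0.
by rewrite -expR0 ler_expR oppr_le0 invr_ge0 ltW.
Qed.

Lemma flat_exp_gt0 k (x : R) : 0 < x -> 0 < flat_exp k x.
Proof. by move=> x0; rewrite /flat_exp x0 mulr_gt0 ?expR_gt0// invr_gt0 exprn_gt0. Qed.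

Lemma flat_exp_eq0 k (x : R) : x <= 0 -> flat_exp k x = 0.
Proof. by move=> x0; rewrite /flat_exp ltNge x0. Qed.

Lemma bump_ge0 a b n x : 0 <= bump a b n x.
Proof. by apply: prodr_ge0 => i _; rewrite mulr_ge0 ?flat_exp_ge0. Qed.

Lemma bump_le1 a b n x : bump a b n x <= 1.
Proof.
apply: prodr_ile1 => i _; rewrite mulr_ge0 ?flat_exp_ge0//=.
by rewrite mulr_ile1 ?flat_exp_ge0 ?flat_exp0_le1.
Qed.

Lemma bump_gt0 a b n x : open_box a b x -> 0 < bump a b n x.
Proof.
move=> xab; apply: prodr_gt0 => i _; have := xab i; rewrite /= in_itv/= => /andP[ax xb].
by rewrite mulr_gt0// flat_exp_gt0// ?mulNr ?[- _ + _]addrC subr_gt0 ltr_pM2l.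
Qed.

Lemma bump_out a b n x : ~ open_box a b x -> bump a b n x = 0.
Proof.
move=> /existsNP[i]; rewrite /= in_itv/= => /negP; rewrite negb_and -!leNgt => xi.
rewrite /bump (bigD1 i)//=; case/orP: xi => xi.
  by rewrite flat_exp_eq0 ?mul0r ?mul0r// subr_le0 ler_pM2l.
rewrite [X in _ * X * _]flat_exp_eq0 ?mulr0 ?mul0r//.
by rewrite mulNr addrC subr_le0 ler_pM2l.
Qed.

Lemma C0infty_bump a b n : C0infty (bump a b n).
Proof.
apply/C0inftyP; split.
  by apply: smooth_prod => i; apply: smoothM; apply: smooth_flat_exp; exact: smooth_affine.
exists (\sum_(i < N) (`|a i| + `|b i|)) => x xM; apply: bump_out => xab; apply: xM => i.
have := xab i; rewrite /= !in_itv/= => /andP[ax xb].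
have Mi : `|a i| + `|b i| <= \sum_(i < N) (`|a i| + `|b i|).
  by rewrite (bigD1 i)//= lerDl sumr_ge0// => j _; rewrite addr_ge0.
have := ler_norm (- a i); have := ler_norm (b i); rewrite normrN => h1 h2.
have h3 := normr_ge0 (a i); have h4 := normr_ge0 (b i).
by apply/andP; split; lra.
Qed.

Lemma cvg_bump a b x : bump a b ^~ x @ \oo --> (\1_(open_box a b) x : R).
Proof.
rewrite indicE; have [xab|xab] := pselect (open_box a b x); last first.
  rewrite memNset//; apply: cvg_near_cst; apply: nearW => n; exact: bump_out.
rewrite mem_set//.
have -> : true%:R = \prod_(i < N) (1 * 1) :> R by rewrite big1 // => i _; rewrite mulr1.
rewrite /bump.
have fe (d : R) : 0 < d -> (fun n => flat_exp 0 (n.+1%:R * d)) @ \oo --> (1 : R).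
  move=> d0; rewrite /flat_exp.
  have -> : (fun n => if 0 < n.+1%:R * d then (n.+1%:R * d) ^- 0 * expR (- (n.+1%:R * d)^-1) else 0)
      = (fun n => expR (- (d^-1 * n.+1%:R^-1))).
    by apply/funext => n; rewrite mulr_gt0// expr0 invr1 mul1r invfM mulrC.
  rewrite -[X in _ --> X]expR0; apply: continuous_cvg; first exact: continuous_expR.
  rewrite -oppr0; apply: cvgN; rewrite -[X in _ --> X](mulr0 d^-1).
  by apply: cvgM; [exact: cvg_cst|exact: cvg_harmonic].
apply: cvg_prod_ord => i; have := xab i; rewrite /= in_itv/= => /andP[ax xb].
apply: cvgM.
  rewrite [X in X @ _ --> _](_ : _ = fun n => flat_exp 0 (n.+1%:R * (x ord0 i - a i))).
    by apply: fe; rewrite subr_gt0.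
  by apply/funext => n; rewrite mulrBr.
rewrite [X in X @ _ --> _](_ : _ = fun n => flat_exp 0 (n.+1%:R * (b i - x ord0 i))).
  by apply: fe; rewrite subr_gt0.
by apply/funext => n; rewrite mulrBr mulNr addrC.
Qed.

End bumps.

Section du_bois_reymond.
Context {R : realType} {N : nat}.
Local Notation E := ('rV[R]_N).
Local Notation mu := (@lebesgue_rV R N).
Local Notation intg f := (mu.-integrable setT (EFin \o f)).

Let boxes : set (set E) := [set B | exists a b, B = open_box a b].

Let setI_boxes : setI_closed boxes.
Proof.
move=> _ _ [a [b ->]] [a' [b' ->]].
exists (fun i => Num.max (a i) (a' i)), (fun i => Num.min (b i) (b' i)).
apply/seteqP; split=> x /=.
  move=> [xa xa'] i; have := xa i; have := xa' i; rewrite /= !in_itv/=.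
  by move=> /andP[h1 h2] /andP[h3 h4]; rewrite gt_max lt_min h1 h2 h3 h4.
by move=> xi; split=> i; have := xi i; rewrite /= !in_itv/= gt_max lt_min;
  move=> /andP[/andP[h1 h2] /andP[h3 h4]]; rewrite ?h1 ?h2 ?h3 ?h4.
Qed.

Let cover_boxes (x : E) : exists n : nat, forall i, - n%:R < x ord0 i < n%:R.
Proof.
exists (Num.truncn (\sum_(i < N) `|x ord0 i|)).+1 => i.
rewrite -ltr_norml (le_lt_trans _ (truncnS_gt _))//.
by rewrite (bigD1 i)//= lerDl sumr_ge0.
Qed.

(** Open boxes are stable under intersection, so this presentation opens the way to Dynkin
    induction. *)
Lemma measurable_rV_boxes : @measurable _ E = <<s boxes >>.
Proof.
apply/seteqP; split; last first.
  apply: smallest_sub; first exact: sigma_algebra_measurable.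
  by move=> _ [a [b ->]]; exact: measurable_open_box.
apply: smallest_sub; first exact: smallest_sigma_algebra.
move=> A; rewrite -bigcup_seq => -[i /= _].
move=> [B mB <-].
have : preimage_set_system setT (fun x : E => x ord0 i) (@RGenOpens.G R).-sigma.-measurable
    (setT `&` (fun x : E => x ord0 i) @^-1` B).
  by exists B => //; rewrite -RGenOpens.measurableE.
rewrite -g_sigma_preimageE; apply: smallest_sub; first exact: smallest_sigma_algebra.
move=> _ [_ [c [d ->]] <-]; rewrite setTI.
have -> : (fun x : E => x ord0 i) @^-1` `]c, d[%classic = \bigcup_(n : nat)
    open_box (fun j => if j == i then c else - n%:R) (fun j => if j == i then d else n%:R).
  apply/seteqP; split=> [x /= xcd|x [n _] /(_ i)]; last by rewrite eqxx.
  have [n xn] := cover_boxes x; exists n => // j /=.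
  by case: eqP => [->//|_]; rewrite in_itv/=.
apply: sigma_algebra_bigcup => n; apply: sub_gen_smallest.
by eexists; eexists.
Qed.

Lemma open_box_cube (a b : 'I_N -> R) : exists2 M : R, 0 < M & open_box a b `<=` cube M.
Proof.
exists (1 + \sum_(i < N) (`|a i| + `|b i|)) => [|x xab i].
  by rewrite ltr_wpDr// sumr_ge0// => j _; rewrite addr_ge0.
have := xab i; rewrite /= !in_itv/= => /andP[ax xb].
have Mi : `|a i| + `|b i| <= \sum_(i < N) (`|a i| + `|b i|).
  by rewrite (bigD1 i)//= lerDl sumr_ge0// => j _; rewrite addr_ge0.
have := ler_norm (- a i); have := ler_norm (b i); rewrite normrN => h1 h2.
have h3 := normr_ge0 (a i); have h4 := normr_ge0 (b i).
by apply/andP; split; lra.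
Qed.

Lemma intg_indic (f : E -> R) A : measurable A -> intg f -> intg (fun x => f x * \1_A x).
Proof.
move=> mA fi; apply: (intg_le (g := fun x => `|f x|)).
- apply: measurable_funM; first exact: intg_measurable fi.
  exact: measurable_indic.
- exact: integrable_norm.
- move=> x; rewrite normrM ler_piMr// indicE; case: (x \in A); rewrite ?normr1 ?normr0//.
Qed.

Lemma L1loc_intg_cube (f : E -> R) M : L1loc f -> intg (fun x => f x * \1_(cube M) x).
Proof.
move=> [mf fK]; apply/integrableP; split.
  apply/measurable_EFinP; apply: measurable_funM => //; apply: measurable_indic.
  exact: measurable_cube.
have := fK _ (@compact_cubeT R N M); rewrite integral_mkcond; apply: le_lt_trans.
rewrite le_eqVlt; apply/orP; left; apply/eqP; apply: eq_integral => x _.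
rewrite /= patchE indicE; case: (x \in cube M); rewrite ?mulr1 ?mulr0 ?normr0//.
Qed.

Lemma L1loc_intg_test (f phi : E -> R) : L1loc f -> C0infty phi ->
  intg (fun x => f x * phi x).
Proof.
move=> fl phis; have [C C0 phiC] := C0infty_bounded phis.
have [M phiM] := ((C0inftyP _).1 phis).2.
apply: (intg_le (g := fun x => C * `|f x * \1_(cube M) x|)).
- by apply: measurable_funM; [case: fl|exact: C0infty_measurable].
- by apply: intgZ; apply: integrable_norm; exact: L1loc_intg_cube.
- move=> x; rewrite normrM indicE; have [xM|xM] := pselect (cube M x).
    by rewrite mem_set// mulr1 mulrC ler_wpM2r.
  by rewrite phiM// memNset// !(mulr0, normr0).
Qed.

(** Bumps increase to indicators of boxes, so the integral of [f] over every box is 0; Dynkin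
    induction extends this to measurable subsets of a box, in particular to the subset where [f] is
    positive. *)
Lemma du_bois_reymond (f : E -> R) : L1loc f ->
  (forall phi, C0infty phi -> \int[mu]_x (f x * phi x) = 0) ->
  {ae mu, forall x, f x = 0}.
Proof.
move=> fl f0.
have mf : measurable_fun setT f by case: fl.
have box0 a b : \int[mu]_x (f x * \1_(open_box a b) x) = 0.
  have [M M0 abM] := open_box_cube a b.
  have [|||||_ _] := @Rint_dominated _ _ _ mu (fun n x => f x * bump a b n x)
      (fun x => f x * \1_(open_box a b) x) (fun x => `|f x * \1_(cube M) x|).
  - by move=> n; apply: measurable_funM => //; apply: C0infty_measurable; exact: C0infty_bump.
  - by apply: measurable_funM => //; apply: measurable_indic; exact: measurable_open_box.
  - by apply: aeW => x; apply: cvgM; [exact: cvg_cst|exact: cvg_bump].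
  - by apply: integrable_norm; exact: L1loc_intg_cube.
  - apply: aeW => x n; rewrite !normrM ler_wpM2l// ger0_norm ?bump_ge0// indicE.
    have [xM|xM] := pselect (cube M x); first by rewrite mem_set// normr1 bump_le1.
    by rewrite memNset// normr0 bump_out// => /abM.
  under eq_fun do rewrite (f0 _ (C0infty_bump _ _ _)).
  by move=> H; apply/esym; apply: (cvg_unique _ _ H) => //; exact: cvg_cst.
(* The box [Q] is kept fixed during the induction so that [f] is integrable on it; complements and
   countable unions require this. *)
have set0 (m : nat) A : measurable A ->
    \int[mu]_x (f x * \1_(open_box (fun=> - m%:R) (fun=> m%:R)) x * \1_A x) = 0.
  move=> mA; set Q := open_box _ _.
  have mQ : measurable Q by exact: measurable_open_box.
  have [M M0 QM] := open_box_cube (fun=> - m%:R) (fun=> m%:R).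
  have fQ : intg (fun x => f x * \1_Q x).
    apply: eq_intg (intg_indic mQ (L1loc_intg_cube M fl)) => x.
    rewrite !indicE -mulrA; have [xQ|xQ] := pselect (Q x); last by rewrite (memNset xQ) !mulr0.
    by rewrite (mem_set xQ) (mem_set (QM _ xQ)) mulr1.
  move: A mA; rewrite measurable_rV_boxes.
  apply: (dynkin_induction measurable_rV_boxes setI_boxes).
  - by rewrite -[RHS](box0 (fun=> - m%:R) (fun=> m%:R)); apply: Rint_eq => x;
      rewrite indicT mulr1.
  - move=> _ [a [b ->]].
    have [a' [b' E]] : boxes (Q `&` open_box a b).
      by apply: setI_boxes; eexists; eexists.
    by rewrite -[RHS](box0 a' b') -E; apply: Rint_eq => x; rewrite indicI /= mulrA.
  - move=> S mS S0.
    have -> : \int[mu]_x (f x * \1_Q x * \1_(~` S) x) =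
        \int[mu]_x (f x * \1_Q x - f x * \1_Q x * \1_S x).
      apply: Rint_eq => x; rewrite !indicE in_setC.
      by case: (x \in S); rewrite /= ?mulr1 ?mulr0 ?subr0 ?subrr.
    by rewrite RintB ?S0 ?box0 ?subrr//; exact: intg_indic.
  - move=> F mF tF F0.
    have [|||||_ _] := @Rint_dominated _ _ _ mu
        (fun n x => f x * \1_Q x * \1_(\big[setU/set0]_(i < n) F i) x)
        (fun x => f x * \1_Q x * \1_(\bigcup_k F k) x) (fun x => `|f x * \1_Q x|).
    + move=> n; apply: measurable_funM; first exact: intg_measurable fQ.
      by apply: measurable_indic; exact: bigsetU_measurable.
    + apply: measurable_funM; first exact: intg_measurable fQ.
      by apply: measurable_indic; exact: bigcup_measurable.
    + apply: aeW => x; apply: cvgM; first exact: cvg_cst.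
      rewrite indicE; have [[k _ Fk]|xF] := pselect ((\bigcup_k F k) x).
        rewrite mem_set; last by exists k.
        apply: cvg_near_cst; exists k.+1 => // n /= kn.
        by rewrite indicE mem_set// -bigcup_mkord; exists k.
      rewrite memNset//; apply: cvg_near_cst; apply: nearW => n.
      rewrite indicE memNset// -bigcup_mkord => -[k _ Fk]; apply: xF.
      by exists k.
    + exact: integrable_norm.
    + apply: aeW => x n; rewrite normrM ler_piMr// indicE.
      by case: (x \in _); rewrite ?normr1 ?normr0.
    have S0 n : \int[mu]_x (f x * \1_Q x * \1_(\big[setU/set0]_(i < n) F i) x) = 0.
      elim: n => [|n IH].
        under Rint_eq do rewrite big_ord0 indic0 mulr0.
        by rewrite /Rintegral integral0.
      have -> : \int[mu]_x (f x * \1_Q x * \1_(\big[setU/set0]_(i < n.+1) F i) x) =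
          \int[mu]_x (f x * \1_Q x * \1_(\big[setU/set0]_(i < n) F i) x +
            f x * \1_Q x * \1_(F n) x).
        apply: Rint_eq => x; rewrite big_ord_recr/= -mulrDr; congr (_ * _).
        have /seteqP[dis _] : (\big[setU/set0]_(i < n) F i) `&` F n = set0.
          rewrite -bigcup_mkord; apply/seteqP; split=> // y [[k /= kn Fk] Fn].
          have kn' : k = n by apply: (tF k n I I); exists y.
          by rewrite kn' ltnn in kn.
        rewrite !indicE in_setU.
        case: (boolP (x \in \big[setU/set0]_(i < n) F i)) => [x1|_]/=; last by rewrite add0r.
        rewrite [x \in F n]memNset ?addr0// => xF; apply: (dis x); split=> //.
        by rewrite inE in x1.
      rewrite RintD ?IH ?F0 ?addr0//; apply: intg_indic => //.
      exact: bigsetU_measurable.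
    under eq_fun do rewrite S0.
    by move=> H; apply/esym; apply: (cvg_unique _ _ H) => //; exact: cvg_cst.
have Q0 (m : nat) : {ae mu, forall x, f x * \1_(open_box (fun=> - m%:R) (fun=> m%:R)) x = 0}.
  pose g x := f x * \1_(open_box (fun=> - m%:R) (fun=> m%:R)) x.
  suff : {ae mu, forall x, g x = 0} by [].
  have [M M0 QM] := open_box_cube (fun=> - m%:R) (fun=> m%:R).
  have mQ := @measurable_open_box R N (fun=> - m%:R) (fun=> m%:R).
  have gi : intg g.
    apply: eq_intg (intg_indic mQ (L1loc_intg_cube M fl)) => x.
    rewrite /g !indicE -mulrA; have [xQ|xQ] := pselect (open_box (fun=> - m%:R) (fun=> m%:R) x).
      by rewrite (mem_set xQ) (mem_set (QM _ xQ)) !mulr1.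
    by rewrite (memNset xQ) !mulr0.
  have mg := intg_measurable gi.
  have mP : measurable [set x | 0 < g x].
    by rewrite -[X in measurable X]setTI -preimage_itvoy; exact: mg.
  have abs0 : \int[mu]_x `|g x| = 0.
    (* |g| is written with the two sets [[set x | 0 < g x]] and [setT], to both of which [set0]
       applies. *)
    have -> : \int[mu]_x `|g x| = \int[mu]_x (2 * (g x * \1_[set x | 0 < g x] x) - g x * \1_setT x).
      apply: Rint_eq => x; rewrite indicT mulr1 indicE.
      have [gx|gx] := ltP 0 (g x); first by rewrite mem_set// mulr1 gtr0_norm//; lra.
      by rewrite memNset/= ?mulr0 ?sub0r ?ler0_norm// ltNge gx.
    rewrite RintB; [|by apply: intgZ; exact: intg_indic|exact: intg_indic].
    by rewrite RintZ ?set0 ?mulr0 ?subrr//; exact: intg_indic.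
  have /ae_eq_integral_abs : (\int[mu]_x `|(g x)%:E| = 0)%E.
    rewrite -[RHS]/(0%:E) -abs0 Rintegral_EFin//; exact: integrable_norm.
  move=> /(_ measurableT (measurable_int _ gi)); apply: filterS => x /(_ I) /= [].
  by [].
have := ae_foralln Q0; apply: filterS => x Hx.
have [m xm] := cover_boxes x; have := Hx m.
by rewrite indicE mem_set ?mulr1// => i /=; rewrite in_itv/= xm.
Qed.

End du_bois_reymond.

(** * The energy of test functions and its minimizing sequences *)

(** Hoelder's and Sobolev's inequalities together bound the k-term by a multiple of D^(q/2),
    sublinear in D since q < 2. The quarter leaves room against the D/2 of the energy. *)
Lemma interpolation_absorb {R : realType} (q r A B : R) :
  0 < q -> q < 2 -> q < r -> 0 <= A -> 0 < B ->
  exists C : R, forall K X D, 0 <= X -> 0 <= D ->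
    K <= X `^ (q / r) * A `^ (1 - q / r) -> X <= B * D `^ (r / 2) ->
    K / q <= C + D / 4.
Proof.
move=> q0 q2 qr A0 B0; have r0 : 0 < r by exact: lt_trans qr.
pose c := B `^ (q / r) * A `^ (1 - q / r) / q.
have c0 : 0 <= c by rewrite !mulr_ge0 ?powR_ge0// invr_ge0 ltW.
have e0 : 0 < (4 * (c + 1))^-1 by rewrite invr_gt0 mulr_gt0// ltr_wpDl.
have hq : 0 <= q / 2 by rewrite divr_ge0// ltW.
have hq1 : q / 2 < 1 by rewrite ltr_pdivrMr// mul1r.
have [C C0 abs] := powR_absorb hq hq1 e0.
exists (c * C) => K X D X0 D0 KX XB.
have t0 : 0 <= q / r by rewrite divr_ge0// ltW.
have XD : X `^ (q / r) <= B `^ (q / r) * D `^ (q / 2).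
  move: XB => /(ge0_ler_powR t0).
  rewrite !nnegrE X0 mulr_ge0 ?powR_ge0 ?(ltW B0)// => /(_ isT isT).
  rewrite powRM ?powR_ge0 ?(ltW B0)// -powRrM.
  by have -> : r / 2 * (q / r) = q / 2 by field; rewrite gt_eqF.
have := abs _ D0; rewrite powRr1// => DC.
have Kc : K / q <= c * D `^ (q / 2).
  rewrite /c mulrAC ler_wpM2r ?invr_ge0 ?(ltW q0)//.
  by rewrite (le_trans KX)// mulrAC ler_wpM2r ?powR_ge0.
rewrite (le_trans Kc)// (le_trans (ler_wpM2l c0 DC))// mulrDr lerD2l.
rewrite mulrA mulrC ler_wpM2l// ler_pdivrMr ?mulr_gt0 ?ltr_wpDl//.
by rewrite mulrA mulVf// mul1r lerDl.
Qed.

Section energy.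
Context {R : realType} {n : nat}.
Local Notation N := n.+3.
Local Notation E := ('rV[R]_N).
Local Notation mu := (@lebesgue_rV R N).
Local Notation intg f := (mu.-integrable setT (EFin \o f)).
Local Notation p := (@crit_exp R N).
Implicit Types (phi psi u v z : E -> R).

Lemma crit_exp_gt2 : 2 < p.
Proof.
rewrite /crit_exp natrM ltr_pdivlMr ?ltr0n//.
by rewrite ltr_pM2l// ltr_nat.
Qed.

Lemma intg_weight (w : E -> R) (M c : R) phi : measurable_fun setT w ->
  (forall x, 0 <= w x) -> (forall x, w x <= M) -> 0 < c -> C0infty phi ->
  intg (fun x => w x * `|phi x| `^ c).
Proof.
move=> mw w0 wM c0 phis; have wi := C0infty_powR_intg c0 phis.
apply: (intg_le (g := fun x => M * `|phi x| `^ c)).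
- by apply: measurable_funM => //; exact: intg_measurable wi.
- exact: intgZ.
- by move=> x; rewrite ger0_norm ?mulr_ge0 ?powR_ge0// ler_wpM2r ?powR_ge0.
Qed.

Variables (q s : R) (k h : E -> R) (Mk Mh : R).
Hypotheses (q1 : 1 < q) (q2 : q < 2) (s2 : 2 < s).
Hypotheses (mk : measurable_fun setT k) (k0 : forall x, 0 <= k x)
  (kM : forall x, k x <= Mk) (ki : intg (fun x => k x `^ (p / (p - q)))).
Hypotheses (mh : measurable_fun setT h) (h0 : forall x, 0 <= h x)
  (hM : forall x, h x <= Mh).

Let q0 : 0 < q. Proof. exact: lt_trans q1. Qed.
Let s0 : 0 < s. Proof. exact: lt_trans s2. Qed.
Let p2 : 2 < p. Proof. exact: crit_exp_gt2. Qed.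
Let p0 : 0 < p. Proof. exact: lt_trans p2. Qed.

Definition quad phi : R := \int[mu]_x (\sum_(i < N) (phi x * partial i phi x) ^+ 2).
Definition kfun phi : R := \int[mu]_x (k x * `|phi x| `^ q).
Definition hfun phi : R := \int[mu]_x (h x * `|phi x| `^ s).
(** The functional [J] read on test functions with classical derivatives; half of (1 + 2 phi^2)
    |dphi|^2 is split into [dir phi / 2] and [quad phi], which behave differently in the limit. *)
Definition energy phi : R :=
  dir phi / 2 + quad phi - kfun phi / q + hfun phi / s.

Lemma intg_kfun phi : C0infty phi -> intg (fun x => k x * `|phi x| `^ q).
Proof. exact: intg_weight mk k0 kM q0. Qed.

Lemma intg_hfun phi : C0infty phi -> intg (fun x => h x * `|phi x| `^ s).
Proof. exact: intg_weight mh h0 hM s0. Qed.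

Lemma intg_quad phi : C0infty phi -> intg (fun x => \sum_(i < N) (phi x * partial i phi x) ^+ 2).
Proof.
move=> phis; apply: intg_sum => i; apply: C0infty_intg_sqr.
by apply: C0inftyM => //; exact: C0infty_partial.
Qed.

Lemma quad_ge0 phi : 0 <= quad phi.
Proof. by apply: Rint_ge0 => x; exact: sum_sqr_ge0. Qed.

Lemma kfun_ge0 phi : 0 <= kfun phi.
Proof. by apply: Rint_ge0 => x; rewrite mulr_ge0 ?powR_ge0. Qed.

Lemma hfun_ge0 phi : 0 <= hfun phi.
Proof. by apply: Rint_ge0 => x; rewrite mulr_ge0 ?powR_ge0. Qed.

(** Hoelder's inequality with exponents p/q and p/(p-q); the latter is the exponent q_0 of the
    assumption on k. *)
Lemma kfun_hoelder phi : C0infty phi -> kfun phi <=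
  (\int[mu]_x (`|phi x| `^ p)) `^ (q / p) *
  (\int[mu]_x (k x `^ (p / (p - q)))) `^ (1 - q / p).
Proof.
move: (p) p2 p0 ki => r r2 r0 kir phis.
have qr : q < r by exact: lt_trans r2.
have t01 : 0 < q / r < 1.
  by apply/andP; split; [exact: divr_gt0|rewrite ltr_pdivrMr// mul1r].
have iX := C0infty_powR_intg r0 phis.
rewrite -lee_fin Rintegral_EFin; last exact: intg_kfun.
have := hoelder_ereal mu t01 (measurable_int _ iX) (measurable_int _ kir).
rewrite -(Rintegral_EFin iX) -(Rintegral_EFin kir) !poweR_EFin -EFinM.
move=> H; apply: le_trans (H _ _); last 2 first.
- by move=> x; rewrite lee_fin powR_ge0.
- by move=> x; rewrite lee_fin powR_ge0.
rewrite le_eqVlt; apply/orP; left; apply/eqP; apply: eq_integral => x _.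
rewrite -[RHS]/((`|phi x| `^ r)%:E `^ (q / r) *
  (k x `^ (r / (r - q)))%:E `^ (1 - q / r))%E.
rewrite !poweR_EFin -EFinM -!powRrM; congr (_%:E).
have -> : r / (r - q) * (1 - q / r) = 1.
  by field; rewrite subr_eq0 !gt_eqF.
have -> : r * (q / r) = q by field; rewrite gt_eqF.
by rewrite powRr1// mulrC.
Qed.

Lemma kfun_coercive : exists C : R, forall phi, C0infty phi ->
  kfun phi / q <= C + dir phi / 4.
Proof.
have [Cs Cs0 sob] := @sobolev R n.
have A0 : 0 <= \int[mu]_x (k x `^ (p / (p - q))).
  by apply: Rint_ge0 => x; exact: powR_ge0.
have [C HC] := interpolation_absorb q0 q2 (lt_trans q2 p2) A0 Cs0.
exists C => phi phis; apply: HC (kfun_hoelder phis) (sob phi phis).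
- by apply: Rint_ge0 => x; exact: powR_ge0.
- exact: dir_ge0.
Qed.

Lemma energy_coercive : exists C : R, forall phi, C0infty phi ->
  dir phi / 4 + quad phi + hfun phi / s <= C + energy phi.
Proof.
have [C HC] := kfun_coercive; exists C => phi phis.
by have := HC phi phis; rewrite /energy; lra.
Qed.

Lemma energy_scale (t : R) phi : 0 < t -> C0infty phi ->
  energy (fun x => t * phi x) = t ^+ 2 * (dir phi / 2) + t ^+ 4 * quad phi
    - t `^ q * (kfun phi / q) + t `^ s * (hfun phi / s).
Proof.
move=> t0 phis; have dE i : partial i (fun x => t * phi x) = fun x => t * partial i phi x.
  by apply: partialZ; exact: C0infty_smooth.
have pw (w : E -> R) (c : R) : intg (fun x => w x * `|phi x| `^ c) ->
    \int[mu]_x (w x * `|t * phi x| `^ c) = t `^ c * \int[mu]_x (w x * `|phi x| `^ c).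
  move=> wi; rewrite -RintZ//; apply: Rint_eq => x.
  by rewrite normrM (gtr0_norm t0) powRM// ?(ltW t0)// mulrCA.
rewrite /energy /kfun /hfun !pw; [|exact: intg_hfun|exact: intg_kfun].
have -> : dir (fun x => t * phi x) = t ^+ 2 * dir phi.
  rewrite /dir -RintZ; last exact: intg_grad.
  apply: Rint_eq => x; rewrite mulr_sumr; apply: eq_bigr => i _.
  by rewrite dE exprMn.
have -> : quad (fun x => t * phi x) = t ^+ 4 * quad phi.
  rewrite /quad -RintZ; last exact: intg_quad.
  apply: Rint_eq => x; rewrite mulr_sumr; apply: eq_bigr => i _.
  by rewrite dE; ring.
by rewrite !mulrA.
Qed.

(** Along t phi the k-term is of order t^q with q < 2, so it beats the rest for small t unless
    [kfun phi] is 0. If it were 0 for every test function, the bumps, positive on their boxes, would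
    force k = 0 almost everywhere. *)
Lemma energy_neg : ~ {ae mu, forall x, k x = 0} ->
  exists2 phi, C0infty phi & energy phi < 0.
Proof.
move=> kn0; apply: contrapT => H; apply: kn0.
have K0 phi : C0infty phi -> kfun phi = 0.
  move=> phis; apply/eqP; rewrite eq_le kfun_ge0 andbT leNgt; apply/negP => K0.
  apply: H; set A := dir phi / 2 + quad phi + hfun phi / s.
  have A0 : 0 <= A by rewrite !addr_ge0 ?divr_ge0 ?dir_ge0 ?quad_ge0 ?hfun_ge0// ltW.
  have d0 : 0 < 2 - q by rewrite subr_gt0.
  (* t <= 1 reduces t^4 and t^s to t^2; the other bound makes the k-term at least t^2 (A + 1), so
     the energy is at most - t^2. *)
  pose t := Num.min 1 ((kfun phi / q / (A + 1)) `^ (2 - q)^-1).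
  have A1 : 0 < A + 1 by rewrite ltr_wpDl.
  have t0 : 0 < t by rewrite lt_min ltr01 powR_gt0// !divr_gt0.
  have t1 : t <= 1 by rewrite ge_min lexx.
  exists (fun x => t * phi x); first exact: C0inftyZ.
  rewrite energy_scale//.
  have t4 : t ^+ 4 <= t ^+ 2 by rewrite ler_wiXn2l// ltW.
  have ts : t `^ s <= t ^+ 2.
    by rewrite -powR_mulrn ?(ltW t0)//; apply: ger_powR; [rewrite t0|exact: ltW].
  have t2 : t ^+ 2 = t `^ q * t `^ (2 - q).
    by rewrite -powR_mulrn ?(ltW t0)// -powRD ?(gt_eqF t0) ?implybT//; congr (_ `^ _); ring.
  have td : t `^ (2 - q) * (A + 1) <= kfun phi / q.
    rewrite -ler_pdivlMr//.
    have -> : kfun phi / q / (A + 1) = ((kfun phi / q / (A + 1)) `^ (2 - q)^-1) `^ (2 - q).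
      by rewrite -powRrM mulVf ?gt_eqF// powRr1// !divr_ge0// ?(ltW K0) ?(ltW q0) ?(ltW A1).
    apply: ge0_ler_powR; rewrite ?nnegrE ?powR_ge0 ?(ltW d0) ?(ltW t0)//.
    by rewrite ge_min lexx orbT.
  have := ler_wpM2r (quad_ge0 phi) t4.
  have := ler_wpM2r (divr_ge0 (hfun_ge0 phi) (ltW s0)) ts.
  have : t ^+ 2 * (A + 1) <= t `^ q * (kfun phi / q).
    by rewrite t2 -mulrA ler_wpM2l ?powR_ge0.
  have : 0 < t ^+ 2 by rewrite exprn_gt0.
  by rewrite mulrDr /A !mulrDr mulr1; lra.
have Q0 (m : nat) : {ae mu, forall x, open_box (fun=> - m%:R) (fun=> m%:R) x -> k x = 0}.
  have := K0 _ (C0infty_bump (fun=> - m%:R) (fun=> m%:R) 0).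
  set b := bump _ _ _ => Kb.
  have bi : intg (fun x => k x * `|b x| `^ q).
    by apply: intg_kfun; exact: C0infty_bump.
  have /ae_eq_integral_abs : (\int[mu]_x `|(k x * `|b x| `^ q)%:E| = 0)%E.
    rewrite -[RHS]/(0%:E) -Kb Rintegral_EFin//; apply: eq_integral => x _.
    by rewrite gee0_abs// lee_fin mulr_ge0 ?powR_ge0.
  move=> /(_ measurableT (measurable_int _ bi)); apply: filterS => x /(_ I) /= [] /eqP.
  rewrite mulf_eq0 => /orP[/eqP//|]; rewrite powR_eq0 normr_eq0 => /andP[/eqP b0 _].
  by move=> /(@bump_gt0 _ _ _ _ 0); rewrite -/b b0 ltxx.
have := ae_foralln Q0; apply: filterS => x Hx.
apply: (Hx (Num.truncn (\sum_(i < N) `|x ord0 i|)).+1) => i /=.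
rewrite in_itv/= -ltr_norml (le_lt_trans _ (truncnS_gt _))//.
by rewrite (bigD1 i)//= lerDl sumr_ge0.
Qed.

End energy.

Lemma midpoint_combine (F : realFieldType) (Du Dv Dz Qu Qv Qz Ku Kv Kz Hu Hv Hz W d a b : F) :
  Dz <= (Du + Dv) / 2 -> Qz <= (Qu + Qv) / 2 - W / 16 ->
  (Ku + Kv) / 2 * a <= Kz + d -> Hz * b <= (Hu + Hv) / 2 * b ->
  Dz / 2 + Qz - Kz + Hz * b <=
  ((Du / 2 + Qu - Ku * a + Hu * b) + (Dv / 2 + Qv - Kv * a + Hv * b)) / 2 - W / 16 + d.
Proof. lra. Qed.

(** * Midpoint convexity of the energy in u^2 *)

Section energy_midpoint.
Context {R : realType} {n : nat}.
Local Notation N := n.+3.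
Local Notation E := ('rV[R]_N).
Local Notation mu := (@lebesgue_rV R N).
Local Notation intg f := (mu.-integrable setT (EFin \o f)).
Local Notation p := (@crit_exp R N).
Implicit Types (phi psi u v z : E -> R).

Definition sqr_mean u v (x : E) : R := (u x ^+ 2 + v x ^+ 2) / 2.

(* A smooth substitute for the square root of [sqr_mean u v]. *)
Definition quad_mean (e : R) u v (x : E) : R := Num.sqrt (sqr_mean u v x + e ^+ 2) - e.

Section pointwise.
Variables (u v : E -> R) (e : R).
Hypotheses (us : C0infty u) (vs : C0infty v) (e0 : 0 < e).
Local Notation w := (sqr_mean u v).
Local Notation z := (quad_mean e u v).

Lemma C0infty_sqr_mean : C0infty w.
Proof.
have -> : w = fun x => 2^-1 * (u x * u x + v x * v x).
  by apply/funext => x; rewrite /sqr_mean mulrC.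
by apply: C0inftyZ; apply: C0inftyD; exact: C0inftyM.
Qed.

Lemma sqr_mean_ge0 x : 0 <= w x.
Proof. by rewrite divr_ge0 ?addr_ge0 ?sqr_ge0. Qed.

Let we0 x : 0 < w x + e ^+ 2.
Proof. by rewrite ltr_wpDl ?sqr_mean_ge0 ?exprn_gt0. Qed.

Let smooth_we : smooth (fun x => w x + e ^+ 2).
Proof. by apply: smoothD; [exact: C0infty_smooth C0infty_sqr_mean|exact: smooth_cst]. Qed.

Lemma quad_mean_ge0 x : 0 <= z x.
Proof.
rewrite subr_ge0 -{1}(ger0_norm (ltW e0)) -sqrtr_sqr ler_sqrt ?(ltW (we0 x))//.
by rewrite lerDr sqr_mean_ge0.
Qed.

Lemma quad_mean_sqr_le x : z x ^+ 2 <= w x.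
Proof.
have z0 := quad_mean_ge0 x.
have : (z x + e) ^+ 2 = w x + e ^+ 2 by rewrite /quad_mean subrK sqr_sqrtr ?(ltW (we0 x)).
have : 0 <= z x * e by rewrite mulr_ge0 ?(ltW e0).
by rewrite sqrrD mulr2n; lra.
Qed.

(** From (z + e)^2 = w + e^2 one gets w = z^2 + 2 e z, and z is at most the root of w. *)
Lemma sqr_mean_le x : w x <= z x ^+ 2 + 2 * e * Num.sqrt (w x).
Proof.
have z0 := quad_mean_ge0 x.
have H : (z x + e) ^+ 2 = w x + e ^+ 2 by rewrite /quad_mean subrK sqr_sqrtr ?(ltW (we0 x)).
have zs : z x <= Num.sqrt (w x).
  rewrite -(ger0_norm z0) -sqrtr_sqr ler_sqrt ?sqr_mean_ge0//.
  exact: quad_mean_sqr_le.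
have := ler_wpM2l (ltW e0) zs.
by move: H; rewrite sqrrD mulr2n; lra.
Qed.

Lemma C0infty_quad_mean : C0infty z.
Proof.
apply/C0inftyP; split.
  have -> : z = fun x => Num.sqrt (w x + e ^+ 2) + - e by [].
  by apply: smoothD; [exact: smooth_sqrt|exact: smooth_cst].
have [_ [M wM]] := (C0inftyP _).1 C0infty_sqr_mean.
(* Where w vanishes the root equals [e]; subtracting [e] in [quad_mean] keeps the support
   bounded. *)
by exists M => x /wM wx; rewrite /quad_mean wx add0r sqrtr_sqr gtr0_norm// subrr.
Qed.

Lemma partial_sqr_mean i x : partial i w x = u x * partial i u x + v x * partial i v x.
Proof.
have -> : w = fun x => 2^-1 * (u x * u x + v x * v x).
  by apply/funext => y; rewrite /sqr_mean mulrC.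
have su := C0infty_smooth us; have sv := C0infty_smooth vs.
rewrite partialZ; last by apply: smoothD; exact: smoothM.
rewrite partialD; [|exact: smoothM|exact: smoothM].
by rewrite !partialM//; field.
Qed.

Lemma partial_quad_mean i x : 2 * (z x + e) * partial i z x =
  u x * partial i u x + v x * partial i v x.
Proof.
have -> : partial i z x = partial i (fun x => Num.sqrt (w x + e ^+ 2) - e) x by [].
rewrite partialB; [|exact: smooth_sqrt|exact: smooth_cst].
rewrite partial_cst subr0 partial_sqrt//.
rewrite partialD; [|exact: C0infty_smooth C0infty_sqr_mean|exact: smooth_cst].
rewrite partial_cst addr0 /quad_mean subrK partial_sqr_mean mulrA divff ?mul1r//.
by rewrite mulf_neq0// gt_eqF// sqrtr_gt0.
Qed.

(** Since 2 (z + e) dz = u du + v dv, the Cauchy-Schwarz inequality and w <= (z + e)^2 conclude. *)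
Lemma partial_quad_mean_sqr i x :
  partial i z x ^+ 2 <= (partial i u x ^+ 2 + partial i v x ^+ 2) / 2.
Proof.
have H := partial_quad_mean i x; have z0 := quad_mean_ge0 x.
have Z : (z x + e) ^+ 2 = w x + e ^+ 2 by rewrite /quad_mean subrK sqr_sqrtr ?(ltW (we0 x)).
have Z0 : 0 < (z x + e) ^+ 2 by rewrite Z.
have wz : w x <= (z x + e) ^+ 2 by rewrite Z lerDl sqr_ge0.
move: H Z0 wz; set a := partial i u x; set b := partial i v x; set c := partial i z x.
rewrite /sqr_mean; move: (u x) (v x) (z x) => U V Y H Y0 wY.
rewrite -(ler_pM2l Y0).
have -> : (Y + e) ^+ 2 * c ^+ 2 = (U * a + V * b) ^+ 2 / 4 by rewrite -H; field.
have h1 : (U * a + V * b) ^+ 2 <= (U ^+ 2 + V ^+ 2) * (a ^+ 2 + b ^+ 2).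
  have := sqr_ge0 (U * b - V * a); nra.
have := ler_wpM2r (addr_ge0 (sqr_ge0 a) (sqr_ge0 b)) wY.
by move: h1; nra.
Qed.

(** (z + e) dz is the mean of u du and v dv. The parallelogram identity produces the squared
    difference, the gain that makes minimizing sequences Cauchy; replacing z + e by z only helps. *)
Lemma quad_mean_partial_sqr i x : (z x * partial i z x) ^+ 2 <=
  ((u x * partial i u x) ^+ 2 + (v x * partial i v x) ^+ 2) / 2
    - (u x * partial i u x - v x * partial i v x) ^+ 2 / 4.
Proof.
have H := partial_quad_mean i x; have z0 := quad_mean_ge0 x.
set a := u x * _ in H *; set b := v x * _ in H *; set c := partial i z x in H *.
have -> : (a ^+ 2 + b ^+ 2) / 2 - (a - b) ^+ 2 / 4 = ((z x + e) * c) ^+ 2.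
  have -> : a = 2 * (z x + e) * c - b by rewrite H addrK.
  by field.
have ze0 : 0 <= z x + e by exact: addr_ge0 z0 (ltW e0).
by rewrite !exprMn ler_wpM2r ?sqr_ge0// ler_sqr ?nnegrE// lerDl ltW.
Qed.

End pointwise.

Variables (q s : R) (k h : E -> R) (Mk Mh : R).
Hypotheses (q1 : 1 < q) (q2 : q < 2) (s2 : 2 < s).
Hypotheses (mk : measurable_fun setT k) (k0 : forall x, 0 <= k x)
  (kM : forall x, k x <= Mk) (ki : intg (fun x => k x `^ (p / (p - q)))).
Hypotheses (mh : measurable_fun setT h) (h0 : forall x, 0 <= h x)
  (hM : forall x, h x <= Mh).

Let q0 : 0 < q. Proof. exact: lt_trans q1. Qed.
Let s0 : 0 < s. Proof. exact: lt_trans s2. Qed.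

Lemma dir_sqr_diff u v : C0infty u -> C0infty v ->
  dir (fun x => u x ^+ 2 - v x ^+ 2) =
  4 * \int[mu]_x (\sum_(i < N) (u x * partial i u x - v x * partial i v x) ^+ 2).
Proof.
move=> us vs; have su := C0infty_smooth us; have sv := C0infty_smooth vs.
rewrite -RintZ; last first.
  apply: intg_sum => i; apply: C0infty_intg_sqr.
  by apply: C0inftyB; apply: C0inftyM => //; exact: C0infty_partial.
apply: Rint_eq => x; rewrite mulr_sumr; apply: eq_bigr => i _.
have -> : (fun x => u x ^+ 2 - v x ^+ 2) = (fun x => u x * u x - v x * v x) by [].
rewrite partialB; [|exact: smoothM|exact: smoothM].
by rewrite !partialM//; ring.
Qed.

(* Convexity of the energy as a function of [u ^+ 2], strong in the Dirichlet
   norm because of the term [quad]. *)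
Lemma energy_midpoint u v (d : R) : C0infty u -> C0infty v -> 0 < d ->
  exists z, [/\ C0infty z, forall x, 0 <= z x &
    energy q s k h z <= (energy q s k h u + energy q s k h v) / 2
      - dir (fun x => u x ^+ 2 - v x ^+ 2) / 16 + d].
Proof.
move=> us vs d0.
pose C := \int[mu]_x (k x * `|sqr_mean u v x| `^ (q / 4)).
have q4 : 0 < q / 4 by rewrite divr_gt0.
have Ci : intg (fun x => k x * `|sqr_mean u v x| `^ (q / 4)).
  by apply: (intg_weight mk k0 kM q4); exact: C0infty_sqr_mean.
have C0 : 0 <= C by apply: Rint_ge0 => x; rewrite mulr_ge0 ?powR_ge0.
have qh : 0 < q / 2 by rewrite divr_gt0.
have qh1 : q / 2 <= 1 by rewrite ler_pdivrMr// mul1r ltW.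
(* The k-term loses at most (2 e)^(q/2) C; this choice makes the loss at most q d, which becomes [d]
   after the division by q in the energy. *)
pose e := (q * d / (C + 1)) `^ (q / 2)^-1 / 2.
have C1 : 0 < C + 1 by rewrite ltr_wpDl.
have e0 : 0 < e by rewrite divr_gt0// powR_gt0// !divr_gt0// mulr_gt0.
have eE : (2 * e) `^ (q / 2) * (C + 1) = q * d.
  rewrite /e mulrC [2 * _]mulrC divfK// -powRrM mulVf ?gt_eqF// powRr1.
    by rewrite mulrC divfK// gt_eqF.
  by rewrite divr_ge0 ?mulr_ge0 ?(ltW q0) ?(ltW d0) ?(ltW C1).
clearbody e.
pose z := quad_mean e u v; exists z.
have zs : C0infty z by exact: C0infty_quad_mean.
have z0 x : 0 <= z x by exact: quad_mean_ge0.
split=> //.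
have gi phi : C0infty phi -> intg (fun x => \sum_(i < N) partial i phi x ^+ 2)  by exact: intg_grad.
have Dz : dir z <= (dir u + dir v) / 2.
  rewrite [leRHS]mulrC -RintD; [|exact: gi|exact: gi].
  rewrite -RintZ; last by apply: intgD; exact: gi.
  apply: Rint_le; [exact: gi|by apply: intgZ; apply: intgD; exact: gi|move=> x].
  rewrite -big_split/= mulr_sumr; apply: ler_sum => i _; rewrite mulrC.
  exact: partial_quad_mean_sqr.
have di : intg (fun x => \sum_(i < N) (u x * partial i u x - v x * partial i v x) ^+ 2).
  apply: intg_sum => i; apply: C0infty_intg_sqr.
  by apply: C0inftyB; apply: C0inftyM => //; exact: C0infty_partial.
(* The pointwise gain of 1/4 becomes 1/16 because d(u^2 - v^2) is twice u du - v dv. *)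
have Qz : quad z <= (quad u + quad v) / 2 - dir (fun x => u x ^+ 2 - v x ^+ 2) / 16.
  rewrite dir_sqr_diff//.
  have -> : 4 * \int[mu]_x (\sum_(i < N) (u x * partial i u x - v x * partial i v x) ^+ 2) / 16 =
      4^-1 * \int[mu]_x (\sum_(i < N) (u x * partial i u x - v x * partial i v x) ^+ 2) by field.
  rewrite [(quad u + _) / 2]mulrC -RintD; [|exact: intg_quad|exact: intg_quad].
  rewrite -!RintZ//; last by apply: intgD; exact: intg_quad.
  rewrite -RintB; [|by apply: intgZ; apply: intgD; exact: intg_quad|exact: intgZ].
  apply: Rint_le; first exact: intg_quad.
    by apply: intgB; apply: intgZ => //; apply: intgD; exact: intg_quad.
  move=> x; rewrite -big_split/= !mulr_sumr -sumrB; apply: ler_sum => i _.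
  rewrite [2^-1 * _]mulrC [4^-1 * _]mulrC; exact: quad_mean_partial_sqr.
have Hz : hfun s h z <= (hfun s h u + hfun s h v) / 2.
  have hfi phi : C0infty phi -> intg (fun x => h x * `|phi x| `^ s)  by exact: (intg_hfun s2 mh h0 hM).
  rewrite [leRHS]mulrC -RintD; [|exact: hfi|exact: hfi].
  rewrite -RintZ; last by apply: intgD; exact: hfi.
  apply: Rint_le; [exact: hfi|by apply: intgZ; apply: intgD; exact: hfi|move=> x].
  rewrite -mulrDr mulrCA ler_wpM2l//.
  have sh : 1 <= s / 2 by rewrite ler_pdivlMr// mul1r ltW.
  have pE y : `|y| `^ s = (y ^+ 2) `^ (s / 2).
    by rewrite powR_sqr; congr (_ `^ _); field.
  rewrite !pE (le_trans _ (_ : sqr_mean u v x `^ (s / 2) <= _))//.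
    apply: ge0_ler_powR; rewrite ?nnegrE ?sqr_ge0 ?sqr_mean_ge0 ?(le_trans ler01 sh)//.
    exact: quad_mean_sqr_le.
  by rewrite [2^-1 * _]mulrC; apply: powR_midpoint_convex; rewrite ?sqr_ge0.
(* The only estimate with an error: the k-term enters the energy with a minus sign, so z^2 must be
   bounded from below by w, through [sqr_mean_le] and subadditivity of the power q/2. *)
have Kz : (kfun q k u + kfun q k v) / 2 <= kfun q k z + q * d.
  have kfi phi : C0infty phi -> intg (fun x => k x * `|phi x| `^ q)  by exact: (intg_kfun q1 mk k0 kM).
  apply: (@le_trans _ _ (kfun q k z + (2 * e) `^ (q / 2) * C)); last first.
    by rewrite lerD2l -eE ler_wpM2l ?powR_ge0// lerDl.
  rewrite [leLHS]mulrC -RintD; [|exact: kfi|exact: kfi].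
  rewrite -!RintZ//; last by apply: intgD; exact: kfi.
  rewrite -RintD; [|exact: kfi|exact: intgZ].
  apply: Rint_le.
  - by apply: intgZ; apply: intgD; exact: kfi.
  - by apply: intgD; [exact: kfi|exact: intgZ].
  move=> x; rewrite -mulrDr mulrCA [_ `^ _ * (k x * _)]mulrCA -mulrDr ler_wpM2l//.
  have pE y : `|y| `^ q = (y ^+ 2) `^ (q / 2).
    by rewrite powR_sqr; congr (_ `^ _); field.
  have w0 := sqr_mean_ge0 u v x.
  rewrite !pE [2^-1 * _]mulrC; apply: (@le_trans _ _ (sqr_mean u v x `^ (q / 2))).
    by apply: powR_midpoint_concave; rewrite ?sqr_ge0// qh qh1.
  have ws : 0 <= 2 * e * Num.sqrt (sqr_mean u v x).
    by rewrite mulr_ge0 ?sqrtr_ge0// mulr_ge0 ?(ltW e0).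
  apply: (@le_trans _ _ ((z x ^+ 2 + 2 * e * Num.sqrt (sqr_mean u v x)) `^ (q / 2))).
    apply: ge0_ler_powR; rewrite ?nnegrE ?addr_ge0 ?sqr_ge0 ?(ltW qh)//.
    exact: sqr_mean_le.
  apply: le_trans (powR_subadd _ ws _) _; rewrite ?sqr_ge0 ?qh ?qh1//.
  rewrite lerD2l powRM ?sqrtr_ge0 ?mulr_ge0 ?(ltW e0)//.
  rewrite -powR12_sqrt// -powRrM ger0_norm// le_eqVlt; apply/orP; left; apply/eqP.
  by congr (_ * _ `^ _); field.
rewrite /energy.
have iq : 0 <= q^-1 by rewrite invr_ge0 ltW.
have is0 : 0 <= s^-1 by rewrite invr_ge0 ltW.
have := ler_wpM2r is0 Hz; have := ler_wpM2r iq Kz.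
have -> : (kfun q k z + q * d) / q = kfun q k z / q + d by field; rewrite gt_eqF.
move=> Kz' Hz'; exact: midpoint_combine Dz Qz Kz' Hz'.
Qed.

End energy_midpoint.

Lemma midpoint_gap (F : realFieldType) (Ji Jj m D a b e : F) :
  Ji <= m + a -> Jj <= m + b -> m <= (Ji + Jj) / 2 - D / 16 + e / 16 ->
  D <= 8 * (a + b) + e.
Proof. lra. Qed.

Section subsequences.

Lemma cvg_subseq (T : topologicalType) (f : nat -> T) (l : T) (g : nat -> nat) :
  (forall n, (n <= g n)%N) -> f @ \oo --> l -> (f \o g) @ \oo --> l.
Proof.
move=> gn fl; apply: cvg_comp fl => A [m _ mA].
by exists m => // k /= mk; apply: mA => /=; rewrite (leq_trans mk).
Qed.

Lemma select_subseq (P : nat -> nat -> Prop) : (forall n, exists m, P n m) ->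
  (forall n m m', (m <= m')%N -> P n m -> P n m') ->
  exists2 g : nat -> nat, (forall n, (g n < g n.+1)%N) & forall n, P n (g n).
Proof.
move=> /choice[f fP] Pm.
(* Sums of the chosen ranks dominate each of them; the added n makes the sequence strictly
   increasing. *)
exists (fun n => n + \sum_(j < n.+1) f j)%N => n.
  by rewrite [X in (_ < _ + X)%N]big_ord_recr/= addSn ltnS leq_add2l leq_addr.
apply: Pm (fP n).
by rewrite (leq_trans _ (leq_addl _ _))// big_ord_recr/= leq_addl.
Qed.

Lemma subseq_ge (g : nat -> nat) : (forall n, (g n < g n.+1)%N) -> forall n, (n <= g n)%N.
Proof. by move=> gS; elim=> // n IH; rewrite (leq_ltn_trans IH). Qed.

End subsequences.

(** * Minimizing sequences of nonnegative test functions *)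

Section minimizing_sequence.
Context {R : realType} {n : nat}.
Local Notation N := n.+3.
Local Notation E := ('rV[R]_N).
Local Notation mu := (@lebesgue_rV R N).
Local Notation intg f := (mu.-integrable setT (EFin \o f)).
Local Notation p := (@crit_exp R N).
Implicit Types (phi psi u v z : E -> R).

Variables (q s : R) (k h : E -> R) (Mk Mh : R).
Hypotheses (q1 : 1 < q) (q2 : q < 2) (s2 : 2 < s).
Hypotheses (mk : measurable_fun setT k) (k0 : forall x, 0 <= k x)
  (kM : forall x, k x <= Mk) (ki : intg (fun x => k x `^ (p / (p - q)))).
Hypotheses (mh : measurable_fun setT h) (h0 : forall x, 0 <= h x)
  (hM : forall x, h x <= Mh).
Local Notation J0 := (energy q s k h).

(** The last clause comes from the midpoint of f_i and f_j: its energy is at least m, so the gain in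
    [energy_midpoint] is at most the mean excess of f_i and f_j over m, up to an arbitrarily small
    error. *)
Lemma minimizing_sequence : exists m, exists f : nat -> E -> R,
  [/\ forall j, C0infty (f j), forall j x, 0 <= f j x,
      forall psi, C0infty psi -> m <= J0 psi,
      forall j, J0 (f j) <= m + (j.+1%:R^-1) ^+ 2 &
      forall i j, dir (fun x => f i x ^+ 2 - f j x ^+ 2) <=
        8 * ((i.+1%:R^-1) ^+ 2 + (j.+1%:R^-1) ^+ 2)].
Proof.
pose A := [set J0 psi | psi in C0infty].
have C00 : C0infty (fun _ : E => 0 : R).
  by apply/C0inftyP; split; [exact: smooth_cst|exists 0].
have A0 : A !=set0 by exists (J0 (fun=> 0)), (fun=> 0).
have [C HC] := energy_coercive s h q1 q2 mk k0 kM ki.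
have lbA : has_lbound A.
  exists (- C) => _ [psi psis <-]; have := HC psi psis.
  have s0 : 0 < s by rewrite (lt_trans _ s2).
  have a1 := dir_ge0 psi; have a2 := quad_ge0 psi.
  have a3 : 0 <= hfun s h psi / s by rewrite divr_ge0 ?hfun_ge0 ?(ltW s0).
  move: (hfun s h psi / s) a3 (J0 psi) => a a3 b.
  have a4 : 0 <= dir psi / 4 by rewrite divr_ge0.
  move=> H; rewrite -subr_ge0 opprK addrC; apply: le_trans H.
  by rewrite !addr_ge0.
have hiA : has_inf A by split.
have infP psi : C0infty psi -> inf A <= J0 psi.
  by move=> psis; apply: ge_inf => //; exists psi.
have step (j : nat) : exists f, [/\ C0infty f, forall x, 0 <= f x &
    J0 f <= inf A + (j.+1%:R^-1) ^+ 2].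
  have e0 : 0 < (j.+1%:R^-1) ^+ 2 / 2 :> R by rewrite divr_gt0// exprn_gt0// invr_gt0.
  have [_ [psi psis <-] psij] := inf_adherent e0 hiA.
  (* The midpoint of [psi] with itself is a regularized |psi|: nonnegative, at the price of half of
     the allowed excess. *)
  have [z [zs z0 zle]] := energy_midpoint q1 q2 s2 mk k0 kM mh h0 hM psis psis e0.
  exists z; split=> //; apply: (le_trans zle).
  have D0 := dir_ge0 (fun x => psi x ^+ 2 - psi x ^+ 2).
  have -> : inf A + (j.+1%:R^-1) ^+ 2 = inf A + (j.+1%:R^-1) ^+ 2 / 2 + (j.+1%:R^-1) ^+ 2 / 2 :> R by field.
  rewrite lerD2r; apply: le_trans (ltW psij).
  have -> : (J0 psi + J0 psi) / 2 = J0 psi by field.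
  by rewrite gerDl oppr_le0 divr_ge0.
have [f fP] := choice step.
exists (inf A), f; split.
- by move=> j; case: (fP j).
- by move=> j; case: (fP j).
- exact: infP.
- by move=> j; case: (fP j).
move=> i j; have [fi _ Ji] := fP i; have [fj _ Jj] := fP j.
apply/ler_addgt0Pr => e e0; set D := dir _.
have e16 : 0 < e / 16 by rewrite divr_gt0.
have [z [zs _ zle]] := energy_midpoint q1 q2 s2 mk k0 kM mh h0 hM fi fj e16.
have := le_trans (infP z zs) zle; rewrite -/D.
exact: midpoint_gap Ji Jj.
Qed.

Lemma minimizing_bound (m : R) (f : nat -> E -> R) :
  (forall j, C0infty (f j)) -> (forall j, J0 (f j) <= m + (j.+1%:R^-1) ^+ 2) ->
  exists2 B : R, 0 <= B & forall j, [/\ dir (f j) <= B, quad (f j) <= B,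
    hfun s h (f j) <= B & \int[mu]_x (`|f j x| `^ p) <= B].
Proof.
move=> fs fJ.
have [C HC] := energy_coercive s h q1 q2 mk k0 kM ki.
have [Cs Cs0 sob] := @sobolev R n.
pose A := `|C + m + 1|.
have s0 : 0 < s by rewrite (lt_trans _ s2).
have p0 : 0 < p / 2 by rewrite divr_gt0// (lt_trans _ (@crit_exp_gt2 R n)).
have bnd j : dir (f j) / 4 + quad (f j) + hfun s h (f j) / s <= A.
  apply: (le_trans (HC _ (fs j))); rewrite /A (le_trans _ (ler_norm _))//.
  rewrite -addrA lerD2l (le_trans (fJ j))// lerD2l exprn_ile1// ?invr_ge0//.
  by rewrite invf_le1 ?ltr0n// ler1n.
have A0 : 0 <= A by exact: normr_ge0.
exists (4 * A + s * A + Cs * (4 * A) `^ (p / 2)) => [|j].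
  by rewrite !addr_ge0 ?mulr_ge0 ?powR_ge0 ?(ltW s0) ?(ltW Cs0).
have a1 := dir_ge0 (f j); have a2 := quad_ge0 (f j).
have a3 : 0 <= hfun s h (f j) / s by rewrite divr_ge0 ?hfun_ge0 ?(ltW s0).
have a4 : 0 <= dir (f j) / 4 by rewrite divr_ge0.
have b1 : dir (f j) <= 4 * A.
  by rewrite mulrC -ler_pdivrMr// (le_trans _ (bnd j))// -addrA lerDl addr_ge0.
have b2 : quad (f j) <= A.
  by rewrite (le_trans _ (bnd j))// -addrAC lerDr addr_ge0.
have b3 : hfun s h (f j) <= s * A.
  by rewrite mulrC -ler_pdivrMr// (le_trans _ (bnd j))// lerDr addr_ge0.
have c1 : 0 <= s * A by rewrite mulr_ge0// ltW.
have c2 : 0 <= Cs * (4 * A) `^ (p / 2) by rewrite mulr_ge0 ?powR_ge0// ltW.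
have c3 : A <= 4 * A by rewrite ler_peMl// ler1n.
split.
- by rewrite (le_trans b1)// -addrA lerDl addr_ge0.
- by rewrite (le_trans b2)// (le_trans c3)// -addrA lerDl addr_ge0.
- by rewrite (le_trans b3)// -addrA addrCA lerDl addr_ge0// mulr_ge0.
- apply: (le_trans (sob _ (fs j))); rewrite -[leLHS]add0r; apply: lerD; first by rewrite addr_ge0// mulr_ge0.
  rewrite ler_wpM2l ?(ltW Cs0)//; apply: ge0_ler_powR; rewrite ?nnegrE ?(ltW p0) ?mulr_ge0//.
Qed.

Lemma sobolev_sqr_diff (f : nat -> E -> R) :
  (forall j, C0infty (f j)) ->
  (forall i j, dir (fun x => f i x ^+ 2 - f j x ^+ 2) <=
        8 * ((i.+1%:R^-1) ^+ 2 + (j.+1%:R^-1) ^+ 2)) ->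
  forall e : R, 0 < e -> exists j0 : nat, forall i j, (j0 <= i)%N -> (j0 <= j)%N ->
    dir (fun x => f i x ^+ 2 - f j x ^+ 2) <= e.
Proof.
move=> fs fd e e0; have e16 : 0 < e / 16 by rewrite divr_gt0.
exists (Num.truncn ((e / 16)^-1)) => i j ji jj.
have small (a : nat) : (Num.truncn ((e / 16)^-1) <= a)%N -> (a.+1%:R^-1) ^+ 2 <= e / 16 :> R.
  move=> ha; apply: (@le_trans _ _ (a.+1%:R^-1)).
    by rewrite expr2 ler_piMl ?invr_ge0// invf_le1 ?ltr0n// ler1n.
  rewrite -(invrK (e / 16)) lef_pV2 ?posrE ?invr_gt0//.
  by rewrite (le_trans (ltW (truncnS_gt _)))// ler_nat ltnS.
apply: (le_trans (fd i j)).
have -> : e = 8 * (e / 16 + e / 16) by field.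
by rewrite ler_pM2l// lerD// small.
Qed.

End minimizing_sequence.

(** * Mazur's lemma and the limit of a minimizing sequence *)

Lemma mazur_arith (F : realFieldType) (ei ej ci cj l di dj d e : F) :
  0 < e -> ei <= e / 8 -> ej <= e / 8 -> ci <= d -> l - ci < e / 8 -> di <= ci + ei ->
  dj <= cj + ej -> cj <= l -> 2 * di + 2 * dj - 4 * d <= e.
Proof. lra. Qed.

Section mazur.
Context {R : realType} {N : nat}.
Local Notation E := ('rV[R]_N).
Local Notation mu := (@lebesgue_rV R N).
Local Notation intg f := (mu.-integrable setT (EFin \o f)).
Implicit Types (phi psi u v z : E -> R) (f : nat -> E -> R).

(* Dyadic convex combinations of the tail of a sequence: all that Mazur's lemma
   needs, since the parallelogram law only involves midpoints. *)
Inductive tail_mid f (j : nat) : (E -> R) -> Prop :=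
| tail_mid_base i : (j <= i)%N -> tail_mid f j (f i)
| tail_mid_half u v : tail_mid f j u -> tail_mid f j v ->
    tail_mid f j (fun x => 2^-1 * (u x + v x)).

Lemma tail_mid_C0infty f j u : (forall i, C0infty (f i)) -> tail_mid f j u -> C0infty u.
Proof.
by move=> fs; elim=> [i _|v w _ vs _ ws]; [exact: fs|apply: C0inftyZ; exact: C0inftyD].
Qed.

Lemma tail_mid_le f i j u : (i <= j)%N -> tail_mid f j u -> tail_mid f i u.
Proof.
move=> ij; elim=> [l jl|v w _ vs _ ws]; last exact: tail_mid_half.
by apply: tail_mid_base; exact: leq_trans jl.
Qed.

Lemma half_sum_dist (a b l e : R) : `|a - l| <= e -> `|b - l| <= e ->
  `|2^-1 * (a + b) - l| <= e.
Proof.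
move=> ae be; have -> : 2^-1 * (a + b) - l = 2^-1 * ((a - l) + (b - l)) by field.
rewrite normrM ger0_norm// mulrC ler_pdivrMr// (le_trans (ler_normD _ _))//.
by rewrite mulr_natr mulr2n lerD.
Qed.

(** Intervals around [l] are convex, so the combinations keep the pointwise limits of the sequence;
    this identifies the limit found by Mazur's lemma. *)
Lemma tail_mid_dist f j u x (l e : R) :
  (forall i, (j <= i)%N -> `|f i x - l| <= e) -> tail_mid f j u -> `|u x - l| <= e.
Proof. by move=> fl; elim=> [i /fl//|v w _ vl _ wl]; exact: half_sum_dist. Qed.

Lemma tail_mid_partial_dist f j u i x (l e : R) : (forall i, C0infty (f i)) ->
  (forall k, (j <= k)%N -> `|partial i (f k) x - l| <= e) -> tail_mid f j u ->
  `|partial i u x - l| <= e.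
Proof.
move=> fs fl; elim=> [k /fl//|v w vt vl wt wl].
have sv := C0infty_smooth (tail_mid_C0infty fs vt).
have sw := C0infty_smooth (tail_mid_C0infty fs wt).
by rewrite partialZ ?partialD//; [exact: half_sum_dist|exact: smoothD].
Qed.

Lemma Rint_parallelogram (f1 f2 f3 f4 : E -> R) : intg f1 -> intg f2 -> intg f3 ->
  (forall x, f4 x = 2 * f1 x + 2 * f2 x - 4 * f3 x) ->
  \int[mu]_x f4 x = 2 * \int[mu]_x f1 x + 2 * \int[mu]_x f2 x - 4 * \int[mu]_x f3 x.
Proof.
move=> i1 i2 i3 e; have j1 := intgZ 2 i1; have j2 := intgZ 2 i2; have j3 := intgZ 4 i3.
rewrite -(RintZ 2 i1) -(RintZ 2 i2) -(RintZ 4 i3) -(RintD j1 j2) -(RintB (intgD j1 j2) j3).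
exact: Rint_eq.
Qed.

Lemma dir_parallelogram u v : C0infty u -> C0infty v ->
  dir (fun x => u x - v x) =
  2 * dir u + 2 * dir v - 4 * dir (fun x => 2^-1 * (u x + v x)).
Proof.
move=> us vs; have su := C0infty_smooth us; have sv := C0infty_smooth vs.
have gu := intg_grad us; have gv := intg_grad vs.
have gw : intg (fun x => \sum_(i < N) partial i (fun x => 2^-1 * (u x + v x)) x ^+ 2).
  by apply: intg_grad; apply: C0inftyZ; exact: C0inftyD.
apply: (Rint_parallelogram gu gv gw) => x; rewrite !mulr_sumr -big_split/= -sumrB; apply: eq_bigr => i _.
rewrite partialB// partialZ; last exact: smoothD.
by rewrite partialD//; field.
Qed.

(** The infimum c_j of [dir] over combinations of the tail from j is nondecreasing and bounded by B,
    hence convergent. For i <= j the midpoint of y_i and y_j is still a combination of the tail from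
    i, so by the parallelogram law dir (y_i - y_j) is at most 2 dir y_i + 2 dir y_j - 4 c_i. The
    bound by dir (f_j) lets Fatou's lemma use y in place of f in the Dirichlet term. *)
Lemma mazur f (B : R) : (forall i, C0infty (f i)) -> (forall i, dir (f i) <= B) ->
  exists y : nat -> E -> R,
  [/\ forall j, tail_mid f j (y j), forall j, dir (y j) <= dir (f j) + j.+1%:R^-1 &
      forall e : R, 0 < e -> exists j0 : nat, forall i j, (j0 <= i)%N -> (j0 <= j)%N ->
        dir (fun x => y i x - y j x) <= e].
Proof.
move=> fs fB; pose A j := [set dir u | u in tail_mid f j]; pose c j := inf (A j).
have lbA j : has_lbound (A j) by exists 0 => _ [u _ <-]; exact: dir_ge0.
have hA j : has_inf (A j).
  by split=> //; exists (dir (f j)), (f j) => //; exact: tail_mid_base.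
have cle j u : tail_mid f j u -> c j <= dir u.
  by move=> ut; apply: ge_inf => //; exists u.
have j0 (j : nat) : 0 < j.+1%:R^-1 :> R by rewrite invr_gt0.
have step j : exists u, tail_mid f j u /\ dir u <= c j + j.+1%:R^-1.
  by have [_ [u ut <-] uc] := inf_adherent (j0 j) (hA j); exists u; split=> //; exact: ltW.
have [y yP] := choice step; exists y.
have yt j : tail_mid f j (y j) by case: (yP j).
have yc j : dir (y j) <= c j + j.+1%:R^-1 by case: (yP j).
split=> //.
  by move=> j; rewrite (le_trans (yc j))// lerD2r cle//; exact: tail_mid_base.
have c_nd : nondecreasing_seq c.
  move=> i j ij; apply: lb_le_inf; first by case: (hA j).
  by move=> _ [u ut <-]; apply: cle; exact: tail_mid_le ut.
have c_cvg : cvgn c.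
  apply: nondecreasing_is_cvgn => //; exists B => _ [j _ <-].
  by rewrite (le_trans (cle j _ (tail_mid_base f (leqnn j))))//.
move=> e e0; have e8 : 0 < e / 8 by rewrite divr_gt0.
pose l := limn c.
have cl j : c j <= l by exact: nondecreasing_cvgn_le.
have /cvgrPdist_lt/(_ (e / 8) e8)[m1 _ m1P] : c @ \oo --> l by exact: c_cvg.
pose m2 := Num.truncn ((e / 8)^-1).
exists (maxn m1 m2).
have key i j : (i <= j)%N -> (maxn m1 m2 <= i)%N -> (maxn m1 m2 <= j)%N ->
    dir (fun x => y i x - y j x) <= e.
  move=> ij mi mj; rewrite geq_max in mi; rewrite geq_max in mj.
  have /andP[m1i m2i] := mi; have /andP[m1j m2j] := mj.
  rewrite (dir_parallelogram (tail_mid_C0infty fs (yt i)) (tail_mid_C0infty fs (yt j))).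
  have small (a : nat) : (m2 <= a)%N -> a.+1%:R^-1 <= e / 8 :> R.
    move=> ha; rewrite -(invrK (e / 8)) lef_pV2 ?posrE ?invr_gt0//.
    by rewrite (le_trans (ltW (truncnS_gt _)))// ler_nat ltnS.
  have h1 := small _ m2i; have h2 := small _ m2j.
  have h3 : c i <= dir (fun x => 2^-1 * (y i x + y j x)).
    by apply: cle; apply: tail_mid_half => //; exact: tail_mid_le (yt j).
  have h4 : l - c i < e / 8.
    by have := m1P i m1i; rewrite /= ger0_norm// subr_ge0.
  have h5 := yc i; have h6 := yc j; have h7 := cl j.
  move: e0 h1 h2 h3 h4 h5 h6 h7; exact: mazur_arith.
move=> i j mi mj; have [ij|/ltnW ji] := leqP i j; first exact: key.
have -> : dir (fun x => y i x - y j x) = dir (fun x => y j x - y i x); last exact: key.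
apply: Rint_eq => x; apply: eq_bigr => a _.
have si := C0infty_smooth (tail_mid_C0infty fs (yt i)).
have sj := C0infty_smooth (tail_mid_C0infty fs (yt j)).
by rewrite !partialB// -sqrrN opprB.
Qed.

End mazur.

(** * Limits with a majorant, and weak derivatives *)

Section dominated_limits.
Context {R : realType} {N : nat}.
Local Notation E := ('rV[R]_N).
Local Notation mu := (@lebesgue_rV R N).
Local Notation intg f := (mu.-integrable setT (EFin \o f)).
Implicit Types (phi psi u v g : E -> R) (f : nat -> E -> R).

(** Convergence in L^r as it holds along a fast subsequence: almost everywhere, with a single
    integrable majorant of all the errors. *)
Definition dom_cvg (r : R) f u : Prop :=
  [/\ measurable_fun setT u, {ae mu, forall x, f ^~ x @ \oo --> u x} &
      exists2 S, intg S & (forall x, 0 <= S x) /\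
        {ae mu, forall x, forall n, `|f n x - u x| `^ r <= S x}].

Lemma dom_cvg_subseq r f u (g : nat -> nat) : (forall n, (n <= g n)%N) ->
  dom_cvg r f u -> dom_cvg r (f \o g) u.
Proof.
move=> gn [mu_ fu [S Si [S0 fS]]]; split=> //.
  by apply: filterS fu => x; exact: (@cvg_subseq _ (f ^~ x)).
by exists S => //; split=> //; apply: filterS fS => x fx n; exact: fx.
Qed.

Lemma dom_cvg_ae r f u v : measurable_fun setT v -> {ae mu, forall x, u x = v x} ->
  dom_cvg r f u -> dom_cvg r f v.
Proof.
move=> mv uv [_ fu [S Si [S0 fS]]]; split=> //.
  by apply: filterS2 fu uv => x + <-.
by exists S => //; split=> //; apply: filterS2 fS uv => x fx <-.
Qed.

Lemma dom_cvgD r f u phi : measurable_fun setT phi -> dom_cvg r f u ->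
  dom_cvg r (fun n x => f n x + phi x) (fun x => u x + phi x).
Proof.
move=> mphi [mu_ fu [S Si [S0 fS]]]; split.
- exact: measurable_funD.
- by apply: filterS fu => x fx; apply: cvgD => //; exact: cvg_cst.
exists S => //; split=> //; apply: filterS fS => x fx n.
by rewrite opprD addrACA subrr addr0.
Qed.

Lemma ler_powR1D (a r : R) : 1 <= r -> 0 <= a -> a <= 1 + a `^ r.
Proof.
move=> r1 a0; have [a1|/ltW a1] := leP a 1; first by rewrite (le_trans a1)// lerDl powR_ge0.
by rewrite (le_trans (le1r_powR a1 r1))// lerDr.
Qed.

Lemma dom_cvg_Rint r f u : 0 < r -> (forall n, measurable_fun setT (f n)) ->
  dom_cvg r f u -> (\int[mu]_x (`|f n x - u x| `^ r)) @[n --> \oo] --> 0.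
Proof.
move=> r0 mf [mu_ fu [S Si [S0 fS]]].
have [|||||_ _] := @Rint_dominated _ _ _ mu (fun n x => `|f n x - u x| `^ r) (fun=> 0) S.
- move=> n; apply: (measurableT_comp (measurable_powR _)).
  by apply: measurableT_comp => //; exact: measurable_funB.
- exact: measurable_cst.
- apply: filterS fu => x fx.
  have d0 : (fun n => f n x - u x) @ \oo --> 0.
    by rewrite -(subrr (u x)); apply: cvgB => //; exact: cvg_cst.
  have := cvg_comp _ _ d0 (@continuous_normr_powR R r r0 0).
  by rewrite normr0 powR0// gt_eqF.
- exact: Si.
- by apply: filterS fS => x fx n; rewrite ger0_norm ?powR_ge0.
by rewrite /Rintegral integral0.
Qed.

Lemma intg_le_ae u g : measurable_fun setT u -> intg g ->
  {ae mu, forall x, `|u x| <= g x} -> intg u.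
Proof.
move=> mu_ gi ug; have mg := intg_measurable gi.
have /integrableP[_ goo] := gi.
apply/integrableP; split; first exact/measurable_EFinP.
apply: le_lt_trans goo; apply: ae_ge0_le_integral => //.
- by apply/measurable_EFinP; exact: measurableT_comp.
- by apply/measurable_EFinP; exact: measurableT_comp.
by apply: filterS ug => x ux _; rewrite /= lee_fin (le_trans ux)// ler_norm.
Qed.

Section test_sequence.
Variables (r : R) (f : nat -> E -> R) (u : E -> R).
Hypotheses (fs : forall n, C0infty (f n)) (fu : dom_cvg r f u).

(** Since |f_n - u| is at most 1 + |f_n - u|^r, the majorant for the exponent [r] serves for the
    exponent 1 once multiplied by a bounded function of bounded support. *)
Lemma dom_cvg_test phi : 1 <= r -> C0infty phi -> intg (fun x => u x * phi x) /\
  (\int[mu]_x (f n x * phi x)) @[n --> \oo] --> \int[mu]_x (u x * phi x).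
Proof.
move=> r1 phis; have [mu_ cfu [S Si [S0 fS]]] := fu.
have [C C0 phiC] := C0infty_bounded phis.
have phii := C0infty_integrable phis.
have [|||||||ui _ cv] := @Rint_cvg_young _ _ _ mu (fun n x => f n x * phi x) (fun _ _ => 0)
  (fun x => u x * phi x) 0.
- by move=> n; apply: C0infty_integrable; exact: C0inftyM.
- by apply: measurable_funM => //; exact: C0infty_measurable.
- by apply: filterS cfu => x fx; apply: cvgM => //; exact: cvg_cst.
- by move=> n; exact: intg0.
- by [].
- by move=> n; rewrite /Rintegral integral0.
- move=> e e0; exists (fun x => `|phi x| + C * S x).
    by apply: intgD; [exact: integrable_norm|exact: intgZ].
  apply: filterS fS => x fx n; rewrite mulr0 addr0 -mulrBl normrM.
  apply: (le_trans (ler_wpM2r _ (ler_powR1D r1 (normr_ge0 _)))) => //.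
  rewrite mulrDl mul1r lerD2l mulrC; apply: ler_pM => //; exact: powR_ge0.
by [].
Qed.

Lemma dom_cvg_L1loc : 1 <= r -> L1loc u.
Proof.
move=> r1; have [mu_ cfu [S Si [S0 fS]]] := fu; split=> // K cK.
have [M M0 KM] := compact_cube cK.
have mK : measurable K.
  rewrite -(setCK K); apply: measurableC; apply: open_measurable_rV; apply: closed_openC.
  by apply: compact_closed => //; exact: norm_hausdorff.
have i1 : intg (\1_(@cube R N M) : E -> R).
  apply: (@integrable_bounded _ _ _ M 1).
  - by apply: measurable_indic; exact: measurable_cube.
  - by move=> x; rewrite indicE; case: (_ \in _); rewrite ?normr1 ?normr0.
  - by move=> x xM; rewrite indicE memNset.
have : intg (fun x => u x * \1_(cube M) x).
  apply: (@intg_le_ae _ (fun x => `|f 0%N x| + (\1_(cube M) x + S x))).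
  - by apply: measurable_funM => //; apply: measurable_indic; exact: measurable_cube.
  - by apply: intgD; [apply: integrable_norm; exact: C0infty_integrable|exact: intgD].
  apply: filterS fS => x /(_ 0%N) fx; rewrite normrM indicE.
  case: (x \in _); last by rewrite normr0 mulr0 addr_ge0 ?add0r.
  rewrite normr1 mulr1 -[X in `|X|](subrK (f 0%N x)) addrC (le_trans (ler_normD _ _))//.
  by rewrite lerD2l distrC (le_trans (ler_powR1D r1 (normr_ge0 _)))// lerD2l.
move=> /integrableP[mu1 uoo]; apply: le_lt_trans uoo.
apply: (@le_trans _ _ (\int[mu]_(x in K) `|(u x * \1_(cube M) x)%:E|)%E).
  rewrite le_eqVlt; apply/orP; left; apply/eqP; apply: eq_integral => x; rewrite inE => /KM xM.
  by rewrite indicE mem_set// mulr1.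
apply: ge0_subset_integral => //.
by apply: measurableT_comp => //; exact: mu1.
Qed.

Lemma dom_cvg_powR_intg : 0 < r -> intg (fun x => `|u x| `^ r).
Proof.
move=> r0; have [mu_ cfu [S Si [S0 fS]]] := fu.
apply: (@intg_le_ae _ (fun x => 2 `^ r * (`|f 0%N x| `^ r + S x))).
- by apply: (measurableT_comp (measurable_powR _)); exact: measurableT_comp.
- by apply: intgZ; apply: intgD => //; exact: C0infty_powR_intg.
apply: filterS fS => x /(_ 0%N) fx; rewrite ger0_norm ?powR_ge0//.
apply: (@le_trans _ _ (2 `^ r * (`|f 0%N x| `^ r + `|f 0%N x - u x| `^ r))).
  apply: le_trans (powR_D_le (normr_ge0 _) (normr_ge0 _) r0).
  apply: ge0_ler_powR; rewrite ?nnegrE ?addr_ge0 ?(ltW r0)//.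
  by rewrite -[X in `|X|](subrK (f 0%N x)) addrC (le_trans (ler_normD _ _))// [X in _ + X]distrC.
by rewrite ler_wpM2l ?powR_ge0// lerD2l.
Qed.

End test_sequence.

Lemma dom_cvg_weak_partial (r : R) i f u g : 1 <= r -> (forall n, C0infty (f n)) ->
  dom_cvg r f u -> dom_cvg 2 (fun n => partial i (f n)) g -> is_weak_partial i u g.
Proof.
move=> r1 fs fu fg; have r2 : (1 : R) <= 2 by rewrite ler1n.
have gs n : C0infty (partial i (f n)) by exact: C0infty_partial.
split; [exact: dom_cvg_L1loc fs fu r1|exact: dom_cvg_L1loc gs fg r2|] => phi phis.
have dphis : C0infty (partial i phi) by exact: C0infty_partial.
have [i1 c1] := dom_cvg_test fs fu r1 dphis.
have [i2 c2] := dom_cvg_test gs fg r2 phis.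
rewrite -(Rintegral_EFin i1) -(Rintegral_EFin i2) -EFinN; congr EFin.
have c3 : (\int[mu]_x (f n x * partial i phi x)) @[n --> \oo] -->
    - \int[mu]_x (g x * phi x).
  under eq_fun do rewrite (integration_by_parts_rV i (fs _) phis).
  exact: cvgN.
exact: (cvg_unique _ c1 c3).
Qed.

End dominated_limits.

Section dir_cauchy_limit.
Context {R : realType} {n : nat}.
Local Notation N := n.+3.
Local Notation E := ('rV[R]_N).
Local Notation mu := (@lebesgue_rV R N).
Local Notation intg f := (mu.-integrable setT (EFin \o f)).
Local Notation p := (@crit_exp R N).

Lemma sobolev_small (e : R) : 0 < e -> exists2 d : R, 0 < d &
  forall phi : E -> R, C0infty phi -> dir phi <= d ->
    \int[mu]_x (`|phi x| `^ p) <= e.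
Proof.
move=> e0; have [C C0 HC] := @sobolev R n.
have p2 : 0 < p / 2 by rewrite divr_gt0// (lt_trans _ (@crit_exp_gt2 R n)).
move: (p / 2) p2 HC => r r0 HC.
exists ((e / C) `^ r^-1); first by apply: powR_gt0; exact: divr_gt0.
move=> phi phis /(ge0_ler_powR (ltW r0)); rewrite !nnegrE dir_ge0 powR_ge0 => /(_ isT isT).
rewrite -powRrM mulVf ?gt_eqF// powRr1 ?(divr_ge0 (ltW e0) (ltW C0))//.
by rewrite ler_pdivlMr// mulrC; apply: le_trans; exact: HC.
Qed.

(** Completeness of D^{1,2}: one subsequence is fast both in L^p, by Sobolev's inequality, and for
    every partial derivative in L^2, so the majorants exist for all of them at once. *)
Lemma dir_cauchy_limit (f : nat -> E -> R) : (forall j, C0infty (f j)) ->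
  (forall e : R, 0 < e -> exists j0 : nat, forall i j, (j0 <= i)%N -> (j0 <= j)%N ->
    dir (fun x => f i x - f j x) <= e) ->
  exists2 g : nat -> nat, (forall j, (g j < g j.+1)%N) &
    exists2 w : E -> R, dom_cvg p (f \o g) w &
    exists D : 'I_N -> E -> R, forall i, dom_cvg 2 (fun j => partial i (f (g j))) (D i).
Proof.
move=> fs fd; have h0 (j : nat) : 0 < 2^-1 ^+ j :> R by rewrite exprn_gt0.
have p0 : 0 < p by rewrite (lt_trans _ (@crit_exp_gt2 R n)).
have fij i j : C0infty (fun x => f i x - f j x) by exact: C0inftyB.
pose a (r : R) j : R := (2^-1 ^+ j) * (2^-1 ^+ j) `^ r.
have a0 r j : 0 < a r j by rewrite mulr_gt0 ?powR_gt0.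
pose P j m := forall i l, (m <= i)%N -> (m <= l)%N ->
  \int[mu]_x (`|f i x - f l x| `^ p) <= a p j /\ dir (fun x => f i x - f l x) <= a 2 j.
have [j|j m m' mm' H i l mi ml|g gS gP] := @select_subseq P.
- have [d d0 dP] := sobolev_small (a0 p j).
  have [|m mP] := fd (Num.min d (a 2 j)); first by rewrite lt_min d0 a0.
  exists m => i l mi ml; have := mP i l mi ml; rewrite le_min => /andP[m1 m2].
  by split; [exact: (dP _ (fij i l))|].
- by apply: H; exact: (leq_trans mm').
exists g => //.
have [||w [S Si [mw S0 fw fS]]] := @riesz_fischer_fast _ _ _ mu (fun j => f (g j)) p p0.
- by move=> j; exact: C0infty_measurable.
- move=> j; rewrite -Rintegral_EFin; last exact: C0infty_powR_intg (fij _ _).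
  by rewrite lee_fin; have [] := gP j (g j.+1) (g j) (ltnW (gS j)) (leqnn _).
exists w; first by split=> //; exists S.
have /choice[D DP] : forall i : 'I_N, exists D, dom_cvg 2 (fun j => partial i (f (g j))) D.
  move=> i; have r0 : 0 < 2 :> R by [].
  have [||D [T Ti [mD T0 fD fT]]] := @riesz_fischer_fast _ _ _ mu (fun j => partial i (f (g j))) 2 r0.
  - by move=> j; apply: C0infty_measurable; exact: C0infty_partial.
  - move=> j; have dE x : `|partial i (f (g j.+1)) x - partial i (f (g j)) x| `^ 2 =
      (partial i (fun x => f (g j.+1) x - f (g j) x) x) ^+ 2.
      by rewrite (partialB i (C0infty_smooth (fs _)) (C0infty_smooth (fs _))) powR_mulrn// real_normK ?num_real.
    under eq_integral do rewrite dE.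
    rewrite -Rintegral_EFin; last by apply: C0infty_intg_sqr; exact: C0infty_partial (fij _ _).
    rewrite lee_fin (le_trans (dir_partial i (fij _ _)))//.
    by have [] := gP j (g j.+1) (g j) (ltnW (gS j)) (leqnn _).
  by exists D; split=> //; exists T.
by exists D.
Qed.

End dir_cauchy_limit.

Lemma mul2_young (F : realFieldType) (a b e : F) : 0 < e ->
  `|2 * a * b| <= e * b ^+ 2 + e^-1 * a ^+ 2.
Proof.
move=> e0; rewrite !normrM normr_nat -(real_normK (num_real b)) -(real_normK (num_real a)).
move: `|a| `|b| => {}a {}b.
have := sqr_ge0 (e * b - a); rewrite -(pmulr_rge0 _ (_ : 0 < e^-1)) ?invr_gt0// => H.
rewrite -subr_ge0; apply: le_trans H _; rewrite le_eqVlt; apply/orP; left; apply/eqP.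
by field; rewrite gt_eqF.
Qed.

Section vanishing_gradient.
Context {R : realType} {N : nat}.
Local Notation E := ('rV[R]_N).
Local Notation mu := (@lebesgue_rV R N).
Local Notation intg f := (mu.-integrable setT (EFin \o f)).
Implicit Types (f : nat -> E -> R) (u w D : E -> R).

Lemma dom_cvg_cube (r : R) f u M A : 1 <= r -> (forall j, C0infty (f j)) ->
  dom_cvg r f u -> measurable A -> A `<=` cube M ->
  [/\ intg (fun x => u x * \1_A x), forall j, intg (fun x => `|f j x - u x| * \1_A x) &
   (\int[mu]_x (`|f j x - u x| * \1_A x)) @[j --> \oo] --> 0].
Proof.
move=> r1 fs fu mA AM; have r0 : 0 < r by exact: lt_le_trans r1.
have uA : intg (fun x => u x * \1_A x).
  have := intg_indic mA (L1loc_intg_cube M (dom_cvg_L1loc fs fu r1)).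
  apply: eq_intg => x; rewrite !indicE; have [/set_mem/AM xM|xA] := boolP (x \in A).
    by rewrite mem_set// !mulr1.
  by rewrite !mulr0.
have fA j : intg (fun x => `|f j x - u x| * \1_A x).
  have : intg (fun x => f j x * \1_A x - u x * \1_A x).
    by apply: intgB => //; apply: intg_indic => //; exact: C0infty_integrable.
  move=> /integrable_norm; apply: eq_intg => x /=.
  by rewrite -mulrBl normrM [X in _ * X]ger0_norm.
have [mu_ cfu [S Si [S0 fS]]] := fu.
have iA : intg (\1_A : E -> R).
  apply: (@integrable_bounded _ _ _ M 1); first exact: measurable_indic.
    by move=> x; rewrite indicE; case: (_ \in _); rewrite ?normr1 ?normr0.
  by move=> x xM; rewrite indicE memNset//; apply: contra_not xM => /AM.
split=> //.
have [|||||_ _] := @Rint_dominated _ _ _ mu (fun j x => `|f j x - u x| * \1_A x) (fun=> 0)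
  (fun x => \1_A x + S x).
- by move=> j; exact: intg_measurable (fA j).
- exact: measurable_cst.
- apply: filterS cfu => x fx; rewrite -[X in _ --> X](mul0r (\1_A x : R)).
  apply: cvgM; last exact: cvg_cst.
  rewrite -(normr0 R) -(subrr (u x)); apply: cvg_norm; apply: cvgB => //; exact: cvg_cst.
- exact: intgD.
- apply: filterS fS => x fx j; rewrite normrM normr_id indicE.
  case: (x \in A); last by rewrite normr0 mulr0 addr_ge0.
  by rewrite normr1 mulr1 (le_trans (ler_powR1D r1 (normr_ge0 _)))// lerD2l.
by rewrite /Rintegral integral0.
Qed.

(* |2 f d_i f| <= e (d_i f)^2 + f^2 / e, and f^2 tends to 0 where w = 0. *)
Lemma vanishing_gradient (r B : R) i f w D : 1 <= r -> (forall j, C0infty (f j)) ->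
  (forall j, dir (f j) <= B) -> dom_cvg r (fun j x => f j x ^+ 2) w ->
  dom_cvg 2 (fun j x => 2 * f j x * partial i (f j) x) D ->
  {ae mu, forall x, w x = 0 -> D x = 0}.
Proof.
move=> r1 fs fB fw fD.
have r2 : (1 : R) <= 2 by rewrite ler1n.
have mw : measurable_fun setT w by case: fw.
have sqs j : C0infty (fun x => f j x ^+ 2) by exact: C0inftyM.
have dqs j : C0infty (fun x => 2 * f j x * partial i (f j) x).
  by apply: C0inftyM; [exact: C0inftyZ|exact: C0infty_partial].
have pi j : intg (fun x => partial i (f j) x ^+ 2).
  by apply: C0infty_intg_sqr; exact: C0infty_partial.
pose A (M : nat) := (w @^-1` [set 0]) `&` cube M%:R.
have mA M : measurable (A M).
  by apply: measurableI; [rewrite -[X in measurable X]setTI; exact: mw|exact: measurable_cube].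
suff AM M : {ae mu, forall x, D x * \1_(A M) x = 0}.
  have /ae_foralln : forall M, {ae mu, forall x, D x * \1_(A M) x = 0} by [].
  apply: filterS => x H wx.
  have [M _ xM] : exists2 M : nat, True & cube M%:R x.
    have [M _ xM] := compact_cube (@compact_set1 E x).
    exists (Num.truncn M).+1 => //; apply: (@cube_sub _ _ M); last exact: xM.
    by rewrite ltW// truncnS_gt.
  by have := H M; rewrite indicE mem_set ?mulr1.
have [Di Ddi Dc] := dom_cvg_cube r2 dqs fD (mA M) (@subIsetr _ _ _).
have [_ wdi wc] := dom_cvg_cube r1 sqs fw (mA M) (@subIsetr _ _ _).
have Dai : intg (fun x => `|D x| * \1_(A M) x).
  move: Di => /integrable_norm; apply: eq_intg => x /=.
  by rewrite normrM [X in _ * X]ger0_norm.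
have B0 : 0 <= B by rewrite (le_trans _ (fB 0%N))// dir_ge0.
have D0 : \int[mu]_x (`|D x| * \1_(A M) x) = 0.
  apply/eqP; rewrite eq_le Rint_ge0 ?andbT; last by move=> x; rewrite mulr_ge0.
  apply/ler_addgt0Pr => e e0; rewrite add0r.
  (* The weight of the derivative in Young's inequality; as the Dirichlet integrals are at most B,
     this part contributes at most e. *)
  pose d := e / (B + 1); have d0 : 0 < d by rewrite divr_gt0// ltr_wpDl.
  have db : d * B <= e.
    by rewrite /d -mulrA ler_piMr ?(ltW e0)// mulrC ler_pdivrMr ?mul1r ?lerDl// ltr_wpDl.
  have key j : \int[mu]_x (`|D x| * \1_(A M) x) <=
      \int[mu]_x (`|2 * f j x * partial i (f j) x - D x| * \1_(A M) x)
      + d^-1 * \int[mu]_x (`|f j x ^+ 2 - w x| * \1_(A M) x) + e.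
    have i1 := intgZ d^-1 (wdi j); have i2 := intgZ d (pi j).
    rewrite -(RintZ d^-1 (wdi j)) -(RintD (Ddi j) i1).
    apply: (@le_trans _ _ (\int[mu]_x (`|2 * f j x * partial i (f j) x - D x| * \1_(A M) x
      + d^-1 * (`|f j x ^+ 2 - w x| * \1_(A M) x)) + d * \int[mu]_x (partial i (f j) x ^+ 2))).
      rewrite -(RintZ d (pi j)) -(RintD (intgD (Ddi j) i1) i2).
      apply: Rint_le => //; first by apply: intgD => //; exact: intgD.
      move=> x; rewrite indicE; have [/set_mem[/= -> _]|xA] := boolP (x \in A M); last first.
        by rewrite !mulr0 !add0r mulr_ge0 ?sqr_ge0 ?ltW.
      rewrite subr0 !mulr1 (ger0_norm (sqr_ge0 _)) -addrA [X in _ + X]addrC.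
      apply: (@le_trans _ _ (`|2 * f j x * partial i (f j) x - D x| + `|2 * f j x * partial i (f j) x|)).
        by rewrite distrC -[X in `|X| <= _](subrK (2 * f j x * partial i (f j) x)) ler_normD.
      by rewrite lerD2l mul2_young.
    rewrite lerD2l (le_trans _ db)// ler_wpM2l ?(ltW d0)//.
    by rewrite (le_trans (dir_partial i (fs j))).
  have cv : (\int[mu]_x (`|2 * f j x * partial i (f j) x - D x| * \1_(A M) x)
      + d^-1 * \int[mu]_x (`|f j x ^+ 2 - w x| * \1_(A M) x) + e) @[j --> \oo] --> 0 + d^-1 * 0 + e.
    apply: cvgD; last exact: cvg_cst.
    by apply: cvgD => //; apply: cvgM => //; exact: cvg_cst.
  rewrite mulr0 !add0r in cv.
  by rewrite -(cvg_lim _ cv)//; apply: limr_ge; [exact: cvgP cv|exact: nearW].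
have mDA : measurable_fun setT (EFin \o (fun x => D x * \1_(A M) x)) by case/integrableP: Di.
have [/(_ _)H _] := ae_eq_integral_abs mu measurableT mDA.
have : ae_eq mu setT (EFin \o (fun x => D x * \1_(A M) x)) (cst 0%E).
  apply: H; under eq_integral => x _ do rewrite /= normrM [X in _ * X]ger0_norm//.
  by rewrite -Rintegral_EFin// D0.
by apply: filterS => x /(_ Logic.I)[].
Qed.

End vanishing_gradient.

Section limit_data.
Context {R : realType} {n : nat}.
Local Notation N := n.+3.
Local Notation E := ('rV[R]_N).
Local Notation mu := (@lebesgue_rV R N).
Local Notation intg f := (mu.-integrable setT (EFin \o f)).
Local Notation p := (@crit_exp R N).

(* f is minimizing for the energy, but only the gradients of f^2 converge
   strongly; y consists of convex combinations of tails of f and converges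
   strongly in D^{1,2}. *)
Record limit_data (q s : R) (k h : E -> R) (m : R) (f y : nat -> E -> R) (u : E -> R)
    (g : 'I_N -> E -> R) : Prop := LimitData {
  ld_f : forall j, C0infty (f j);
  ld_f0 : forall j x, 0 <= f j x;
  ld_min : forall psi, C0infty psi -> m <= energy q s k h psi;
  ld_energy : forall j, energy q s k h (f j) <= m + (j.+1%:R^-1) ^+ 2;
  ld_y : forall j, C0infty (y j);
  ld_dir : forall j, dir (y j) <= dir (f j) + j.+1%:R^-1;
  ld_cauchy : forall e : R, 0 < e -> exists j0 : nat, forall i j, (j0 <= i)%N -> (j0 <= j)%N ->
    dir (fun x => y i x - y j x) <= e;
  ld_u0 : forall x, 0 <= u x;
  ld_cvg : {ae mu, forall x, f ^~ x @ \oo --> u x};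
  ld_sqr : dom_cvg p (fun j x => f j x ^+ 2) (fun x => u x ^+ 2);
  ld_dsqr : forall i, dom_cvg 2 (fun j x => 2 * f j x * partial i (f j) x)
                                (fun x => 2 * u x * g i x);
  ld_dcvg : forall i, {ae mu, forall x, u x != 0 ->
    (fun j => partial i (f j) x) @ \oo --> g i x};
  ld_strong : dom_cvg p y u;
  ld_dstrong : forall i, dom_cvg 2 (fun j => partial i (y j)) (g i) }.

Variables (q s : R) (k h : E -> R) (Mk Mh : R).
Hypotheses (q1 : 1 < q) (q2 : q < 2) (s2 : 2 < s).
Hypotheses (mk : measurable_fun setT k) (k0 : forall x, 0 <= k x)
  (kM : forall x, k x <= Mk) (ki : intg (fun x => k x `^ (p / (p - q)))).
Hypotheses (mh : measurable_fun setT h) (h0 : forall x, 0 <= h x)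
  (hM : forall x, h x <= Mh).

(** Two descriptions of the gradient are reconciled. Strong convergence of d(f^2) gives df the limit
    D / (2 u) where u is nonzero, and convex combinations inherit it; their strong limit [g] agrees
    with it there and also covers the set u = 0. *)
Lemma limit_dataP : exists m f y u g, limit_data q s k h m f y u g.
Proof.
have p1 : 1 <= p by rewrite ltW// (lt_trans _ (@crit_exp_gt2 R n))// ltr1n.
have [m [f0 [fs0 f00 min0 en0 d0]]] := minimizing_sequence q1 q2 s2 mk k0 kM ki mh h0 hM.
have [B B0 fB] := minimizing_bound q1 q2 s2 mk k0 kM ki h0 fs0 en0.
have sqs j : C0infty (fun x => f0 j x ^+ 2) by exact: C0inftyM.
have [g1 g1S [w cw [D cD]]] := dir_cauchy_limit sqs (sobolev_sqr_diff fs0 d0).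
pose f1 := f0 \o g1.
have fs1 j : C0infty (f1 j) by exact: fs0.
(* The f_j are nonnegative, hence roots of their squares, and converge wherever the squares do. *)
pose u x := Num.sqrt (w x).
have mw : measurable_fun setT w by case: cw.
have mu_ : measurable_fun setT u.
  apply: (@measurableT_comp _ _ _ _ _ _ (@Num.sqrt R)) => //.
  by apply: continuous_measurable_fun; exact: sqrt_continuous.
have u1 : {ae mu, forall x, f1 ^~ x @ \oo --> u x}.
  case: cw => _ + _; apply: filterS => x wx.
  rewrite [X in X @ \oo --> _](_ : _ = Num.sqrt \o (fun j => f0 (g1 j) x ^+ 2)).
    exact: cvg_comp wx (@sqrt_continuous R (w x)).
  by apply/funext => j /=; rewrite sqrtr_sqr ger0_norm.
have w0 : {ae mu, forall x, w x = u x ^+ 2}.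
  case: cw => _ + _; apply: filterS => x wx.
  rewrite /u sqr_sqrtr// -(cvg_lim _ wx)//.
  by apply: limr_ge; [exact: cvgP wx|apply: nearW => j; exact: sqr_ge0].
have cu : dom_cvg p (fun j x => f1 j x ^+ 2) (fun x => u x ^+ 2).
  by apply: (dom_cvg_ae _ w0 cw); exact: measurable_funX.
have dE i j : partial i (fun x => f1 j x ^+ 2) = fun x => 2 * f1 j x * partial i (f1 j) x.
  rewrite (_ : (fun x => _) = (fun x => f1 j x * f1 j x)); last by apply/funext => x.
  rewrite (partialM i (C0infty_smooth (fs1 j)) (C0infty_smooth (fs1 j))).
  by apply/funext => x; rewrite -mulrA mulr_natl mulr2n.
have cD1 i : dom_cvg 2 (fun j x => 2 * f1 j x * partial i (f1 j) x) (D i).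
  by rewrite (_ : (fun j x => _) = (fun j => partial i (fun x => f1 j x ^+ 2)))//;
     apply/funext => j; rewrite dE.
(* Without this, D = 2 u g could fail on the set u = 0. *)
have vD i : {ae mu, forall x, u x = 0 -> D i x = 0}.
  have B1 j : dir (f1 j) <= B by have [] := fB (g1 j).
  apply: filterS (vanishing_gradient p1 fs1 B1 cu (cD1 i)) => x + ux.
  by apply; rewrite ux expr0n.
(* Where u = 0 the quotient is the default 0; [G] is compared with other functions only where u is
   nonzero. *)
pose G i x := D i x / (2 * u x).
have cG i : {ae mu, forall x, u x != 0 -> (fun j => partial i (f1 j) x) @ \oo --> G i x}.
  have [_ cDi _] := cD1 i; apply: filterS2 u1 cDi => x ux Dx ux0.
  have u2 : 2 * u x != 0 by rewrite mulf_neq0// pnatr_eq0.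
  have c1 : (fun j => 2 * f1 j x) @ \oo --> 2 * u x by apply: cvgM => //; exact: cvg_cst.
  have c2 : (fun j => 2 * f1 j x * partial i (f1 j) x * (2 * f1 j x)^-1) @ \oo --> G i x.
    by apply: cvgM => //; exact: cvgV.
  apply: cvg_trans c2; apply: near_eq_cvg.
  have : \forall j \near \oo, 2 * f1 j x != 0 by exact: cvgr_neq0 c1 u2.
  by apply: filterS => j j0 /=; rewrite mulrAC divff// mul1r.
have [y0 [yt yd yc]] := mazur fs1 (fun j => match fB (g1 j) with And4 a _ _ _ => a end).
have ys0 j : C0infty (y0 j) by exact: tail_mid_C0infty fs1 (yt j).
have yu : {ae mu, forall x, y0 ^~ x @ \oo --> u x}.
  apply: filterS u1 => x ux; apply/cvgrPdist_le => e e0.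
  have /cvgrPdist_le/(_ e e0)[j0 _ jP] := ux; exists j0 => // j /= jj.
  rewrite distrC; apply: (tail_mid_dist (f := f1) (j := j)) (yt j) => i ji.
  by rewrite distrC jP//= (leq_trans jj).
have yG i : {ae mu, forall x, u x != 0 -> (fun j => partial i (y0 j) x) @ \oo --> G i x}.
  apply: filterS (cG i) => x + ux0 => /(_ ux0) ux; apply/cvgrPdist_le => e e0.
  have /cvgrPdist_le/(_ e e0)[j0 _ jP] := ux; exists j0 => // j /= jj.
  rewrite distrC; apply: (tail_mid_partial_dist fs1) (yt j) => l jl.
  by rewrite distrC jP//= (leq_trans jj).
(* A second extraction; its indices [g2] are applied to f as well, so that f and y keep the same
   index in the energy estimates. *)
have [g2 g2S [v cv [g cg]]] := dir_cauchy_limit ys0 yc.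
have g2j := subseq_ge g2S; have g1j := subseq_ge g1S.
have gG i : {ae mu, forall x, u x != 0 -> G i x = g i x}.
  have [_ c1 _] := cg i; apply: filterS2 (yG i) c1 => x + c1x ux0 => /(_ ux0) c2x.
  have c3 := @cvg_subseq _ (fun j => partial i (y0 j) x) _ g2 g2j c2x.
  exact: cvg_unique c3 c1x.
have small (j : nat) : (j <= g1 (g2 j))%N by exact: leq_trans (g2j j) (g1j _).
have inv_le (a b : nat) : (a <= b)%N -> b.+1%:R^-1 <= a.+1%:R^-1 :> R.
  by move=> ab; rewrite lef_pV2 ?posrE ?ltr0n// ler_nat ltnS.
exists m, (f1 \o g2), (y0 \o g2), u, g; split.
- by move=> j; exact: fs1.
- by move=> j x; exact: f00.
- exact: min0.
- move=> j; apply: (le_trans (en0 _)); rewrite lerD2l.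
  by rewrite ler_sqr ?nnegrE ?invr_ge0// inv_le.
- by move=> j; exact: ys0.
- by move=> j; apply: (le_trans (yd _)); rewrite lerD2l inv_le.
- move=> e e0; have [j0 j0P] := yc e e0; exists j0 => i j ij jj.
  by apply: j0P; [exact: leq_trans ij (g2j _)|exact: leq_trans jj (g2j _)].
- by move=> x; exact: sqrtr_ge0.
- by apply: filterS u1 => x; exact: (@cvg_subseq _ (f1 ^~ x)).
- exact: (dom_cvg_subseq g2j cu).
- move=> i; apply: (dom_cvg_ae _ _ (dom_cvg_subseq g2j (cD1 i))).
    by apply: measurable_funM; [exact: measurable_funM|case: (cg i)].
  apply: filterS2 (vD i) (gG i) => x ux0 uxn; have [u0|un] := eqVneq (u x) 0.
    by rewrite ux0// u0 mulr0 mul0r.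
  by rewrite -uxn// /G mulrC divfK// mulf_neq0// pnatr_eq0.
- move=> i; apply: filterS2 (cG i) (gG i) => x + + ux0 => /(_ ux0) c1 /(_ ux0) <-.
  exact: (@cvg_subseq _ (fun j => partial i (f1 j) x)).
- apply: (dom_cvg_ae _ _ cv) => //.
  case: cv => _ c1 _; apply: filterS2 yu c1 => x c2x c1x.
  exact: cvg_unique c1x (@cvg_subseq _ (y0 ^~ x) _ g2 g2j c2x).
- exact: cg.
Qed.

End limit_data.

(** * Uniqueness of weak derivatives, and norms in the sense of the library *)

Section weak_partial_uniqueness.
Context {R : realType} {N : nat}.
Local Notation E := ('rV[R]_N).
Local Notation mu := (@lebesgue_rV R N).
Implicit Types (u v g : E -> R).

Lemma L1locB u v : L1loc u -> L1loc v -> L1loc (fun x => u x - v x).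
Proof.
move=> [mu_ uK] [mv vK]; split; first exact: measurable_funB.
move=> K cK; have mK : measurable K.
  rewrite -(setCK K); apply: measurableC; apply: open_measurable_rV; apply: closed_openC.
  by apply: compact_closed => //; exact: norm_hausdorff.
have ma (f : E -> R) : measurable_fun setT f -> measurable_fun K (fun x => `|f x|%:E).
  move=> mf; apply: measurable_funTS; apply/measurable_EFinP.
  exact: measurableT_comp.
apply: (@le_lt_trans _ _ (\int[mu]_(x in K) (`|u x|%:E + `|v x|%:E))%E).
  apply: ge0_le_integral => //.
  - by apply: ma; exact: measurable_funB.
  - by apply: emeasurable_funD; exact: ma.
  - by move=> x _; rewrite -EFinD lee_fin ler_normB.
have m1 := ma u mu_; have m2 := ma v mv.
by rewrite ge0_integralD// lte_add_pinfty// ?uK ?vK.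
Qed.

Lemma weak_partialP i v g : is_weak_partial i v g -> is_weak_partial i v (weak_partial i v).
Proof. by move=> H; exact: (@xgetI _ _ [set g | is_weak_partial i v g] g). Qed.

(** The difference of two weak derivatives integrates to 0 against every test function. This ties
    the chosen representative to the gradient computed as a limit. *)
Lemma weak_partial_ae i v g : is_weak_partial i v g ->
  {ae mu, forall x, weak_partial i v x = g x}.
Proof.
move=> H; have [_ lw ew] := weak_partialP H.
have [_ lg eg] := H.
have /filterS : {ae mu, forall x, weak_partial i v x - g x = 0}.
  apply: du_bois_reymond => [|phi phis]; first exact: L1locB.
  have i1 := L1loc_intg_test lw phis; have i2 := L1loc_intg_test lg phis.
  under Rint_eq do rewrite mulrBl.
  rewrite RintB// /Rintegral.
  have := ew phi phis; rewrite eg// => /(congr1 (@oppe R)); rewrite !oppeK => ->.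
  by rewrite subrr.
by apply=> x /eqP; rewrite subr_eq0 => /eqP.
Qed.

Lemma powR_intg_Lfun (r : R) u : 0 < r -> measurable_fun setT u ->
  mu.-integrable setT (EFin \o (fun x => `|u x| `^ r)) -> u \in Lfun mu r%:E.
Proof.
move=> r0 mu_ /integrableP[_ ui]; rewrite inE; apply/andP; split; first by rewrite inE.
rewrite inE /= /finite_norm unlock; apply: poweR_lty.
by apply: le_lt_trans ui; rewrite le_eqVlt; apply/orP; left; apply/eqP; apply: eq_integral => x _;
   rewrite /= [in RHS]ger0_norm ?powR_ge0.
Qed.

Lemma dirichlet_normE v : C0infty v -> dirichlet_norm v = (dir v `^ 2^-1)%:E.
Proof.
by move=> vs; rewrite /dirichlet_norm -Rintegral_EFin//; exact: intg_grad.
Qed.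

Lemma Lnorm_cvg0 (r : R) (f : nat -> E -> R) u : 0 < r ->
  (forall j, mu.-integrable setT (EFin \o (fun x => `|f j x - u x| `^ r))) ->
  (\int[mu]_x (`|f j x - u x| `^ r)) @[j --> \oo] --> 0 ->
  ('N[mu]_r%:E[EFin \o (f j \- u)%R] @[j --> \oo] --> 0)%E.
Proof.
move=> r0 fi f0.
have -> : (fun j => 'N[mu]_r%:E[EFin \o (f j \- u)%R])%E =
    EFin \o (fun j => `|\int[mu]_x (`|f j x - u x| `^ r)| `^ r^-1).
  apply/funext => j; rewrite unlock /= ger0_norm; last by apply: Rint_ge0 => x; exact: powR_ge0.
  by rewrite -poweR_EFin Rintegral_EFin.
apply/cvg_EFin; first exact: nearW.
have ri : 0 < r^-1 by rewrite invr_gt0.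
have := cvg_comp _ _ f0 (@continuous_normr_powR R r^-1 ri 0).
by rewrite normr0 powR0// gt_eqF.
Qed.

End weak_partial_uniqueness.

Section D12.
Context {R : realType} {n : nat}.
Local Notation N := n.+3.
Local Notation E := ('rV[R]_N).
Local Notation mu := (@lebesgue_rV R N).
Local Notation intg f := (mu.-integrable setT (EFin \o f)).
Local Notation p := (@crit_exp R N).

Lemma dom_cvg_D12 (y : nat -> E -> R) u : (forall j, C0infty (y j)) ->
  (forall e : R, 0 < e -> exists j0 : nat, forall i j, (j0 <= i)%N -> (j0 <= j)%N ->
    dir (fun x => y i x - y j x) <= e) -> dom_cvg p y u -> D12 u.
Proof.
move=> ys yc yu; have p0 : 0 < p by rewrite (lt_trans _ (@crit_exp_gt2 R n)).
have [mu_ _ [S Si [S0 yS]]] := yu.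
split; first by apply: powR_intg_Lfun => //; exact: dom_cvg_powR_intg ys yu p0.
exists y; split=> //.
(* [dirichlet_norm] is the root of [dir], and the factor 1/2 makes the inequality strict. *)
- move=> e e0; have d0 : 0 < e ^+ 2 / 2 by rewrite divr_gt0// exprn_gt0.
  have [j0 j0P] := yc _ d0; exists j0 => i j ij jj.
  rewrite dirichlet_normE; last exact: C0inftyB.
  have -> : e = (e ^+ 2) `^ 2^-1 by rewrite -powR_mulrn ?ltW// -powRrM divff// powRr1// ltW.
  rewrite lte_fin; apply: gt0_ltr_powR; rewrite ?nnegrE ?dir_ge0 ?sqr_ge0 ?invr_gt0//.
  by apply: (le_lt_trans (j0P i j ij jj)); rewrite ltr_pdivrMr// ltr_pMr ?exprn_gt0// ltr1n.
- apply: Lnorm_cvg0 => //; last first.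
    by apply: dom_cvg_Rint => // j; exact: C0infty_measurable.
  move=> j; apply: (intg_le_ae _ Si).
    apply: (measurableT_comp (measurable_powR _)); apply: measurableT_comp => //.
    by apply: measurable_funB => //; exact: C0infty_measurable.
  by apply: filterS yS => x xS; rewrite ger0_norm ?powR_ge0.
Qed.

End D12.

Section powR_increment.
Context {R : realType}.

(** The tangent lines at a and at a + b bound the increment by multiples of |b| |a|^(r-1) and |b|^r;
    Young's inequality turns the former into a small multiple of |a|^r plus a multiple of |b|^r. It
    serves the h-term, where only the integrals of |a|^r are bounded. *)
Lemma normr_powR_increment (r e : R) : 1 < r -> 0 < e ->
  exists2 C : R, 0 <= C & forall a b : R,
    `| `|a + b| `^ r - `|a| `^ r | <= C * `|b| `^ r + e * `|a| `^ r.
Proof.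
move=> r1 e0; have r0 : 0 < r by rewrite (lt_trans _ r1).
have rm0 : 0 < r - 1 by rewrite subr_gt0.
pose c := r * 2 `^ (r - 1); have c0 : 0 < c by rewrite mulr_gt0// powR_gt0.
have rr : r - 1 < r by rewrite ltrBlDr ltrDl.
have [C C0 HC] := powR_weight_absorb rm0 rr (divr_gt0 e0 c0).
have {}HC (a b : R) : `|b| * `|a| `^ (r - 1) <= C * `|b| `^ r + e / c * `|a| `^ r.
  by have := HC `|b| `|a| (normr_ge0 _) (normr_ge0 _); rewrite opprB addrCA subrr addr0 divr1.
have tan (a b : R) : `|a| `^ r - r * (`|b| * `|a| `^ (r - 1)) <= `|a + b| `^ r.
  apply: le_trans (normr_powR_tangent a b r1); rewrite lerD2l lerNl.
  rewrite -!mulrA -mulrN ler_pM2l// (le_trans (ler_norm _))// normrN !normrM.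
  rewrite (ger0_norm (powR_ge0 _ _)) mulrA mulrC ler_wpM2l//.
  have [->|a0] := eqVneq a 0; first by rewrite normr0 mulr0 powR_ge0.
  rewrite -[X in _ * X]powRr1// -powRD ?normr_eq0 ?(negPf a0) ?implybT//.
  by rewrite -addrA (_ : - 2 + 1 = - 1 :> R)//; lra.
exists (c * C + r * 2 `^ (r - 1)) => [|a b]; first by rewrite addr_ge0 ?mulr_ge0 ?powR_ge0// ltW.
have lo : - (r * (`|b| * `|a| `^ (r - 1))) <= `|a + b| `^ r - `|a| `^ r.
  by rewrite lerBrDr addrC tan.
have hi : `|a + b| `^ r - `|a| `^ r <= r * (`|b| * `|a + b| `^ (r - 1)).
  by rewrite lerBlDl -lerBlDr; have := tan (a + b) (- b); rewrite addrK normrN.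
have sub : `|a + b| `^ (r - 1) <= 2 `^ (r - 1) * (`|a| `^ (r - 1) + `|b| `^ (r - 1)).
  apply: le_trans (powR_D_le (normr_ge0 _) (normr_ge0 _) rm0).
  by apply: ge0_ler_powR; rewrite ?nnegrE ?(ltW rm0) ?ler_normD ?addr_ge0.
have bb : `|b| * `|b| `^ (r - 1) = `|b| `^ r.
  have [->|b0] := eqVneq b 0; first by rewrite normr0 mul0r powR0// gt_eqF.
  by rewrite -[X in X * _]powRr1// -powRD ?normr_eq0 ?(negPf b0) ?implybT// addrC subrK.
have two : 1 <= 2 `^ (r - 1) by rewrite -[leLHS](powRr0 (2 : R)) ler_powR ?ler1n ?(ltW rm0).
have X0 : 0 <= `|b| * `|a| `^ (r - 1) by rewrite mulr_ge0 ?powR_ge0.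
have lec : r * (`|b| * `|a| `^ (r - 1)) <= c * (`|b| * `|a| `^ (r - 1)).
  by rewrite ler_wpM2r// ler_peMr// ltW.
have fin : c * (`|b| * `|a| `^ (r - 1)) <= c * C * `|b| `^ r + e * `|a| `^ r.
  apply: (le_trans (ler_wpM2l (ltW c0) (HC a b))).
  by rewrite mulrDr mulrA lerD2l mulrA mulrCA divff ?gt_eqF// mulr1.
rewrite ler_norml; apply/andP; split.
  rewrite (le_trans _ lo)// lerN2 (le_trans lec)// (le_trans fin)// lerD2r ler_wpM2r ?powR_ge0//.
  by rewrite lerDl (ltW c0).
apply: (le_trans hi).
apply: (@le_trans _ _ (c * (`|b| * `|a| `^ (r - 1)) + c * `|b| `^ r)).
  rewrite -mulrDr -bb -mulrDr -mulrA ler_pM2l//.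
  by rewrite mulrCA ler_wpM2l.
by rewrite mulrDl [leRHS]addrAC lerD2r.
Qed.

End powR_increment.

(** With a = f, b = d_i f, c = d_i phi, d = phi this expands the gradient part of the energy in t.
    The two sides differ by t^2 times a sum of squares, and every product in the remainder has an
    integral bounded along the minimizing sequence. *)
Lemma shift_pointwise_le (F : realFieldType) (a b c d t : F) : t ^+ 2 <= 1 ->
  2^-1 * (b + t * c) ^+ 2 + ((a + t * d) * (b + t * c)) ^+ 2 <=
  2^-1 * b ^+ 2 + (a * b) ^+ 2 + t * (b * c + 2 * a * b * a * c + 2 * a * b * b * d) +
    t ^+ 2 * (2^-1 * c ^+ 2 +
      ((a * b) ^+ 2 + 3 * (d * c) ^+ 2 + 4 * (a ^+ 2 * c ^+ 2) + 4 * (d ^+ 2 * b ^+ 2))).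
Proof.
rewrite -subr_ge0 => t1; rewrite -subr_ge0; set D := _ - _.
have -> : D = t ^+ 2 * ((a * b - d * c) ^+ 2 + (a * c + d * b - t * (d * c)) ^+ 2 +
  2 * (d * c) ^+ 2 * (1 - t ^+ 2) + 2 * (a * c - d * b) ^+ 2) by rewrite /D; field.
apply: mulr_ge0; first exact: sqr_ge0.
apply: addr_ge0; last by rewrite mulr_ge0 ?sqr_ge0.
apply: addr_ge0; first by rewrite addr_ge0 ?sqr_ge0.
by rewrite mulr_ge0// mulr_ge0 ?sqr_ge0.
Qed.

Lemma energy_combine (F : realFieldType) (d d' e e' a a' b b' l c q' s' : F) :
  d' / 2 + e' <= d / 2 + e + l + c ->
  d' / 2 + e' - a' / q' + b' / s' <=
  d / 2 + e - a / q' + b / s' + l + c - (a' - a) / q' + (b' - b) / s'.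
Proof. by rewrite !mulrBl => H; lra. Qed.

Section derive_powR_integral.
Context d (T : measurableType d) {R : realType} (mu : {measure set T -> \bar R}).
Local Notation intg f := (mu.-integrable setT (EFin \o f)).

(** For |t| <= 1 the derivative of the integrand is at most c w (|v| + |phi|)^c, because |phi| and
    |v + t phi| are both at most |v| + |phi|; this majorant permits differentiation under the
    integral. *)
Lemma is_derive_powR_integral (w v phi : T -> R) (c : R) : 1 < c ->
  measurable_fun setT w -> (forall x, 0 <= w x) ->
  measurable_fun setT v -> measurable_fun setT phi ->
  (forall t : R, intg (fun x => w x * `|v x + t * phi x| `^ c)) ->
  intg (fun x => w x * `|v x| `^ c) -> intg (fun x => w x * `|phi x| `^ c) ->
  intg (fun x => w x * `|v x| `^ (c - 2) * v x * phi x) /\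
  is_derive (0 : R) 1 (fun t : R => \int[mu]_x (w x * `|v x + t * phi x| `^ c))
    (c * \int[mu]_x (w x * `|v x| `^ (c - 2) * v x * phi x)).
Proof.
move=> c1 mw w0 mv mphi it iv iphi; have c0 : 0 < c by rewrite (lt_trans _ c1).
have cm : 0 < c - 1 by rewrite subr_gt0.
pose F (t : R) x := w x * `|v x + t * phi x| `^ c.
pose G x := c * (2 `^ c * (w x * `|v x| `^ c + w x * `|phi x| `^ c)).
have G0 x : 0 <= G x.
  by rewrite /G mulr_ge0 ?(ltW c0)// mulr_ge0 ?powR_ge0// addr_ge0 ?mulr_ge0 ?powR_ge0.
have iG : intg G by apply: intgZ; apply: intgZ; exact: intgD.
have dF (t : R) x : is_derive t 1 (F ^~ x)
    (w x * (c * `|v x + t * phi x| `^ (c - 2) * (v x + t * phi x) * phi x)).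
  have d1 : is_derive t 1 (fun t : R => v x + t * phi x) (phi x).
    rewrite (_ : (fun t => _) = cst (v x) + phi x *: id); last first.
      by apply/funext => r /=; rewrite mulrC.
    apply: (is_derive_eq (is_deriveD (is_derive_cst (v x) t (1 : R))
      (is_deriveZ (phi x) (is_derive_id t (1 : R))))).
    by rewrite add0r [LHS]mulr1.
  have d2 := is_derive_comp d1 (is_derive_normr_powR (v x + t * phi x) c1).
  by have := is_deriveZ (w x) d2.
have powE (a : R) : `| `|a| `^ (c - 2) * a| = `|a| `^ (c - 1).
  have [->|a0] := eqVneq a 0; first by rewrite mulr0 normr0 powR0// gt_eqF.
  rewrite normrM (ger0_norm (powR_ge0 _ _)) -[X in _ * X]powRr1// -powRD ?normr_eq0 ?(negPf a0) ?implybT//.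
  by congr (_ `^ _); ring.
have bnd (t : R) x : `|t| <= 1 ->
    `|w x * (c * `|v x + t * phi x| `^ (c - 2) * (v x + t * phi x) * phi x)| <= G x.
  move=> t1; rewrite -!mulrA mulrCA normrM (ger0_norm (ltW c0)) /G ler_pM2l//.
  rewrite normrM (ger0_norm (w0 x)) -mulrDr [leRHS]mulrCA ler_wpM2l// mulrA normrM powE.
  apply: le_trans (powR_D_le (normr_ge0 _) (normr_ge0 _) c0).
  have S0 : 0 <= `|v x| + `|phi x| by rewrite addr_ge0.
  have le1 : `|v x + t * phi x| <= `|v x| + `|phi x|.
    by rewrite (le_trans (ler_normD _ _))// lerD2l normrM ler_piMl.
  apply: (@le_trans _ _ ((`|v x| + `|phi x|) `^ (c - 1) * (`|v x| + `|phi x|))).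
    apply: ler_pM => //.
      by apply: ge0_ler_powR; rewrite ?nnegrE ?(ltW cm).
    by rewrite lerDr.
  have [->|Sn] := eqVneq (`|v x| + `|phi x|) 0; first by rewrite mulr0 powR_ge0.
  by rewrite -[X in _ * X]powRr1// -powRD ?(negPf Sn) ?implybT// subrK.
have I0 : (`]-1, 1[%classic : set R) 0 by rewrite /= in_itv/= oppr_lt0 ltr01.
have It (t : R) : (`]-1, 1[%classic : set R) t -> `|t| <= 1.
  by rewrite /= in_itv/= => /andP[a b]; rewrite ler_norml !ltW.
have dV (t : R) x : partial1of2 F t x =
    w x * (c * `|v x + t * phi x| `^ (c - 2) * (v x + t * phi x) * phi x).
  by rewrite partial1of2E; exact: (@derive_val _ _ _ _ _ _ _ (dF t x)).
have intF t : (`]-1, 1[%classic : set R) t -> intg (F t) by move=> _; exact: it.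
have derF t x : (`]-1, 1[%classic : set R) t -> setT x -> derivable (F ^~ x) t 1.
  by move=> _ _; have [] := dF t x.
have GF t x : (`]-1, 1[%classic : set R) t -> setT x -> `|partial1of2 F t x| <= G x.
  by move=> /It t1 _; rewrite dV; exact: bnd.
have E x : w x * (c * `|v x + 0 * phi x| `^ (c - 2) * (v x + 0 * phi x) * phi x) =
    c * (w x * `|v x| `^ (c - 2) * v x * phi x) by rewrite mul0r addr0; ring.
have i0 : intg (fun x => w x * `|v x| `^ (c - 2) * v x * phi x).
  apply: (@intg_le _ _ _ _ _ (fun x => c^-1 * G x)).
  - apply: measurable_funM => //; apply: measurable_funM => //; apply: measurable_funM => //.
    by apply: (measurableT_comp (measurable_powR _)); exact: measurableT_comp.
  - exact: intgZ.
  - move=> x; rewrite -(ler_pM2l c0) mulrA divff ?gt_eqF// mul1r -[X in X * `|_|](ger0_norm (ltW c0)).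
    by rewrite -normrM -E; apply: bnd; rewrite normr0.
split=> //; have := @derivable_under_integral R _ T mu F setT measurableT 0 (-1) 1 I0 intF derF G G0 iG GF.
have := @differentiation_under_integral R _ T mu F setT measurableT 0 (-1) 1 I0 intF derF G G0 iG GF.
rewrite derive1E => e de; apply: DeriveDef => //; rewrite e -RintZ//.
by apply: Rint_eq => x; rewrite dV E.
Qed.

End derive_powR_integral.

(** The difference quotients along 1/(j+1) are nonnegative, those along -1/(j+1) nonpositive. *)
Lemma derivative_at_min (R : realType) (F : R -> R) l : is_derive (0 : R) 1 F l ->
  (forall t, `|t| <= 1 -> F 0 <= F t) -> l = 0.
Proof.
move=> [dF <-] Fmin.
have cF : (fun r : R => r^-1 *: (F r - F 0)) @ 0^' --> 'D_1 F 0.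
  have e : (fun r : R => r^-1 *: ((F \o shift 0) (r *: 1) - F 0)) =
           (fun r : R => r^-1 *: (F r - F 0)).
    by apply/funext => r /=; rewrite addr0 [r *: 1]mulr1.
  by rewrite -e; exact: dF.
have v0 : (fun j : nat => j.+1%:R^-1 : R) @ \oo --> 0 by exact: cvg_harmonic.
have vn (j : nat) : 0 < j.+1%:R^-1 :> R by rewrite invr_gt0.
have v1 (j : nat) : `|j.+1%:R^-1| <= 1 :> R.
  by rewrite ger0_norm ?(ltW (vn j))// invf_le1 ?ltr0n// ler1n.
have c1 := (cvgr_dnbhsP _ _ _).1 cF (fun j => j.+1%:R^-1) (conj (fun j => lt0r_neq0 (vn j)) v0).
have nv0 : (fun j : nat => - j.+1%:R^-1 : R) @ \oo --> 0 by rewrite -oppr0; exact: cvgN.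
have nvn (j : nat) : - j.+1%:R^-1 != 0 :> R by rewrite oppr_eq0 lt0r_neq0.
have c2 := (cvgr_dnbhsP _ _ _).1 cF (fun j => - j.+1%:R^-1) (conj nvn nv0).
apply/eqP; rewrite eq_le; apply/andP; split.
  rewrite -(cvg_lim _ c2)//; apply: limr_le; first exact: cvgP c2.
  apply: nearW => j; rewrite /= invrN scaleNr oppr_le0 mulr_ge0 ?invr_ge0//.
  by rewrite subr_ge0 Fmin// normrN.
rewrite -(cvg_lim _ c1)//; apply: limr_ge; first exact: cvgP c1.
apply: nearW => j; rewrite /= mulr_ge0 ?invr_ge0//.
by rewrite subr_ge0 Fmin.
Qed.

(** * The Euler-Lagrange equation *)

Lemma energy_transfer (F : realFieldType) (a b c d e m v : F) :
  a <= b + v -> b / 2 + c - d + e <= m + v ^+ 2 ->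
  2^-1 * a + c + e <= m + v ^+ 2 + 2^-1 * v + d.
Proof. by move: (v ^+ 2) => w; lra. Qed.

Lemma scaled_absorb (F : realFieldType) (T a b c e d : F) : 0 < T ->
  a <= c + e / T * d -> T * (a + b) <= T * (c + b) + e * d.
Proof.
move=> T0 /(ler_wpM2l (ltW T0)) H.
have -> : T * (c + b) + e * d = T * (c + e / T * d) + T * b by field; rewrite gt_eqF.
by rewrite mulrDr lerD2r.
Qed.

Lemma cvg_sum_ord (R : realType) m (f : 'I_m -> R^nat) (l : 'I_m -> R) :
  (forall i, f i @ \oo --> l i) ->
  (fun n => \sum_(i < m) f i n) @ \oo --> \sum_(i < m) l i.
Proof.
elim: m f l => [|m IH] f l fl.
  by rewrite big_ord0; under eq_fun do rewrite big_ord0; exact: cvg_cst.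
rewrite big_ord_recl; under eq_fun do rewrite big_ord_recl.
by apply: cvgD => //; apply: IH.
Qed.

Section limit.
Context {R : realType} {n : nat}.
Local Notation N := n.+3.
Local Notation E := ('rV[R]_N).
Local Notation mu := (@lebesgue_rV R N).
Local Notation intg f := (mu.-integrable setT (EFin \o f)).
Local Notation p := (@crit_exp R N).

Variables (q s : R) (k h : E -> R) (Mk Mh : R).
Hypotheses (q1 : 1 < q) (q2 : q < 2) (s2 : 2 < s).
Hypotheses (mk : measurable_fun setT k) (k0 : forall x, 0 <= k x)
  (kM : forall x, k x <= Mk) (ki : intg (fun x => k x `^ (p / (p - q)))).
Hypotheses (mh : measurable_fun setT h) (h0 : forall x, 0 <= h x)
  (hM : forall x, h x <= Mh).
Variables (m : R) (f y : nat -> E -> R) (u : E -> R) (g : 'I_N -> E -> R).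
Hypothesis ld : limit_data q s k h m f y u g.

Let p2 : 2 < p. Proof. exact: crit_exp_gt2. Qed.
Let p1 : 1 <= p. Proof. by rewrite ltW// (lt_trans _ p2)// ltr1n. Qed.
Let p0 : 0 < p. Proof. exact: lt_le_trans p1. Qed.
Let q0 : 0 < q. Proof. exact: lt_trans q1. Qed.
Let s0 : 0 < s. Proof. exact: lt_trans s2. Qed.
Let qp : q < p. Proof. exact: lt_trans p2. Qed.

Lemma limit_measurable : measurable_fun setT u.
Proof. by have [] := ld_strong ld. Qed.

Lemma limit_partial_measurable i : measurable_fun setT (g i).
Proof. by have [] := ld_dstrong ld i. Qed.

Lemma limit_is_weak_partial psi i : C0infty psi ->
  is_weak_partial i (fun x => u x + psi x) (fun x => g i x + partial i psi x).
Proof.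
move=> psis; apply: (@dom_cvg_weak_partial _ _ p _ (fun j x => y j x + psi x)) => //.
- by move=> j; apply: C0inftyD => //; exact: ld_y ld j.
- by apply: dom_cvgD; [exact: C0infty_measurable|exact: ld_strong ld].
rewrite (_ : (fun j => _) = fun j x => partial i (y j) x + partial i psi x); last first.
  apply/funext => j; rewrite (partialD i (C0infty_smooth (ld_y ld j)) (C0infty_smooth psis))//.
apply: dom_cvgD; last exact: ld_dstrong ld i.
by apply: C0infty_measurable; exact: C0infty_partial.
Qed.

Lemma limit_weak_partial_ae psi : C0infty psi ->
  {ae mu, forall x, forall i, weak_partial i (fun x => u x + psi x) x = g i x + partial i psi x}.
Proof.
by move=> psis; apply: filter_forall => i; apply: weak_partial_ae; exact: limit_is_weak_partial.
Qed.

Lemma limit_D12 : D12 u.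
Proof. exact: dom_cvg_D12 (ld_y ld) (ld_cauchy ld) (ld_strong ld). Qed.

Lemma limit_powR_intg : intg (fun x => `|u x| `^ p).
Proof. exact: dom_cvg_powR_intg (ld_y ld) (ld_strong ld) p0. Qed.

Lemma limit_partial_intg i : intg (fun x => g i x ^+ 2).
Proof.
have dy j : C0infty (partial i (y j)) by apply: C0infty_partial; exact: ld_y ld j.
have := dom_cvg_powR_intg dy (ld_dstrong ld i) (ltr0Sn _ 1).
by apply: eq_intg => x; rewrite powR_mulrn// real_normK ?num_real.
Qed.

Lemma limit_mul_partial_intg i : intg (fun x => (u x * g i x) ^+ 2).
Proof.
have dy j : C0infty (fun x => 2 * f j x * partial i (f j) x).
  by apply: C0inftyM; [apply: C0inftyZ|apply: C0infty_partial]; exact: ld_f ld j.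
have := dom_cvg_powR_intg dy (ld_dsqr ld i) (ltr0Sn _ 1).
move=> /(intgZ 4^-1); apply: eq_intg => x; rewrite powR_mulrn// real_normK ?num_real//.
by field.
Qed.

Lemma powR_shift_intg psi : C0infty psi -> intg (fun x => `|u x + psi x| `^ p).
Proof.
move=> psis; have mpsi := C0infty_measurable psis.
apply: (@intg_le _ _ _ _ _ (fun x => 2 `^ p * (`|u x| `^ p + `|psi x| `^ p))).
- apply: (measurableT_comp (measurable_powR _)); apply: measurableT_comp => //.
  by apply: measurable_funD => //; exact: limit_measurable.
- by apply: intgZ; apply: intgD; [exact: limit_powR_intg|exact: C0infty_powR_intg].
- move=> x; rewrite ger0_norm ?powR_ge0//.
  apply: le_trans (powR_D_le (normr_ge0 _) (normr_ge0 _) p0).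
  by apply: ge0_ler_powR; rewrite ?nnegrE ?(ltW p0) ?ler_normD ?addr_ge0.
Qed.

Lemma intg_k_limit psi : C0infty psi -> intg (fun x => k x * `|u x + psi x| `^ q).
Proof.
move=> psis; have mpsi := C0infty_measurable psis.
have [C C0 HC] := powR_weight_absorb q0 qp (@ltr01 R).
apply: (@intg_le _ _ _ _ _ (fun x => C * k x `^ (p / (p - q)) + `|u x + psi x| `^ p)).
- apply: measurable_funM => //.
  apply: (measurableT_comp (measurable_powR _)); apply: measurableT_comp => //.
  by apply: measurable_funD => //; exact: limit_measurable.
- by apply: intgD; [exact: intgZ|exact: powR_shift_intg].
- move=> x; rewrite ger0_norm ?mulr_ge0 ?powR_ge0//.
  by rewrite (le_trans (HC _ _ (k0 x) (normr_ge0 _)))// mul1r.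
Qed.

(** Only boundedness of the integrals of |f_j|^p is available: k |f_j|^q is at most a fixed
    integrable multiple of k^(p/(p-q)) plus a small multiple of |f_j|^p, so no mass of the k-term
    escapes. *)
Lemma cvg_k_limit psi : C0infty psi ->
  kfun q k (fun x => f j x + psi x) @[j --> \oo] --> \int[mu]_x (k x * `|u x + psi x| `^ q).
Proof.
move=> psis; have mpsi := C0infty_measurable psis.
have [B B0 HB] := minimizing_bound q1 q2 s2 mk k0 kM ki h0 (ld_f ld) (ld_energy ld).
have iu := intg_k_limit psis.
have [|||||||_ _ cv] := @Rint_cvg_young _ _ _ mu (fun j x => k x * `|f j x + psi x| `^ q)
  (fun j x => `|f j x| `^ p) (fun x => k x * `|u x + psi x| `^ q) B.
- by move=> j; apply: (intg_kfun q1 mk k0 kM); apply: C0inftyD => //; exact: ld_f ld j.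
- exact: intg_measurable iu.
- apply: filterS (ld_cvg ld) => x fx; apply: cvgM; first exact: cvg_cst.
  have d0 : (fun j => f j x + psi x) @ \oo --> u x + psi x by apply: cvgD => //; exact: cvg_cst.
  exact: cvg_comp d0 (@continuous_normr_powR R q q0 _).
- by move=> j; apply: C0infty_powR_intg => //; exact: ld_f ld j.
- by move=> j x; exact: powR_ge0.
- by move=> j; have [] := HB j.
- move=> e e0; have t0 : 0 < 2 `^ q :> R by apply: powR_gt0.
  have [C C0 HC] := powR_weight_absorb q0 qp (divr_gt0 e0 t0).
  exists (fun x => 2 `^ q * (C * k x `^ (p / (p - q)) + k x * `|psi x| `^ q)
                   + k x * `|u x + psi x| `^ q).
    apply: intgD => //; apply: intgZ; apply: intgD; first exact: intgZ.
    exact: (intg_kfun q1 mk k0 kM psis).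
  apply: nearW => x j; apply: (le_trans (ler_normB _ _)).
  rewrite !(ger0_norm (mulr_ge0 (k0 x) (powR_ge0 _ _))).
  rewrite [leRHS]addrAC lerD2r.
  apply: (@le_trans _ _ (k x * (2 `^ q * (`|f j x| `^ q + `|psi x| `^ q)))).
    rewrite ler_wpM2l//; apply: le_trans (powR_D_le (normr_ge0 _) (normr_ge0 _) q0).
    by apply: ge0_ler_powR; rewrite ?nnegrE ?(ltW q0) ?ler_normD ?addr_ge0.
  by rewrite mulrCA [k x * (_ + _)]mulrDr; apply: scaled_absorb => //; exact: HC.
exact: cv.
Qed.

Lemma cvg_k_limit0 : kfun q k (f j) @[j --> \oo] --> \int[mu]_x (k x * `|u x| `^ q).
Proof.
have zs : C0infty (fun _ : E => 0 : R).
  by apply/C0inftyP; split; [exact: smooth_cst|exists 0].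
have e (v : E -> R) : \int[mu]_x (k x * `|v x + 0| `^ q) = \int[mu]_x (k x * `|v x| `^ q).
  by apply: Rint_eq => x; rewrite addr0.
have := cvg_k_limit zs; rewrite e => H; apply: cvg_trans H.
by apply: near_eq_cvg; apply: nearW => j; exact: e.
Qed.

(** The integrand mixes two sequences: the Dirichlet term is taken from y, whose gradients converge
    everywhere that is needed, the other terms from f, whose energy is known. The k-term converges
    and moves to the right-hand side. *)
Lemma limit_fatou : (\int[mu]_x (2^-1 * \sum_(i < N) g i x ^+ 2 +
    \sum_(i < N) (u x * g i x) ^+ 2 + s^-1 * (h x * `|u x| `^ s))%:E <=
  (m + q^-1 * \int[mu]_x (k x * `|u x| `^ q))%:E)%E.
Proof.
have kc := cvg_k_limit0.
have i1 j : intg (fun x => 2^-1 * \sum_(i < N) partial i (y j) x ^+ 2).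
  by apply: intgZ; apply: intg_grad; exact: ld_y ld j.
have i2 j := intg_quad (ld_f ld j).
have i3 j : intg (fun x => s^-1 * (h x * `|f j x| `^ s)).
  by apply: intgZ; exact: (intg_hfun s2 mh h0 hM (ld_f ld j)).
pose F j x := 2^-1 * \sum_(i < N) partial i (y j) x ^+ 2 +
    \sum_(i < N) (f j x * partial i (f j) x) ^+ 2 + s^-1 * (h x * `|f j x| `^ s).
have Fi j : intg (F j) by apply: intgD => //; exact: intgD.
have mu_ := limit_measurable; have mg := limit_partial_measurable.
apply: (@Rint_fatou _ _ _ mu F _ (fun j => m + (j.+1%:R^-1) ^+ 2 + 2^-1 * j.+1%:R^-1
  + q^-1 * kfun q k (f j))) => //.
- by move=> j x; rewrite !addr_ge0 ?mulr_ge0 ?powR_ge0 ?sum_sqr_ge0 ?invr_ge0 ?(ltW s0).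
- apply: measurable_funD; first apply: measurable_funD.
  + apply: measurable_funM => //; apply: measurable_sum => i; exact: measurable_funX.
  + by apply: measurable_sum => i; apply: measurable_funX; exact: measurable_funM.
  + apply: measurable_funM => //; apply: measurable_funM => //.
    by apply: (measurableT_comp (measurable_powR _)); exact: measurableT_comp.
- have ae1 : {ae mu, forall x, forall i, (fun j => partial i (y j) x) @ \oo --> g i x}.
    by apply: filter_forall => i; have [] := ld_dstrong ld i.
  have ae2 : {ae mu, forall x, forall i,
      (fun j => 2 * f j x * partial i (f j) x) @ \oo --> 2 * u x * g i x}.
    by apply: filter_forall => i; have [] := ld_dsqr ld i.
  apply: filterS3 ae1 ae2 (ld_cvg ld) => x c1 c2 c3.
  have csum (a : nat -> 'I_N -> R) (b : 'I_N -> R) : (forall i, a ^~ i @ \oo --> b i) ->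
      (fun j => \sum_(i < N) a j i ^+ 2) @ \oo --> \sum_(i < N) b i ^+ 2.
    move=> ab; apply: (@cvg_sum_ord _ _ (fun i j => a j i ^+ 2)) => i.
    by under eq_fun do rewrite expr2; rewrite expr2; apply: cvgM; exact: ab.
  apply: cvgD; first apply: cvgD.
  + by apply: cvgM; [exact: cvg_cst|exact: csum].
  + apply: csum => i; have c : (fun j => 2^-1 * (2 * f j x * partial i (f j) x)) @ \oo -->
        2^-1 * (2 * u x * g i x) by apply: cvgM => //; exact: cvg_cst.
    have e (a b : R) : 2^-1 * (2 * a * b) = a * b by field.
    by rewrite e in c; under eq_fun do rewrite -e.
  + apply: cvgM; first exact: cvg_cst.
    apply: cvgM; first exact: cvg_cst.
    exact: cvg_comp c3 (@continuous_normr_powR R s s0 _).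
- move=> j; rewrite /F (RintD (intgD (i1 j) (i2 j)) (i3 j)) (RintD (i1 j) (i2 j)).
  rewrite RintZ; last by apply: intg_grad; exact: ld_y ld j.
  rewrite RintZ; last exact: (intg_hfun s2 mh h0 hM (ld_f ld j)).
  rewrite -/(dir _) -/(quad _) -/(hfun _ _ _) [_^-1 * hfun _ _ _]mulrC [_^-1 * kfun _ _ _]mulrC.
  exact: energy_transfer (ld_dir ld j) (ld_energy ld j).
- have -> : m + q^-1 * \int[mu]_x (k x * `|u x| `^ q) =
      m + 0 ^+ 2 + 2^-1 * 0 + q^-1 * \int[mu]_x (k x * `|u x| `^ q).
    by rewrite expr0n mulr0 !addr0.
  have v0 : (fun j : nat => j.+1%:R^-1 : R) @ \oo --> 0 by exact: cvg_harmonic.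
  apply: cvgD; last by apply: cvgM => //; exact: cvg_cst.
  apply: cvgD; last by apply: cvgM => //; exact: cvg_cst.
  apply: cvgD; first exact: cvg_cst.
  by rewrite expr2; apply: cvgM.
- by apply: nearW => x; rewrite !addr_ge0 ?mulr_ge0 ?powR_ge0 ?sum_sqr_ge0 ?invr_ge0 ?(ltW s0).
Qed.

(** Nothing bounds |u|^s a priori, as s may exceed every Sobolev exponent; integrability comes from
    the energy bound alone. *)
Lemma intg_h_limit : intg (fun x => h x * `|u x| `^ s).
Proof.
have mu_ := limit_measurable; have mg := limit_partial_measurable.
have mhu : measurable_fun setT (fun x => h x * `|u x| `^ s).
  apply: measurable_funM => //.
  by apply: (measurableT_comp (measurable_powR _)); exact: measurableT_comp.
pose F x := 2^-1 * \sum_(i < N) g i x ^+ 2 + \sum_(i < N) (u x * g i x) ^+ 2 +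
  s^-1 * (h x * `|u x| `^ s).
have Foo : (\int[mu]_x (F x)%:E < +oo)%E := le_lt_trans limit_fatou (ltry _).
have Fi : intg F.
  apply: intg_ge0 => //.
  - apply: measurable_funD; first apply: measurable_funD.
    + apply: measurable_funM => //; apply: measurable_sum => i; exact: measurable_funX.
    + by apply: measurable_sum => i; apply: measurable_funX; exact: measurable_funM.
    + exact: measurable_funM.
  - by move=> x; rewrite !addr_ge0 ?mulr_ge0 ?powR_ge0 ?sum_sqr_ge0 ?invr_ge0 ?(ltW s0).
apply: (@intg_le _ _ _ _ _ (fun x => s * F x)) => //; first exact: intgZ.
move=> x; rewrite ger0_norm ?mulr_ge0 ?powR_ge0// /F mulrDr mulrA divff ?gt_eqF// mul1r lerDr.
by rewrite mulr_ge0 ?(ltW s0)// addr_ge0 ?mulr_ge0 ?sum_sqr_ge0.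
Qed.

Lemma limit_weak_partial i : is_weak_partial i u (g i).
Proof. exact: dom_cvg_weak_partial p1 (ld_y ld) (ld_strong ld) (ld_dstrong ld i). Qed.

(** For nonnegative a and b, |a - b|^2 is at most |a^2 - b^2|, so the majorant for the squares in
    L^p serves for f in L^(2p). *)
Lemma limit_dom_cvg : dom_cvg (2 * p) f u.
Proof.
have [_ _ [S Si [S0 fS]]] := ld_sqr ld.
split; [exact: limit_measurable|exact: ld_cvg ld|].
exists S => //; split=> //; apply: filterS fS => x fx j; apply: le_trans (fx j).
rewrite powRrM powR_mulrn//; apply: ge0_ler_powR; rewrite ?nnegrE ?sqr_ge0 ?(ltW p0)//.
rewrite subr_sqr normrM expr2 ler_wpM2l//.
have f0 := ld_f0 ld j x; have u0 := ld_u0 ld x.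
by rewrite [leRHS]ger0_norm ?addr_ge0// (le_trans (ler_normB _ _))// !ger0_norm.
Qed.

(** The gradients of f converge only weakly: the derivative is moved onto [phi], and f itself
    converges in L^(2p). *)
Lemma cvg_partial_limit i phi : C0infty phi ->
  (\int[mu]_x (partial i (f j) x * partial i phi x)) @[j --> \oo] -->
  \int[mu]_x (g i x * partial i phi x).
Proof.
move=> phis; have dphis := C0infty_partial i phis; have ddphis := C0infty_partial i dphis.
have twop : 1 <= 2 * p by rewrite (le_trans p1)// ler_peMl ?ler1n// ltW.
have [i1 cv] := dom_cvg_test (ld_f ld) limit_dom_cvg twop ddphis.
have -> : \int[mu]_x (g i x * partial i phi x) = - \int[mu]_x (u x * partial i (partial i phi) x).
  have [_ lg /(_ _ dphis) e] := limit_weak_partial i.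
  by rewrite [in RHS]/Rintegral e fineN opprK.
rewrite (_ : (fun j => _) = fun j => - \int[mu]_x (f j x * partial i (partial i phi) x)).
  exact: cvgN.
by apply/funext => j; rewrite (integration_by_parts_rV i (ld_f ld j) dphis) opprK.
Qed.

Lemma intg_h_shift psi : C0infty psi -> intg (fun x => h x * `|u x + psi x| `^ s).
Proof.
move=> psis; have mpsi := C0infty_measurable psis.
apply: (@intg_le _ _ _ _ _ (fun x => 2 `^ s * (h x * `|u x| `^ s + h x * `|psi x| `^ s))).
- apply: measurable_funM => //.
  apply: (measurableT_comp (measurable_powR _)); apply: measurableT_comp => //.
  by apply: measurable_funD => //; exact: limit_measurable.
- by apply: intgZ; apply: intgD; [exact: intg_h_limit|exact: (intg_hfun s2 mh h0 hM psis)].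
- move=> x; rewrite (ger0_norm (mulr_ge0 (h0 x) (powR_ge0 _ _))) -mulrDr mulrCA ler_wpM2l//.
  apply: le_trans (powR_D_le (normr_ge0 _) (normr_ge0 _) s0).
  by apply: ge0_ler_powR; rewrite ?nnegrE ?(ltW s0) ?ler_normD ?addr_ge0.
Qed.

(** [hfun s h (f j)] may lose mass in the limit; only the increment converges, the lost part being
    the same with and without [psi]. *)
Lemma cvg_h_increment psi : C0infty psi ->
  (hfun s h (fun x => f j x + psi x) - hfun s h (f j)) @[j --> \oo] -->
  \int[mu]_x (h x * `|u x + psi x| `^ s) - \int[mu]_x (h x * `|u x| `^ s).
Proof.
move=> psis; have mpsi := C0infty_measurable psis.
have [B B0 HB] := minimizing_bound q1 q2 s2 mk k0 kM ki h0 (ld_f ld) (ld_energy ld).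
have i1 := intg_h_shift psis; have i2 := intg_h_limit.
have j1 j := intg_hfun s2 mh h0 hM (ld_f ld j).
have j2 j := intg_hfun s2 mh h0 hM (C0inftyD (ld_f ld j) psis).
have s1 : 1 < s by rewrite (lt_trans _ s2)// ltr1n.
have [|||||||_ _ cv] := @Rint_cvg_young _ _ _ mu
  (fun j x => h x * `|f j x + psi x| `^ s - h x * `|f j x| `^ s)
  (fun j x => h x * `|f j x| `^ s) (fun x => h x * `|u x + psi x| `^ s - h x * `|u x| `^ s) B.
- by move=> j; exact: intgB.
- by apply: measurable_funB; [exact: intg_measurable i1|exact: intg_measurable i2].
- apply: filterS (ld_cvg ld) => x fx.
  apply: cvgB; apply: cvgM; try exact: cvg_cst.
    have d0 : (fun j => f j x + psi x) @ \oo --> u x + psi x by apply: cvgD => //; exact: cvg_cst.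
    exact: cvg_comp d0 (@continuous_normr_powR R s s0 _).
  exact: cvg_comp fx (@continuous_normr_powR R s s0 _).
- exact: j1.
- by move=> j x; rewrite mulr_ge0 ?powR_ge0.
- by move=> j; have [] := HB j.
- move=> e e0; have [C C0 HC] := normr_powR_increment s1 e0.
  exists (fun x => C * (h x * `|psi x| `^ s)
      + `|h x * `|u x + psi x| `^ s - h x * `|u x| `^ s|).
    apply: intgD; first by apply: intgZ; exact: (intg_hfun s2 mh h0 hM psis).
    by apply: integrable_norm; exact: intgB.
  apply: nearW => x j; apply: (le_trans (ler_normB _ _)).
  rewrite [leRHS]addrAC lerD2r -mulrBr normrM (ger0_norm (h0 x)).
  apply: (le_trans (ler_wpM2l (h0 x) (HC (f j x) (psi x)))).
  by rewrite mulrDr mulrCA [X in _ + X]mulrCA.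
have e j := RintB (j2 j) (j1 j).
apply: cvg_trans (eq_ind _ (fun z => _ --> z) cv _ (RintB i1 i2)).
by apply: near_eq_cvg; apply: nearW => j; exact: e j.
Qed.

(** Both 2 f df and f have majorants. In the dominating function the summand 4 |phi| comes from t^2
    <= 1 + |t|^(2p), used for f - u and for u. *)
Lemma cvg_sqr_partial_limit i phi : C0infty phi ->
  (\int[mu]_x (2 * f j x * partial i (f j) x * f j x * phi x)) @[j --> \oo] -->
  \int[mu]_x (2 * u x * g i x * u x * phi x).
Proof.
move=> phis; have [ma ca [T Ti [T0 aT]]] := ld_dsqr ld i.
have [mb cb [S Si [S0 bS]]] := limit_dom_cvg.
have [C C0 phiC] := C0infty_bounded phis.
have mphi := C0infty_measurable phis.
have ai : intg (fun x => (2 * u x * g i x) ^+ 2).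
  by have := intgZ 4 (limit_mul_partial_intg i); apply: eq_intg => x; ring.
have twop : 0 < 2 * p by rewrite mulr_gt0.
have bi := dom_cvg_powR_intg (ld_f ld) limit_dom_cvg twop.
have sqr_le (a : R) : a ^+ 2 <= 1 + `|a| `^ (2 * p).
  by rewrite powRrM powR_mulrn// real_normK ?num_real// ler_powR1D// sqr_ge0.
have [|||||_ _ cv] := @Rint_dominated _ _ _ mu
  (fun j x => 2 * f j x * partial i (f j) x * f j x * phi x)
  (fun x => 2 * u x * g i x * u x * phi x)
  (fun x => C * (2 * (T x + (2 * u x * g i x) ^+ 2) + 2 * (S x + `|u x| `^ (2 * p)))
            + 4 * `|phi x|).
- move=> j; have mf := C0infty_measurable (ld_f ld j).
  have mpf := C0infty_measurable (C0infty_partial i (ld_f ld j)).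
  by do 2! apply: measurable_funM => //; apply: measurable_funM => //; apply: measurable_funM.
- by apply: measurable_funM => //; apply: measurable_funM.
- apply: filterS2 ca cb => x ax bx.
  by apply: cvgM; [exact: cvgM|exact: cvg_cst].
- apply: intgD; last by apply: intgZ; apply: integrable_norm; exact: C0infty_integrable.
  by apply: intgZ; apply: intgD; apply: intgZ; exact: intgD.
- apply: filterS2 aT bS => x /[swap] bx /[swap] j /(_ j).
  have {bx} := bx j.
  rewrite powR_mulrn// real_normK ?num_real//.
  move: (2 * f j x * _) (2 * u x * _) => a a'; move: (f j x) (u x) => b b' hb ha.
  rewrite normrM.
  have h1 : a ^+ 2 <= 2 * (T x + a' ^+ 2).
    apply: (@le_trans _ _ (2 * ((a - a') ^+ 2 + a' ^+ 2))); last by rewrite ler_pM2l// lerD2r.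
    by rewrite -subr_ge0 (_ : _ - _ = (a - 2 * a') ^+ 2) ?sqr_ge0//; ring.
  have h2 : b ^+ 2 <= 2 * (S x + `|b'| `^ (2 * p)) + 4.
    apply: (@le_trans _ _ (2 * ((b - b') ^+ 2 + b' ^+ 2))).
      by rewrite -subr_ge0 (_ : _ - _ = (b - 2 * b') ^+ 2) ?sqr_ge0//; ring.
    have e1 : (b - b') ^+ 2 <= 1 + S x by rewrite (le_trans (sqr_le _))// lerD2l.
    have := lerD e1 (sqr_le b'); rewrite -(ler_pM2l (ltr0Sn R 1)) => /le_trans; apply.
    by rewrite le_eqVlt; apply/orP; left; apply/eqP; ring.
  have h3 : `|a * b| <= a ^+ 2 + b ^+ 2.
    have := mul2_young a b ltr01; rewrite invr1 !mul1r addrC; apply: le_trans.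
    by rewrite -mulrA [leRHS]normrM normr_nat ler_peMl// ler1n.
  have {h1 h2 h3}: `|a * b| <= 2 * (T x + a' ^+ 2) + (2 * (S x + `|b'| `^ (2 * p)) + 4).
    by apply: (le_trans h3); exact: lerD.
  move=> /(ler_wpM2r (normr_ge0 (phi x))) /le_trans; apply.
  rewrite addrA mulrDl lerD2r mulrC ler_wpM2r//.
  by rewrite addr_ge0 ?mulr_ge0 ?addr_ge0 ?powR_ge0 ?sqr_ge0.
exact: cv.
Qed.

(** Strong times weak: with a_j = 2 f_j df_j and its limit a = 2 u g, the integrand is (a_j - a)
    df_j phi + a phi df_j. The first part tends to 0 since a_j - a does in L^2. The second converges
    because df_j tends to g where u is nonzero, and a vanishes elsewhere. *)
Lemma cvg_partial_sqr_limit i phi : C0infty phi ->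
  intg (fun x => 2 * u x * g i x * g i x * phi x) /\
  (\int[mu]_x (2 * f j x * partial i (f j) x * partial i (f j) x * phi x)) @[j --> \oo] -->
  \int[mu]_x (2 * u x * g i x * g i x * phi x).
Proof.
move=> phis; have [ma ca [T Ti [T0 aT]]] := ld_dsqr ld i.
have [B B0 HB] := minimizing_bound q1 q2 s2 mk k0 kM ki h0 (ld_f ld) (ld_energy ld).
have [C C0 phiC] := C0infty_bounded phis.
have mphi := C0infty_measurable phis; have mg := limit_partial_measurable i.
have ds j := C0infty_partial i (ld_f ld j).
pose a x := 2 * u x * g i x.
pose a_ j x := 2 * f j x * partial i (f j) x.
have ai : intg (fun x => a x ^+ 2).
  by have := intgZ 4 (limit_mul_partial_intg i); apply: eq_intg => x; rewrite /a; ring.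
have api : intg (fun x => (a x * phi x) ^+ 2).
  apply: (@intg_le _ _ _ _ _ (fun x => C ^+ 2 * a x ^+ 2)); last 1 first.
  - move=> x; rewrite ger0_norm ?sqr_ge0// exprMn mulrC ler_wpM2r ?sqr_ge0//.
    by rewrite -(real_normK (num_real (phi x))) ler_sqr ?nnegrE// ltW.
  - by apply: measurable_funX; exact: measurable_funM.
  - exact: intgZ.
have di j := C0infty_intg_sqr (ds j).
have pB j : \int[mu]_x (partial i (f j) x ^+ 2) <= B.
  by have [dB _ _ _] := HB j; exact: le_trans (dir_partial i (ld_f ld j)) dB.
have young (e b c : R) : 0 < e -> `|b * c| <= e * c ^+ 2 + e^-1 * b ^+ 2.
  move=> e0; apply: le_trans (mul2_young b c e0).
  by rewrite -mulrA [leRHS]normrM normr_nat ler_peMl// ler1n.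
have i1 j : intg (fun x => a x * phi x * partial i (f j) x).
  apply: (@intg_le _ _ _ _ _ (fun x => 1 * partial i (f j) x ^+ 2 + 1^-1 * (a x * phi x) ^+ 2)).
  - by apply: measurable_funM; [exact: measurable_funM|exact: C0infty_measurable].
  - by apply: intgD; apply: intgZ.
  - by move=> x; exact: young.
have [|||||||i2 _ c1] := @Rint_cvg_young _ _ _ mu (fun j x => a x * phi x * partial i (f j) x)
  (fun j x => partial i (f j) x ^+ 2) (fun x => a x * phi x * g i x) B.
- exact: i1.
- by apply: measurable_funM => //; exact: measurable_funM.
- apply: filterS (ld_dcvg ld i) => x ux; have [u0|un] := eqVneq (u x) 0.
    by rewrite /a u0 mulr0 !mul0r; under eq_fun do rewrite mul0r; exact: cvg_cst.
  by apply: cvgM; [exact: cvg_cst|exact: ux].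
- exact: di.
- by move=> j x; exact: sqr_ge0.
- exact: pB.
- move=> e e0; exists (fun x => e^-1 * (a x * phi x) ^+ 2
      + (1 * g i x ^+ 2 + 1^-1 * (a x * phi x) ^+ 2)).
    apply: intgD; first exact: intgZ.
    by apply: intgD; apply: intgZ => //; exact: limit_partial_intg.
  apply: nearW => x j; apply: (le_trans (ler_normB _ _)).
  apply: (le_trans (lerD (young _ _ _ e0) (young _ _ _ ltr01))).
  by rewrite -[leLHS]addrA [leLHS]addrC.
have i3 j : intg (fun x => a_ j x * partial i (f j) x * phi x).
  apply: C0infty_integrable; apply: C0inftyM => //; apply: C0inftyM => //.
  by apply: C0inftyM => //; apply: C0inftyZ; exact: ld_f ld j.
have as_ j : C0infty (a_ j) by apply: C0inftyM => //; apply: C0inftyZ; exact: ld_f ld j.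
have di2 j : intg (fun x => (a_ j x - a x) ^+ 2).
  apply: (@intg_le_ae _ _ _ T) => //.
    by apply: measurable_funX; apply: measurable_funB => //; exact: C0infty_measurable.
  apply: filterS aT => x /(_ j); rewrite powR_mulrn// real_normK ?num_real//.
  by rewrite [X in _ -> X <= _]ger0_norm ?sqr_ge0.
have d0 : (\int[mu]_x ((a_ j x - a x) ^+ 2)) @[j --> \oo] --> 0.
  have := dom_cvg_Rint (ltr0Sn R 1) (fun j => C0infty_measurable (as_ j)) (ld_dsqr ld i).
  rewrite (_ : (fun j => _) = fun j => \int[mu]_x ((a_ j x - a x) ^+ 2))//.
  by apply/funext => j; apply: Rint_eq => x; rewrite powR_mulrn// real_normK ?num_real.
have i4 j : intg (fun x => (a_ j x - a x) * partial i (f j) x * phi x).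
  have := intgB (i3 j) (i1 j); apply: eq_intg => x; ring.
have c2 : (\int[mu]_x ((a_ j x - a x) * partial i (f j) x * phi x)) @[j --> \oo] --> 0.
  (* Young's inequality gives [d] times the Dirichlet bound B, at most e/2, plus [c] times the L^2
     error, at most e/2 for large j. *)
  apply/cvgrPdist_le => e e0; pose d := e / (2 * (B + 1)).
  have B1 : 0 < B + 1 by rewrite ltr_wpDl.
  have d1 : 0 < d by rewrite divr_gt0// mulr_gt0.
  pose c := d^-1 * C ^+ 2; have cpos : 0 < c by rewrite mulr_gt0 ?invr_gt0 ?exprn_gt0.
  have e2 : 0 < e / (2 * c) by rewrite divr_gt0// mulr_gt0.
  have /cvgrPdist_le/(_ _ e2) := d0; apply: filterS => j.
  rewrite sub0r normrN ger0_norm; last by apply: Rint_ge0 => x; exact: sqr_ge0.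
  move=> hj; rewrite sub0r normrN.
  apply: (@le_trans _ _ (\int[mu]_x `|(a_ j x - a x) * partial i (f j) x * phi x|)).
    by apply: le_normr_Rintegral => //; exact: i4.
  apply: (@le_trans _ _ (d * B + c * (e / (2 * c)))); last first.
    rewrite -(_ : e / 2 + e / 2 = e); last by field.
    apply: lerD.
      rewrite /d -mulrA ler_wpM2l ?(ltW e0)// invfM -mulrA ler_piMr ?invr_ge0//.
      by rewrite mulrC ler_pdivrMr// mul1r lerDl.
    by rewrite le_eqVlt; apply/orP; left; apply/eqP; field; rewrite gt_eqF.
  apply: (@le_trans _ _ (d * \int[mu]_x (partial i (f j) x ^+ 2) +
      c * \int[mu]_x ((a_ j x - a x) ^+ 2))); last first.
    by apply: lerD; rewrite ler_wpM2l// ltW.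
  rewrite -(RintZ d (di j)) -(RintZ c (di2 j)) -(RintD (intgZ d (di j)) (intgZ c (di2 j))).
  apply: Rint_le => [||x].
  - by apply: integrable_norm; exact: i4.
  - by apply: intgD; exact: intgZ.
  rewrite mulrAC; apply: (le_trans (young d _ _ d1)); rewrite lerD2l /c -mulrA.
  rewrite ler_wpM2l ?invr_ge0 ?(ltW d1)// exprMn mulrC ler_wpM2r ?sqr_ge0//.
  by rewrite -(real_normK (num_real (phi x))) ler_sqr ?nnegrE// ltW.
have E x : a x * phi x * g i x = 2 * u x * g i x * g i x * phi x by rewrite /a; ring.
split; first exact: (eq_intg E i2).
rewrite -(Rint_eq _ E) -[X in _ --> X]add0r (_ : (fun j => _) =
  fun j => \int[mu]_x ((a_ j x - a x) * partial i (f j) x * phi x) +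
           \int[mu]_x (a x * phi x * partial i (f j) x)); first exact: cvgD.
apply/funext => j; rewrite -(RintD (i4 j) (i1 j)).
by apply: Rint_eq => x; rewrite /a_; ring.
Qed.

(** The derivative at t = 0 of [dir / 2 + quad] along v + t phi, written with the factor 2 v dv =
    d(v^2) wherever the quasilinear term contributes. *)
Definition linear_term phi v : R := \int[mu]_x (\sum_(i < N)
  (partial i v x * partial i phi x + 2 * v x * partial i v x * v x * partial i phi x
   + 2 * v x * partial i v x * partial i v x * phi x)).

Definition linear_limit phi : R := \sum_(i < N) (\int[mu]_x (g i x * partial i phi x)
  + \int[mu]_x (2 * u x * g i x * u x * partial i phi x)
  + \int[mu]_x (2 * u x * g i x * g i x * phi x)).

Lemma cvg_linear_term phi : C0infty phi ->
  linear_term phi (f j) @[j --> \oo] --> linear_limit phi.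
Proof.
move=> phis; pose a i j := \int[mu]_x (partial i (f j) x * partial i phi x)
  + \int[mu]_x (2 * f j x * partial i (f j) x * f j x * partial i phi x)
  + \int[mu]_x (2 * f j x * partial i (f j) x * partial i (f j) x * phi x).
have dphis i := C0infty_partial i phis.
rewrite (_ : (fun j => _) = fun j => \sum_(i < N) a i j).
  apply: cvg_sum_ord => i; apply: cvgD; first apply: cvgD.
  - exact: cvg_partial_limit.
  - exact: cvg_sqr_partial_limit.
  - by have [] := cvg_partial_sqr_limit i phis.
apply/funext => j; have fs := ld_f ld j; have ds i := C0infty_partial i fs.
have ws i : C0infty (fun x => 2 * f j x * partial i (f j) x).
  by apply: C0inftyM => //; exact: C0inftyZ.
have i1 i : intg (fun x => partial i (f j) x * partial i phi x).
  by apply: C0infty_integrable; exact: C0inftyM.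
have i2 i : intg (fun x => 2 * f j x * partial i (f j) x * f j x * partial i phi x).
  by apply: C0infty_integrable; apply: C0inftyM => //; exact: C0inftyM.
have i3 i : intg (fun x => 2 * f j x * partial i (f j) x * partial i (f j) x * phi x).
  by apply: C0infty_integrable; apply: C0inftyM => //; exact: C0inftyM.
rewrite /linear_term Rint_sum => [|i]; last by apply: intgD => //; exact: intgD.
apply: eq_bigr => i _.
by rewrite (RintD (intgD (i1 i) (i2 i)) (i3 i)) (RintD (i1 i) (i2 i)).
Qed.

(** [C] does not depend on j because [minimizing_bound] controls each integral of the remainder. The
    increments of the k- and h-terms are kept as they are, since their limits are known exactly. *)
Lemma energy_shift_le phi : C0infty phi -> exists2 C : R, 0 <= C & forall j t, `|t| <= 1 ->
  energy q s k h (fun x => f j x + t * phi x) <= energy q s k h (f j)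
    + t * linear_term phi (f j) + t ^+ 2 * C
    - (kfun q k (fun x => f j x + t * phi x) - kfun q k (f j)) / q
    + (hfun s h (fun x => f j x + t * phi x) - hfun s h (f j)) / s.
Proof.
move=> phis; have dphis i := C0infty_partial i phis.
have [B B0 HB] := minimizing_bound q1 q2 s2 mk k0 kM ki h0 (ld_f ld) (ld_energy ld).
have [C1 C10 phiC] := C0infty_bounded phis.
pose G x := \sum_(i < N) partial i phi x ^+ 2.
have iG : intg G by exact: intg_grad.
have /choice[c cP] : forall i : 'I_N, exists c : R, forall x, partial i phi x ^+ 2 <= c.
  move=> i; have [c c0 cP] := C0infty_bounded (dphis i); exists (c ^+ 2) => x.
  by rewrite -(real_normK (num_real (partial i phi x))) ler_sqr ?nnegrE// ltW.
pose C2 := \sum_(i < N) c i.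
have GC x : G x <= C2 by exact: ler_sum.
have C20 : 0 <= C2 by rewrite (le_trans _ (GC 0))// sum_sqr_ge0.
(* Term by term the remainder of [shift_pointwise_le]; f^2 is estimated by 1 + |f|^p, whence the two
   summands in the third term. *)
pose C := 2^-1 * dir phi + (B + 3 * quad phi + 4 * (\int[mu]_x G x + C2 * B) + 4 * (C1 ^+ 2 * B)).
exists C.
  have G0 : 0 <= \int[mu]_x G x by apply: Rint_ge0 => x; exact: sum_sqr_ge0.
  have D0 := dir_ge0 phi; have Q0 := quad_ge0 phi; have S0 := sqr_ge0 C1.
  by rewrite /C; do ![apply: addr_ge0 => //|apply: mulr_ge0 => //].
move=> j t t1; have t2 : t ^+ 2 <= 1 by rewrite -(real_normK (num_real t)) exprn_ile1.
have fs := ld_f ld j; have ds i := C0infty_partial i fs.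
have [dB quB _ pB] := HB j.
have ss : C0infty (fun x => f j x + t * phi x) by apply: C0inftyD => //; exact: C0inftyZ.
have ws i : C0infty (fun x => 2 * f j x * partial i (f j) x).
  by apply: C0inftyM => //; exact: C0inftyZ.
pose P1 x := \sum_(i < N) partial i (f j) x ^+ 2.
pose P2 x := \sum_(i < N) (f j x * partial i (f j) x) ^+ 2.
pose P3 x := \sum_(i < N)
  (partial i (f j) x * partial i phi x + 2 * f j x * partial i (f j) x * f j x * partial i phi x
   + 2 * f j x * partial i (f j) x * partial i (f j) x * phi x).
pose P4 x := \sum_(i < N) (phi x * partial i phi x) ^+ 2.
have j1 : intg P1 by exact: intg_grad.
have j2 : intg P2 by exact: intg_quad.
have j3 : intg P3.
  apply: intg_sum => i; apply: C0infty_integrable; apply: C0inftyD; first apply: C0inftyD.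
  - exact: C0inftyM.
  - by apply: C0inftyM => //; exact: C0inftyM.
  - by apply: C0inftyM => //; exact: C0inftyM.
have j4 : intg P4 by exact: intg_quad.
have jp : intg (fun x => `|f j x| `^ p) by exact: C0infty_powR_intg.
have l1 := intg_grad ss; have l2 := intg_quad ss.
have key : dir (fun x => f j x + t * phi x) / 2 + quad (fun x => f j x + t * phi x) <=
    dir (f j) / 2 + quad (f j) + t * linear_term phi (f j) + t ^+ 2 * C.
  pose rest x := 2^-1 * G x + (P2 x + 3 * P4 x + 4 * (G x + C2 * `|f j x| `^ p)
    + 4 * (C1 ^+ 2 * P1 x)).
  have k1 := intgD (intgZ 4 (intgD iG (intgZ C2 jp))) (intgZ 4 (intgZ (C1 ^+ 2) j1)).
  have ir : intg rest.
    apply: intgD; first exact: intgZ.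
    apply: intgD; last by apply: intgZ; exact: intgZ.
    apply: intgD; last by apply: intgZ; apply: intgD => //; exact: intgZ.
    by apply: intgD => //; exact: intgZ.
  have restC : \int[mu]_x rest x <= C.
    rewrite /rest (RintD (intgZ _ iG)); last first.
      apply: intgD; last by apply: intgZ; exact: intgZ.
      apply: intgD; last by apply: intgZ; apply: intgD => //; exact: intgZ.
      by apply: intgD => //; exact: intgZ.
    rewrite (RintD (intgD (intgD j2 (intgZ 3 j4)) (intgZ 4 (intgD iG (intgZ C2 jp))))
      (intgZ 4 (intgZ (C1 ^+ 2) j1))).
    rewrite (RintD (intgD j2 (intgZ 3 j4)) (intgZ 4 (intgD iG (intgZ C2 jp)))).
    rewrite (RintD j2 (intgZ 3 j4)) (RintZ _ iG) (RintZ _ j4) (RintZ 4 (intgD iG (intgZ C2 jp))).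
    rewrite (RintD iG (intgZ C2 jp)) (RintZ _ jp) (RintZ 4 (intgZ (C1 ^+ 2) j1)) (RintZ _ j1).
    rewrite /C lerD2l; apply: lerD; last by rewrite ler_pM2l// ler_wpM2l ?sqr_ge0.
    apply: lerD; last by rewrite ler_pM2l// lerD2l ler_wpM2l.
    by apply: lerD.
  have m1 := intgZ 2^-1 l1; have m2 := intgZ 2^-1 j1.
  have m3 := intgZ t j3; have m4 := intgZ (t ^+ 2) ir.
  have e1 := RintD m1 l2; rewrite (RintZ _ l1) mulrC in e1.
  apply: (le_trans (eq_ind _ (fun z => z <= _) (lexx _) _ e1)).
  rewrite [dir (f j) / 2]mulrC.
  apply: (@le_trans _ _ (\int[mu]_x (2^-1 * P1 x + P2 x + t * P3 x + t ^+ 2 * rest x))).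
    apply: Rint_le => [||x]; [exact: intgD|by apply: intgD => //; apply: intgD => //; exact: intgD|].
    have rest_ge : \sum_(i < N) (2^-1 * partial i phi x ^+ 2 +
       ((f j x * partial i (f j) x) ^+ 2 + 3 * (phi x * partial i phi x) ^+ 2
        + 4 * (f j x ^+ 2 * partial i phi x ^+ 2) + 4 * (phi x ^+ 2 * partial i (f j) x ^+ 2))) <= rest x.
      rewrite !big_split /= -!mulr_sumr /rest lerD2l; apply: lerD.
        rewrite lerD2l ler_pM2l//.
        apply: (@le_trans _ _ ((1 + `|f j x| `^ p) * G x)).
          rewrite ler_wpM2r ?sum_sqr_ge0//.
          have pp : p = 2 * (p / 2) by field.
          rewrite pp -powR_sqr ler_powR1D ?sqr_ge0// ler_pdivlMr// mul1r ltW//.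
        by rewrite mulrDl mul1r lerD2l mulrC ler_wpM2r ?powR_ge0.
      rewrite ler_pM2l// ler_wpM2r ?sum_sqr_ge0//.
      by rewrite -(real_normK (num_real (phi x))) ler_sqr ?nnegrE// ltW.
    apply: (@le_trans _ _ (2^-1 * P1 x + P2 x + t * P3 x + t ^+ 2 *
      \sum_(i < N) (2^-1 * partial i phi x ^+ 2 +
       ((f j x * partial i (f j) x) ^+ 2 + 3 * (phi x * partial i phi x) ^+ 2
        + 4 * (f j x ^+ 2 * partial i phi x ^+ 2) + 4 * (phi x ^+ 2 * partial i (f j) x ^+ 2))))); last first.
      by rewrite lerD2l ler_wpM2l ?sqr_ge0.
    rewrite /P1 /P2 /P3 !mulr_sumr -!big_split/=; apply: ler_sum => i _.
    rewrite (partialD i (C0infty_smooth fs) (C0infty_smooth (C0inftyZ t phis))).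
    rewrite (partialZ t i (C0infty_smooth phis)).
    exact: shift_pointwise_le.
  rewrite (RintD (intgD (intgD m2 j2) m3) m4) (RintD (intgD m2 j2) m3) (RintD m2 j2).
  rewrite (RintZ _ j1) (RintZ _ j3) (RintZ _ ir) lerD2l ler_wpM2l ?sqr_ge0//.
exact: energy_combine key.
Qed.

(** f_j + t phi is a competitor, so its energy is at least m, while that of f_j exceeds m by at most
    (j+1)^-2; [energy_shift_le] then passes to the limit in j at fixed t. *)
Lemma variational_inequality phi : C0infty phi -> exists C : R, forall t, `|t| <= 1 ->
  0 <= t * linear_limit phi + t ^+ 2 * C
    - (\int[mu]_x (k x * `|u x + t * phi x| `^ q) - \int[mu]_x (k x * `|u x| `^ q)) / q
    + (\int[mu]_x (h x * `|u x + t * phi x| `^ s) - \int[mu]_x (h x * `|u x| `^ s)) / s.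
Proof.
move=> phis; have [C C0 HC] := energy_shift_le phis.
exists C => t t1; have tphis := C0inftyZ t phis.
pose a j := (j.+1%:R^-1) ^+ 2 + t * linear_term phi (f j) + t ^+ 2 * C
    - (kfun q k (fun x => f j x + t * phi x) - kfun q k (f j)) / q
    + (hfun s h (fun x => f j x + t * phi x) - hfun s h (f j)) / s.
have a0 j : 0 <= a j.
  have := le_trans (ld_min ld (C0inftyD (ld_f ld j) tphis)) (HC j t t1).
  have := ld_energy ld j; rewrite /a; move: (energy _ _ _ _ _) => e h1 h2.
  rewrite -(lerD2l m) addr0 (le_trans h2)// !addrA.
  by rewrite !lerD2r.
have acv : a @ \oo --> 0 ^+ 2 + t * linear_limit phi + t ^+ 2 * C
    - (\int[mu]_x (k x * `|u x + t * phi x| `^ q) - \int[mu]_x (k x * `|u x| `^ q)) / q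
    + (\int[mu]_x (h x * `|u x + t * phi x| `^ s) - \int[mu]_x (h x * `|u x| `^ s)) / s.
  have v0 : (fun j : nat => j.+1%:R^-1 : R) @ \oo --> 0 by exact: cvg_harmonic.
  apply: cvgD; last by apply: cvgM; [exact: cvg_h_increment|exact: cvg_cst].
  apply: cvgB; last first.
    by apply: cvgM; [apply: cvgB; [exact: cvg_k_limit|exact: cvg_k_limit0]|exact: cvg_cst].
  apply: cvgD; last exact: cvg_cst.
  apply: cvgD; last by apply: cvgM; [exact: cvg_cst|exact: cvg_linear_term].
  by rewrite expr2; apply: cvgM.
rewrite expr0n add0r in acv.
by rewrite -(cvg_lim _ acv)//; apply: limr_ge; [exact: cvgP acv|exact: nearW].
Qed.

Lemma intg_mul_sqr (a b : E -> R) : measurable_fun setT a -> measurable_fun setT b ->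
  intg (fun x => a x ^+ 2) -> intg (fun x => b x ^+ 2) -> intg (fun x => a x * b x).
Proof.
move=> ma mb ia ib; apply: (@intg_le _ _ _ _ _ (fun x => a x ^+ 2 + b x ^+ 2)).
- exact: measurable_funM.
- exact: intgD.
- move=> x; have := mul2_young (a x) (b x) ltr01; rewrite invr1 !mul1r addrC.
  by apply: le_trans; rewrite -mulrA [leRHS]normrM normr_nat ler_peMl// ler1n.
Qed.

Lemma intg_sqrD (a b : E -> R) : measurable_fun setT a -> measurable_fun setT b ->
  intg (fun x => a x ^+ 2) -> intg (fun x => b x ^+ 2) -> intg (fun x => (a x + b x) ^+ 2).
Proof.
move=> ma mb ia ib.
have := intgD (intgD ia ib) (intgZ 2 (intg_mul_sqr ma mb ia ib)).
by apply: eq_intg => x; ring.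
Qed.

Lemma intg_mul_test_sqr psi : C0infty psi -> intg (fun x => (u x * psi x) ^+ 2).
Proof.
move=> psis; have sqs j : C0infty (fun x => f j x ^+ 2).
  by apply: C0inftyM; exact: ld_f ld j.
have [+ _] := dom_cvg_test sqs (ld_sqr ld) p1 (C0inftyM psis psis).
by apply: eq_intg => x; ring.
Qed.

Lemma intg_partial_test_sqr psi i : C0infty psi -> intg (fun x => (g i x * psi x) ^+ 2).
Proof.
move=> psis; have [C C0 psiC] := C0infty_bounded psis.
apply: (@intg_le _ _ _ _ _ (fun x => C ^+ 2 * g i x ^+ 2)).
- apply: measurable_funX; apply: measurable_funM; [exact: limit_partial_measurable|].
  exact: C0infty_measurable.
- by apply: intgZ; exact: limit_partial_intg.
- move=> x; rewrite ger0_norm ?sqr_ge0// exprMn mulrC ler_wpM2r ?sqr_ge0//.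
  by rewrite -(real_normK (num_real (psi x))) ler_sqr ?nnegrE// ltW.
Qed.

Definition gradient_energy phi (t : R) : R :=
  \int[mu]_x ((1 + 2 * (u x + t * phi x) ^+ 2) * \sum_(i < N) (g i x + t * partial i phi x) ^+ 2).

(* (1 + 2 v^2) |dv|^2 = |dv|^2 + 2 |v dv|^2, and for v = u + t phi both dv and
   v dv are polynomials in t with square integrable coefficients. *)
Lemma gradient_energy_poly phi : C0infty phi ->
  (forall t, intg (fun x => (1 + 2 * (u x + t * phi x) ^+ 2) *
     \sum_(i < N) (g i x + t * partial i phi x) ^+ 2)) /\
  exists c0 c2 c3 c4 : R, forall t, gradient_energy phi t =
    c0 + t * (2 * linear_limit phi) + t ^+ 2 * c2 + t ^+ 3 * c3 + t ^+ 4 * c4.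
Proof.
move=> phis; have dphis i := C0infty_partial i phis.
have mphi := C0infty_measurable phis; have mdphi i := C0infty_measurable (dphis i).
have mu_ := limit_measurable; have mg := limit_partial_measurable.
pose X i x := u x * g i x.
pose Y i x := u x * partial i phi x + g i x * phi x.
pose Z i x := phi x * partial i phi x.
have mX i : measurable_fun setT (X i) by exact: measurable_funM.
have mZ i : measurable_fun setT (Z i) by exact: measurable_funM.
have mY i : measurable_fun setT (Y i) by apply: measurable_funD; exact: measurable_funM.
have iX i : intg (fun x => X i x ^+ 2) by exact: limit_mul_partial_intg.
have iY i : intg (fun x => Y i x ^+ 2).
  apply: intg_sqrD; [exact: measurable_funM|exact: measurable_funM| |].
    exact: intg_mul_test_sqr.
  exact: intg_partial_test_sqr.
have iZ i : intg (fun x => Z i x ^+ 2) by apply: C0infty_intg_sqr; exact: C0inftyM.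
have ig i : intg (fun x => g i x ^+ 2) by exact: limit_partial_intg.
have ic i : intg (fun x => partial i phi x ^+ 2) by exact: C0infty_intg_sqr.
have igc i : intg (fun x => g i x * partial i phi x) by exact: intg_mul_sqr.
have iXY i : intg (fun x => X i x * Y i x) by exact: intg_mul_sqr.
have iXZ i : intg (fun x => X i x * Z i x) by exact: intg_mul_sqr.
have iYZ i : intg (fun x => Y i x * Z i x) by exact: intg_mul_sqr.
pose S0 x := \sum_(i < N) (g i x ^+ 2 + 2 * X i x ^+ 2).
pose S1 x := \sum_(i < N) (2 * (g i x * partial i phi x) + 4 * (X i x * Y i x)).
pose S2 x := \sum_(i < N) (partial i phi x ^+ 2 + (2 * Y i x ^+ 2 + 4 * (X i x * Z i x))).
pose S3 x := \sum_(i < N) (4 * (Y i x * Z i x)).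
pose S4 x := \sum_(i < N) (2 * Z i x ^+ 2).
have i0 : intg S0 by apply: intg_sum => i; apply: intgD => //; exact: intgZ.
have i1 : intg S1 by apply: intg_sum => i; apply: intgD; exact: intgZ.
have i2 : intg S2.
  by apply: intg_sum => i; apply: intgD => //; apply: intgD; exact: intgZ.
have i3 : intg S3 by apply: intg_sum => i; exact: intgZ.
have i4 : intg S4 by apply: intg_sum => i; exact: intgZ.
have E t x : S0 x + t * S1 x + t ^+ 2 * S2 x + t ^+ 3 * S3 x + t ^+ 4 * S4 x =
    (1 + 2 * (u x + t * phi x) ^+ 2) * \sum_(i < N) (g i x + t * partial i phi x) ^+ 2.
  rewrite !mulr_sumr -!big_split/=; apply: eq_bigr => i _; rewrite /X /Y /Z; ring.
have k1 t := intgD i0 (intgZ t i1); have k2 t := intgD (k1 t) (intgZ (t ^+ 2) i2).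
have k3 t := intgD (k2 t) (intgZ (t ^+ 3) i3); have k4 t := intgD (k3 t) (intgZ (t ^+ 4) i4).
split=> [t|]; first exact: (eq_intg (E t) (k4 t)).
exists (\int[mu]_x S0 x), (\int[mu]_x S2 x), (\int[mu]_x S3 x), (\int[mu]_x S4 x) => t.
rewrite /gradient_energy -(Rint_eq _ (E t)).
rewrite (RintD (k3 t) (intgZ (t ^+ 4) i4)) (RintD (k2 t) (intgZ (t ^+ 3) i3)).
rewrite (RintD (k1 t) (intgZ (t ^+ 2) i2)) (RintD i0 (intgZ t i1)).
rewrite (RintZ t i1) (RintZ _ i2) (RintZ _ i3) (RintZ _ i4).
do 4! congr (_ + _); congr (_ * _).
rewrite Rint_sum; last by move=> i; apply: intgD; exact: intgZ.
rewrite /linear_limit mulr_sumr; apply: eq_bigr => i _.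
rewrite (RintD (intgZ 2 (igc i)) (intgZ 4 (iXY i))) (RintZ _ (igc i)) (RintZ _ (iXY i)).
rewrite -addrA mulrDr; congr (_ + _).
have [j2 _] := cvg_partial_sqr_limit i phis.
have j1 : intg (fun x => 2 * u x * g i x * u x * partial i phi x).
  have := intgB (intgZ 2 (iXY i)) j2; apply: eq_intg => x; rewrite /X /Y; ring.
rewrite -(RintD j1 j2) -(RintZ 4 (iXY i)) -(RintZ 2 (intgD j1 j2)).
by apply: Rint_eq => x; rewrite /X /Y; ring.
Qed.

(** The weak derivatives chosen in [J] agree almost everywhere with g + t dphi. In particular [J] is
    finite along the whole line. *)
Lemma J_limit_shift phi t : C0infty phi -> J q s k h (fun x => u x + t * phi x) =
  (2^-1 * gradient_energy phi t - q^-1 * \int[mu]_x (k x * `|u x + t * phi x| `^ q)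
   + s^-1 * \int[mu]_x (h x * `|u x + t * phi x| `^ s))%:E.
Proof.
move=> phis; have tphis := C0inftyZ t phis.
have [ig _] := gradient_energy_poly phis.
rewrite /J !EFinD EFinN !EFinM (Rintegral_EFin (ig t)) (Rintegral_EFin (intg_k_limit tphis)).
rewrite (Rintegral_EFin (intg_h_shift tphis)).
congr (_ * _ - _ + _)%E; apply: ae_eq_integral => //.
- apply/measurable_EFinP; apply: measurable_funM.
    apply: measurable_funD => //; apply: measurable_funM => //; apply: measurable_funX.
    by apply: measurable_funD; [exact: limit_measurable|exact: C0infty_measurable].
  apply: measurable_sum => i; apply: measurable_funX.
  by have [_ [mw _] _] := weak_partialP (limit_is_weak_partial i tphis).
- by apply/measurable_EFinP; exact: intg_measurable (ig t).
- apply: filterS (limit_weak_partial_ae tphis) => x wx _; congr EFin; congr (_ * _).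
  by apply: eq_bigr => i _; rewrite wx (partialZ t i (C0infty_smooth phis)).
Qed.

Lemma limit_weak_partial_ae0 :
  {ae mu, forall x, forall i, weak_partial i u x = g i x}.
Proof. by apply: filter_forall => i; apply: weak_partial_ae; exact: limit_weak_partial. Qed.

Lemma J_limit_le : J q s k h u \is a fin_num /\ (J q s k h u <= m%:E)%E.
Proof.
have zs : C0infty (fun _ : E => 0 : R).
  by apply/C0inftyP; split; [exact: smooth_cst|exists 0].
have uE : u = (fun x => u x + 0 * 0) by apply/funext => x; rewrite mulr0 addr0.
rewrite [X in J _ _ _ _ X]uE J_limit_shift//; split=> //; rewrite lee_fin.
have mu_ := limit_measurable.
have e (c : R) (w : E -> R) : \int[mu]_x (w x * `|u x + 0 * 0| `^ c) = \int[mu]_x (w x * `|u x| `^ c).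
  by apply: Rint_eq => x; rewrite mul0r addr0.
rewrite !e.
have i1 : intg (fun x => 2^-1 * \sum_(i < N) g i x ^+ 2).
  by apply: intgZ; apply: intg_sum => i; exact: limit_partial_intg.
have i2 : intg (fun x => \sum_(i < N) (u x * g i x) ^+ 2).
  by apply: intg_sum => i; exact: limit_mul_partial_intg.
have i3 := intgZ s^-1 intg_h_limit.
have := limit_fatou; rewrite -(Rintegral_EFin (intgD (intgD i1 i2) i3)) lee_fin.
rewrite (RintD (intgD i1 i2) i3) (RintZ _ intg_h_limit).
suff -> : 2^-1 * gradient_energy (fun=> 0) 0 =
    \int[mu]_x (2^-1 * (\sum_(i < N) g i x ^+ 2) + \sum_(i < N) (u x * g i x) ^+ 2).
  by move=> H; rewrite addrAC lerBlDr.
have [ig _] := gradient_energy_poly zs.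
rewrite /gradient_energy -(RintZ _ (ig 0)); apply: Rint_eq => x.
rewrite !mulr_sumr -!big_split/=; apply: eq_bigr => i _.
by rewrite !mul0r !addr0; field.
Qed.

(** By [variational_inequality] the function [W] below has a minimum at 0 among |t| <= 1, and its
    term in t^2 does not contribute to the derivative there. *)
Lemma euler_lagrange phi : C0infty phi ->
  let kappa := \int[mu]_x (k x * `|u x| `^ (q - 2) * u x * phi x) in
  let eta := \int[mu]_x (h x * `|u x| `^ (s - 2) * u x * phi x) in
  [/\ intg (fun x => k x * `|u x| `^ (q - 2) * u x * phi x),
      intg (fun x => h x * `|u x| `^ (s - 2) * u x * phi x),
      is_derive (0 : R) 1 (fun t : R => \int[mu]_x (k x * `|u x + t * phi x| `^ q)) (q * kappa),
      is_derive (0 : R) 1 (fun t : R => \int[mu]_x (h x * `|u x + t * phi x| `^ s)) (s * eta) &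
      linear_limit phi = kappa - eta].
Proof.
move=> phis kappa eta; have mu_ := limit_measurable; have mphi := C0infty_measurable phis.
have s1 : 1 < s by rewrite (lt_trans _ s2)// ltr1n.
have ku : intg (fun x => k x * `|u x| `^ q).
  have zs : C0infty (fun _ : E => 0 : R).
    by apply/C0inftyP; split; [exact: smooth_cst|exists 0].
  by apply: eq_intg (intg_k_limit zs) => x; rewrite addr0.
have [ik dk] := is_derive_powR_integral q1 mk k0 mu_ mphi
  (fun t => intg_k_limit (C0inftyZ t phis)) ku (intg_kfun q1 mk k0 kM phis).
have [ih dh] := is_derive_powR_integral s1 mh h0 mu_ mphi
  (fun t => intg_h_shift (C0inftyZ t phis)) intg_h_limit (intg_hfun s2 mh h0 hM phis).
split; [exact: ik|exact: ih|exact: dk|exact: dh|].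
have [C HC] := variational_inequality phis.
pose K (t : R) := \int[mu]_x (k x * `|u x + t * phi x| `^ q).
pose H (t : R) := \int[mu]_x (h x * `|u x + t * phi x| `^ s).
have K0 : K 0 = \int[mu]_x (k x * `|u x| `^ q).
  by apply: Rint_eq => x; rewrite mul0r addr0.
have H0 : H 0 = \int[mu]_x (h x * `|u x| `^ s).
  by apply: Rint_eq => x; rewrite mul0r addr0.
pose P := linear_limit phi *: (@id R) + C *: (@id R) ^+ 2.
pose W := P - q^-1 *: K + s^-1 *: H.
have dP : is_derive (0 : R) 1 P (linear_limit phi).
  have d1 := is_deriveD (is_deriveZ (linear_limit phi) (is_derive_id (0 : R) (1 : R)))
    (is_deriveZ C (is_deriveX 2 (is_derive_id (0 : R) (1 : R)))).
  apply: (is_derive_eq d1).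
  by rewrite expr1 /= [_ *: 1]mulr1 mulr0 scale0r scaler0 addr0.
have dW : is_derive (0 : R) 1 W (linear_limit phi - kappa + eta).
  have d1 := is_deriveD (is_deriveB dP (is_deriveZ q^-1 dk)) (is_deriveZ s^-1 dh).
  apply: (is_derive_eq d1); congr (_ - _ + _).
    exact: (mulKf (lt0r_neq0 q0)).
  exact: (mulKf (lt0r_neq0 s0)).
suff /eqP : linear_limit phi - kappa + eta = 0.
  by rewrite -addrA addr_eq0 opprD opprK => /eqP.
apply: (derivative_at_min dW) => t t1.
have WE r : W r = linear_limit phi * r + C * r ^+ 2 - q^-1 * K r + s^-1 * H r by [].
rewrite -subr_ge0; have := HC t t1; rewrite -K0 -H0 -/(K t) -/(H t) !WE.
move: (K t) (K 0) (H t) (H 0) (linear_limit phi) => a b c d l; clear.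
by congr (0 <= _); ring.
Qed.

Lemma limit_critical : critical q s k h u.
Proof.
move=> phi phis; have [ik ih dk dh EL] := euler_lagrange phis.
have [_ [c0 [c2 [c3 [c4 cE]]]]] := gradient_energy_poly phis.
rewrite (_ : (fun t => _) = fun t : R => 2^-1 * gradient_energy phi t
   - q^-1 * \int[mu]_x (k x * `|u x + t * phi x| `^ q)
   + s^-1 * \int[mu]_x (h x * `|u x + t * phi x| `^ s)); last first.
  by apply/funext => t; rewrite J_limit_shift.
have dG : is_derive (0 : R) 1 (gradient_energy phi) (2 * linear_limit phi).
  rewrite (_ : gradient_energy phi = cst c0 + (2 * linear_limit phi) *: (@id R) +
    c2 *: (@id R) ^+ 2 + c3 *: (@id R) ^+ 3 + c4 *: (@id R) ^+ 4); last first.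
    by apply/funext => t; rewrite cE !fctE /GRing.scale/=; ring.
  have di := is_derive_id (0 : R) (1 : R).
  have d1 := is_deriveD (is_deriveD (is_deriveD (is_deriveD (is_derive_cst c0 (0 : R) (1 : R))
    (is_deriveZ (2 * linear_limit phi) di)) (is_deriveZ c2 (is_deriveX 2 di)))
    (is_deriveZ c3 (is_deriveX 3 di))) (is_deriveZ c4 (is_deriveX 4 di)).
  apply: (is_derive_eq d1); rewrite /GRing.scale/= !expr0n/=; ring.
have d1 := is_deriveD (is_deriveB (is_deriveZ 2^-1 dG) (is_deriveZ q^-1 dk)) (is_deriveZ s^-1 dh).
apply: (is_derive_eq d1).
transitivity (linear_limit phi - \int[mu]_x (k x * `|u x| `^ (q - 2) * u x * phi x)
    + \int[mu]_x (h x * `|u x| `^ (s - 2) * u x * phi x)); last first.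
  by rewrite EL addrAC subrK subrr.
congr (_ - _ + _).
- by apply: mulKf; rewrite pnatr_eq0.
- exact: (mulKf (lt0r_neq0 q0)).
- exact: (mulKf (lt0r_neq0 s0)).
Qed.

Lemma limit_weak_equation : weak_equation q s k h u.
Proof.
move=> phi phis; have [ik ih dk dh EL] := euler_lagrange phis.
rewrite -(Rintegral_EFin ik) -(Rintegral_EFin ih) -EFinB -EL.
have dphis i := C0infty_partial i phis.
have mu_ := limit_measurable; have mphi := C0infty_measurable phis.
have mdphi i := C0infty_measurable (dphis i); have mg := limit_partial_measurable.
have i1 i : intg (fun x => g i x * partial i phi x).
  by apply: intg_mul_sqr => //; [exact: limit_partial_intg|exact: C0infty_intg_sqr].
have i3 i : intg (fun x => 2 * u x * g i x * g i x * phi x) by have [] := cvg_partial_sqr_limit i phis.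
have i2 i : intg (fun x => 2 * u x * g i x * u x * partial i phi x).
  have mug : measurable_fun setT (fun x => u x * g i x) by exact: measurable_funM.
  have muc : measurable_fun setT (fun x => u x * partial i phi x) by exact: measurable_funM.
  have := intgZ 2 (intg_mul_sqr mug muc (limit_mul_partial_intg i) (intg_mul_test_sqr (dphis i))).
  by apply: eq_intg => x; ring.
have it : intg (fun x => \sum_(i < N) (g i x * partial i phi x
    + 2 * u x * g i x * u x * partial i phi x + 2 * u x * g i x * g i x * phi x)).
  by apply: intg_sum => i; apply: intgD => //; exact: intgD.
have -> : linear_limit phi = \int[mu]_x (\sum_(i < N) (g i x * partial i phi x
    + 2 * u x * g i x * u x * partial i phi x + 2 * u x * g i x * g i x * phi x)).
  rewrite Rint_sum => [|i]; last by apply: intgD => //; exact: intgD.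
  apply: eq_bigr => i _.
  by rewrite (RintD (intgD (i1 i) (i2 i)) (i3 i)) (RintD (i1 i) (i2 i)).
rewrite (Rintegral_EFin it); apply: ae_eq_integral => //.
- have mw i : measurable_fun setT (weak_partial i u).
    by have [_ [mw _] _] := weak_partialP (limit_weak_partial i).
  apply/measurable_EFinP; apply: measurable_funD.
    apply: measurable_funM.
      by apply: measurable_funD => //; apply: measurable_funM => //; exact: measurable_funX.
    by apply: measurable_sum => i; exact: measurable_funM.
  apply: measurable_funM => //; apply: measurable_funM; first exact: measurable_funM.
  by apply: measurable_sum => i; exact: measurable_funX.
- by apply/measurable_EFinP; exact: intg_measurable it.
- apply: filterS limit_weak_partial_ae0 => x wx _; congr EFin.
  rewrite /sqr_grad mulr_sumr -mulrA -mulrC -mulrA mulr_suml mulr_sumr mulr_sumr -big_split/=.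
  by apply: eq_bigr => i _; rewrite wx; ring.
Qed.

Lemma limit_solution : weak_solution q s k h u.
Proof.
split; [exact: limit_D12|by have [] := J_limit_le|exact: limit_critical|exact: limit_weak_equation].
Qed.

End limit.

(** * Coefficients defined almost everywhere *)

Section almost_everywhere_coefficients.
Context {R : realType} {N : nat}.
Local Notation E := ('rV[R]_N).
Local Notation mu := (@lebesgue_rV R N).
Variables (q s : R) (k k' h h' : E -> R).
Hypotheses (mk : measurable_fun setT k) (mk' : measurable_fun setT k')
  (mh : measurable_fun setT h) (mh' : measurable_fun setT h').
Hypotheses (kk : {ae mu, forall x, k x = k' x}) (hh : {ae mu, forall x, h x = h' x}).

Let eq_integral_ae (w w' v : E -> R) : measurable_fun setT w -> measurable_fun setT w' ->
  measurable_fun setT v -> {ae mu, forall x, w x = w' x} ->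
  (\int[mu]_x (w x * v x)%:E = \int[mu]_x (w' x * v x)%:E)%E.
Proof.
move=> mw mw' mv ww; apply: ae_eq_integral => //.
- by apply/measurable_EFinP; exact: measurable_funM.
- by apply/measurable_EFinP; exact: measurable_funM.
- by apply: filterS ww => x -> _.
Qed.

Lemma J_ae u : measurable_fun setT u -> J q s k h u = J q s k' h' u.
Proof.
move=> mu_; have mp c : measurable_fun setT (fun x => `|u x| `^ c).
  by apply: (measurableT_comp (measurable_powR _)); exact: measurableT_comp.
by rewrite /J (eq_integral_ae mk mk' (mp q) kk) (eq_integral_ae mh mh' (mp s) hh).
Qed.

Lemma weak_solution_ae u : weak_solution q s k h u -> weak_solution q s k' h' u.
Proof.
move=> [Du Ju cu eu]; have mu_ : measurable_fun setT u.
  by have [/sub_Lfun_mfun + _] := Du; rewrite inE.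
split=> //; first by rewrite -J_ae.
- move=> phi phis; have := cu phi phis; congr (is_derive _ _ _ _).
  apply/funext => t; rewrite J_ae//; apply: measurable_funD => //.
  by apply: measurable_funM => //; exact: C0infty_measurable.
- move=> phi phis; have mphi := C0infty_measurable phis; rewrite (eu phi phis).
  have E1 (w : E -> R) (c : R) : (\int[mu]_x (w x * `|u x| `^ (c - 2) * u x * phi x)%:E =
      \int[mu]_x (w x * (`|u x| `^ (c - 2) * u x * phi x))%:E)%E.
    by apply: eq_integral => x _; rewrite !mulrA.
  have mp c : measurable_fun setT (fun x => `|u x| `^ (c - 2) * u x * phi x).
    apply: measurable_funM => //; apply: measurable_funM => //.
    by apply: (measurableT_comp (measurable_powR _)); exact: measurableT_comp.
  by rewrite !E1 (eq_integral_ae mk mk' (mp q) kk) (eq_integral_ae mh mh' (mp s) hh).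
Qed.

End almost_everywhere_coefficients.

Section coefficient_representative.
Context {R : realType} {N : nat}.
Local Notation E := ('rV[R]_N).
Local Notation mu := (@lebesgue_rV R N).
Implicit Type u : E -> R.

Lemma Lfun_measurable (r : \bar R) u : u \in Lfun mu r -> measurable_fun setT u.
Proof. by move=> /sub_Lfun_mfun; rewrite inE. Qed.

Lemma Lfun_bounded_ae u : u \in Lfun mu +oo%E ->
  exists M : R, {ae mu, forall x, `|u x| <= M}.
Proof.
move=> /sub_Lfun_finLfun; rewrite inE /= /finite_norm unlock.
case: ifPn => [_ uoo|mu0 _].
  by apply: ess_sup_inf.ess_supr_bounded; apply: le_lt_trans uoo; rewrite le_eqVlt; apply/orP; left.
(* The norm for the exponent +oo is defined by cases on the measure of the whole space; if that is
   0, any bound holds almost everywhere. *)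
have {}mu0 : mu setT = 0%E.
  by apply/eqP; rewrite eq_le measure_ge0 andbT leNgt.
by exists 0; exists setT; split.
Qed.

(** The variational part asks for bounds at every point. The clause v <= |u| carries the
    integrability of the r-th power over to [v]. *)
Lemma coefficient_representative u (r : R) : u \in Lfun mu r%:E -> u \in Lfun mu +oo%E ->
  {ae mu, forall x, 0 <= u x} ->
  exists2 v : E -> R, measurable_fun setT v & exists M : R,
    [/\ forall x, 0 <= v x, forall x, v x <= M, forall x, v x <= `|u x| &
        {ae mu, forall x, v x = u x}].
Proof.
move=> /Lfun_measurable mu_ /Lfun_bounded_ae[M uM] u0.
(* The maximum of [M] with 0 keeps the truncation nonnegative without asking for the sign of [M]. *)
pose v x := Num.min (Num.max (u x) 0) (Num.max M 0).
exists v.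
  apply: measurable_minr; last exact: measurable_cst.
  by apply: measurable_maxr => //; exact: measurable_cst.
exists (Num.max M 0); split=> [x|x|x|].
- by rewrite le_min !le_max lexx !orbT.
- by rewrite ge_min lexx orbT.
- by rewrite ge_min ge_max ler_norm normr_ge0.
- apply: filterS2 uM u0 => x uM u0; rewrite /v (max_idPl u0).
  by apply/min_idPl; rewrite le_max (le_trans (ler_norm _) uM).
Qed.

End coefficient_representative.

Theorem theorem1p2 (R : realType) (N : nat) (q s : R) (k h : 'rV[R]_N -> R) :
  (3 <= N)%N ->
  1 < q -> q < 2 -> 2 < s ->
  let q0 : R := (2 * N)%:R / ((2 * N)%:R - q * (N - 2)%:R) in
  k \in Lfun (lebesgue_rV N) q0%:E ->
  k \in Lfun (lebesgue_rV N) +oo%E ->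
  {ae lebesgue_rV N, forall x, 0 <= k x} ->
  ~ {ae lebesgue_rV N, forall x, k x = 0} ->
  h \in Lfun (lebesgue_rV N) 1%:E ->
  h \in Lfun (lebesgue_rV N) +oo%E ->
  {ae lebesgue_rV N, forall x, 0 <= h x} ->
  exists u : 'rV[R]_N -> R,
    [/\ weak_solution q s k h u,
        {ae lebesgue_rV N, forall x, 0 <= u x} &
        (J q s k h u < 0)%E].
Proof.
case: N k h => [|[|[|n]]]// k h _ q1 q2 s2 q0 kq koo k0 kN0 h1 hoo h0.
pose p := @crit_exp R n.+3.
have q0E : q0 = p / (p - q).
  rewrite /q0 /p /crit_exp subn2/=.
  have n0 : n.+1%:R != 0 :> R by rewrite pnatr_eq0.
  have d0 : (2 * n.+3)%:R - q * n.+1%:R != 0 :> R.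
    rewrite gt_eqF// subr_gt0 natrM; apply: (@lt_le_trans _ _ (2 * n.+1%:R)).
      by rewrite ltr_pM2r// ltr0n.
    by rewrite ler_pM2l// ler_nat -addn2 leq_addr.
  by move: (2 * n.+3)%:R n.+1%:R n0 d0 => a b b0 d0; field; rewrite b0 mulNr d0.
(* An exponent at least 1 is what integrability of |k|^q0 is deduced from, by [Lfun_integrable]. *)
have q01 : 1 <= q0.
  have pq : 0 < p - q by rewrite subr_gt0 (lt_trans q2)// crit_exp_gt2.
  by rewrite q0E ler_pdivlMr// mul1r gerBl ltW// (lt_trans _ q1).
have [k' mk' [Mk [k'0 k'M k'le k'k]]] := coefficient_representative kq koo k0.
have [h' mh' [Mh [h'0 h'M _ h'h]]] := coefficient_representative h1 hoo h0.
have ki : (@lebesgue_rV R n.+3).-integrable setT (EFin \o (fun x => k' x `^ (p / (p - q)))).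
  rewrite -q0E; apply: intg_le (Lfun_integrable q01 kq) _.
    exact: (measurableT_comp (measurable_powR _)).
  move=> x; rewrite ger0_norm ?powR_ge0//; apply: ge0_ler_powR; rewrite ?nnegrE//.
  by rewrite (le_trans _ q01).
have k'N0 : ~ {ae @lebesgue_rV R n.+3, forall x, k' x = 0}.
  by apply: contra_not kN0 => k'z; apply: filterS2 k'k k'z => x <-.
have [phi phis Jphi] := energy_neg q1 q2 s2 mk' k'0 k'M mh' h'0 h'M k'N0.
have [m [f [y [u [g ld]]]]] := limit_dataP q1 q2 s2 mk' k'0 k'M ki mh' h'0 h'M.
have sol := limit_solution q1 q2 s2 mk' k'0 k'M ki mh' h'0 h'M ld.
have [_ Jm] := J_limit_le q1 q2 s2 mk' k'0 k'M ki mh' h'0 h'M ld.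
have mk := Lfun_measurable kq; have mh := Lfun_measurable h1.
exists u; split.
- exact: weak_solution_ae sol.
- by apply: nearW => x; exact: ld_u0 ld x.
(* J(u) <= m, and m is at most the energy of [phi], which is negative. *)
- rewrite -(J_ae _ _ mk' mk mh' mh k'k h'h); last exact: limit_measurable ld.
  by rewrite (le_lt_trans Jm)// lte_fin (le_lt_trans (ld_min ld phis)).
Qed.
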